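(* The following two decision problems are NP-complete: (1) given a deterministic generalised Büchi automaton $\mathcal{A}$ and a number $n$, decide whether there is a deterministic generalised Büchi automaton with at most $n$ states recognising $\mathcal{L}(\mathcal{A})$; (2) given a deterministic generalised coBüchi automaton $\mathcal{A}$ and a number $n$, decide whether there is a deterministic generalised coBüchi automaton with at most $n$ states recognising $\mathcal{L}(\mathcal{A})$.
   Context: An automaton is a tuple $(Q,\Sigma,q_{\mathrm{init}},\Delta,\Gamma,\mathrm{col},W)$ with finite state set $Q$, finite input alphabet $\Sigma$, initial state, transitions $\Delta\subseteq Q\times\Sigma\times Q$, output alphabet $\Gamma$, transition labelling $\mathrm{col}:\Delta\to\Gamma$ and acceptance condition $W\subseteq\Gamma^\omega$. A run on $w=a_1a_2\cdots$ is a sequence of transitions $(q_0,a_1,q_1)(q_1,a_2,q_2)\cdots$ with $q_0=q_{\mathrm{init}}$, accepting if its label sequence lies in $W$; the recognised language is the set of words with an accepting run. With a finite set $C$ of $k$ output colours and $\Gamma=2^C$: generalised Büchi means $W=\{x : \text{every } c\in C \text{ occurs in infinitely many letters of } x\}$; generalised coBüchi means $W=\{x : \text{some } c\in C \text{ occurs in only finitely many letters of } x\}$. Such an automaton is described with size polynomial in $|Q|+|\Sigma|+k$. Deterministic: for every $(p,a)\in Q\times\Sigma$ there is at most one $q$ with $(p,a,q)\in\Delta$. *)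

(* Defs.v *)
From Corelib Require Import BinNums.
From mathcomp Require Import all_boot.
Set Implicit Arguments. Unset Strict Implicit. Unset Printing Implicit Defensive.

(* Head moves are encoded as [option bool]:
   None = stay, Some false = move left, Some true = move right. *)
Definition move := option bool.

(* Tape symbols of a machine with [k] extra symbols:
   None = blank, Some (inl b) = input bit b, Some (inr i) = extra symbol i. *)
Definition tsym (k : nat) := option (bool + 'I_k)%type.

(* A (possibly nondeterministic) Turing machine; the transition function
   lists all possible moves (an empty list means the machine halts). *)
Record TM := MkTM {
  tm_k : nat;
  tm_st : finType;
  tm_start : tm_st;
  tm_acc : pred tm_st;
  tm_delta : tm_st -> tsym tm_k -> seq (tm_st * tsym tm_k * move)
}.

(* Configuration: state, tape left of head (nearest first), head symbol,
   tape right of head (nearest first); the tape is blank beyond these. *)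
Record config (M : TM) := Cfg {
  c_st : tm_st M;
  c_left : seq (tsym (tm_k M));
  c_head : tsym (tm_k M);
  c_right : seq (tsym (tm_k M))
}.

Definition apply_tr (M : TM) (c : config M)
    (x : tm_st M * tsym (tm_k M) * move) : config M :=
  let: (q', a, m) := x in
  match m with
  | None => Cfg q' (c_left c) a (c_right c)
  | Some false =>
      match c_left c with
      | [::] => Cfg q' [::] None (a :: c_right c)
      | y :: l => Cfg q' l y (a :: c_right c)
      end
  | Some true =>
      match c_right c with
      | [::] => Cfg q' (a :: c_left c) None [::]
      | y :: r => Cfg q' (a :: c_left c) y r
      end
  end.

Definition tm_step (M : TM) (c c' : config M) : Prop :=
  exists2 x, x \in @tm_delta M (c_st c) (c_head c) & c' = apply_tr c x.

Fixpoint reach (M : TM) (t : nat) (c c' : config M) : Prop :=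
  match t with
  | 0 => c' = c
  | t'.+1 => exists c1, tm_step c c1 /\ reach t' c1 c'
  end.

Definition bitsym (M : TM) (b : bool) : tsym (tm_k M) := Some (inl b).

Definition init_cfg (M : TM) (w : seq bool) : config M :=
  match w with
  | [::] => Cfg (tm_start M) [::] None [::]
  | b :: w' => Cfg (tm_start M) [::] (bitsym M b) (map (bitsym M) w')
  end.

Definition halted (M : TM) (c : config M) : Prop :=
  @tm_delta M (c_st c) (c_head c) = [::].

Definition deterministic (M : TM) : Prop :=
  forall q a, size (@tm_delta M q a) <= 1.

Fixpoint read_bits (k : nat) (s : seq (tsym k)) : seq bool :=
  match s with
  | Some (inl b) :: s' => b :: read_bits s'
  | _ => [::]
  end.

Definition output (M : TM) (c : config M) : seq bool :=
  read_bits (c_head c :: c_right c).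

(* Polynomial bounds c * n^c + c (every polynomial is dominated by one). *)
Definition pbound (c n : nat) : nat := c * n ^ c + c.

Definition language := seq bool -> Prop.

Definition poly_computable (f : seq bool -> seq bool) : Prop :=
  exists (M : TM) (c : nat), deterministic M /\
    forall w, exists (t : nat) (cf : config M),
      [/\ t <= pbound c (size w), reach t (init_cfg M w) cf, halted cf
        & output cf = f w].

Definition in_NP (L : language) : Prop :=
  exists (M : TM) (c : nat), forall w,
    L w <-> exists (t : nat) (cf : config M),
      [/\ t <= pbound c (size w), reach t (init_cfg M w) cf & @tm_acc M (c_st cf)].

Definition karp_reduces (L1 L2 : language) : Prop :=
  exists f, poly_computable f /\ forall w, L1 w <-> L2 (f w).

Definition NP_hard (L : language) : Prop :=
  forall L', in_NP L' -> karp_reduces L' L.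

Definition NP_complete (L : language) : Prop := in_NP L /\ NP_hard L.

(* States are 0..nQ-1, letters 0..nS-1, output colours C = {0..nC-1};     *)
(* a transition (p,a,q) carries its label col(p,a,q) ⊆ C (a list).        *)

Record trans := Tr { t_src : nat; t_let : nat; t_dst : nat; t_col : seq nat }.

Record aut := Aut {
  a_nQ : nat; a_nS : nat; a_nC : nat; a_init : nat; a_tr : seq trans
}.

Definition wf_det (A : aut) : bool :=
  [&& a_init A < a_nQ A,
      all (fun t => [&& t_src t < a_nQ A, t_let t < a_nS A, t_dst t < a_nQ A,
                       all (fun c => c < a_nC A) (t_col t) & uniq (t_col t)])
          (a_tr A)
    & uniq [seq (t_src t, t_let t) | t <- a_tr A]].

Definition tr0 : trans := Tr 0 0 0 [::].

Definition is_word (nS : nat) (w : nat -> nat) : Prop := forall i, w i < nS.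

(* A run on w: a sequence of transitions (given by indices in a_tr). *)
Definition is_run (A : aut) (w : nat -> nat) (rho : nat -> nat) : Prop :=
  [/\ forall i, rho i < size (a_tr A),
      t_src (nth tr0 (a_tr A) (rho 0)) = a_init A,
      forall i, t_let (nth tr0 (a_tr A) (rho i)) = w i
    & forall i, t_dst (nth tr0 (a_tr A) (rho i)) = t_src (nth tr0 (a_tr A) (rho i.+1))].

Definition label (A : aut) (rho : nat -> nat) (i : nat) : seq nat :=
  t_col (nth tr0 (a_tr A) (rho i)).

Definition genBuchi_acc (A : aut) (rho : nat -> nat) : Prop :=
  forall c, c < a_nC A -> forall N, exists i, N <= i /\ c \in label A rho i.

Definition genCoBuchi_acc (A : aut) (rho : nat -> nat) : Prop :=
  exists c, c < a_nC A /\ exists N, forall i, N <= i -> c \notin label A rho i.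

Definition accepts_GB (A : aut) (w : nat -> nat) : Prop :=
  exists rho, is_run A w rho /\ genBuchi_acc A rho.

Definition accepts_GcoB (A : aut) (w : nat -> nat) : Prop :=
  exists rho, is_run A w rho /\ genCoBuchi_acc A rho.

(* nQ, nS, nC in unary (so the size is polynomial in |Q|+|Σ|+k and vice   *)
(* versa); all other numbers (state/letter/colour names, n) in binary.    *)

Fixpoint pos_bits (p : positive) : seq bool :=
  match p with
  | xH => [:: true]
  | xO p' => false :: pos_bits p'
  | xI p' => true :: pos_bits p'
  end.

Definition bin (n : nat) : seq bool :=
  match bin_of_nat n with N0 => [::] | Npos p => pos_bits p end.

(* self-delimiting binary encoding: doubled bits, terminated by 01 *)
Definition enc_nat (n : nat) : seq bool :=
  flatten [seq [:: b; b] | b <- bin n] ++ [:: false; true].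

Definition enc_unary (n : nat) : seq bool := nseq n true ++ [:: false].

Definition enc_list (s : seq nat) : seq bool :=
  enc_nat (size s) ++ flatten (map enc_nat s).

Definition enc_trans (t : trans) : seq bool :=
  enc_nat (t_src t) ++ enc_nat (t_let t) ++ enc_nat (t_dst t) ++ enc_list (t_col t).

Definition enc_aut (A : aut) : seq bool :=
  enc_unary (a_nQ A) ++ enc_unary (a_nS A) ++ enc_unary (a_nC A) ++
  enc_nat (a_init A) ++ enc_nat (size (a_tr A)) ++ flatten (map enc_trans (a_tr A)).

Definition enc_inst (A : aut) (n : nat) : seq bool := enc_aut A ++ enc_nat n.

Definition DGBW_min : language := fun x =>
  exists (A : aut) (n : nat), [/\ x = enc_inst A n, wf_det A &
    exists B : aut, [/\ wf_det B, a_nQ B <= n, a_nS B = a_nS A &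
      forall w, is_word (a_nS A) w -> (accepts_GB A w <-> accepts_GB B w)]].

Definition DGCW_min : language := fun x =>
  exists (A : aut) (n : nat), [/\ x = enc_inst A n, wf_det A &
    exists B : aut, [/\ wf_det B, a_nQ B <= n, a_nS B = a_nS A &
      forall w, is_word (a_nS A) w -> (accepts_GcoB A w <-> accepts_GcoB B w)]].

(* Main.v *)
Require Import Defs.
From Stdlib Require Import Classical.
From mathcomp Require Import all_boot zify.
Set Implicit Arguments. Unset Strict Implicit. Unset Printing Implicit Defensive.

(**
Adding a sink turns both acceptance conditions, up to complementation, into "every colour occurs
infinitely often" for complete deterministic automata.

Membership in NP. If every run of the product of [A] and [B] that sees all colours of [A] infinitely
often does so for colour [d] of [B], then in the product without the [d]-transitions every strongly
connected component avoids some colour of [A]; a rank function decreasing between components,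
together with the avoided colours, certifies this. Only polynomially many colours of [B] are needed
for such certificates in both directions, so [B] and the certificates can be guessed.

Hardness. A computation tableau of a nondeterministic machine is a system of binary constraints
between cells of consecutive rows. As rows alternate in parity, the constraints are expressed by
proper colourings of a graph with a number [N] of colours depending on the machine only. From the
graph one builds an automaton with [N] interchangeable roots and one state per vertex, in which a
word is accepted iff each edge [u v] infinitely often either sees a vertex outside it or has [u]
marked. Two adjacent vertices cannot share a state below the same root, and an equivalent automaton
with [2 N] states has at least one root represented by a single state and at most [N] states for the
vertices, which is a colouring.

Polynomial-time computability. Expressions built from addition, multiplication, comparison and
iteration with values cut at a given bound are compiled to a register machine, which is simulated on
a single tape; the reduction and the certificate check are written as such expressions.
*)

(** The number of colours of [B] is not part of the input and [n] is written in binary, so neither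
    bounds a guess. The second is harmless, as [A] itself is a witness once [n] reaches its number
    of states; the first forces the detour through certificates, which are extracted from an
    arbitrary [B] and show which of its colours to keep. The verifier never parses its input: it
    guesses tables, writes out the instance they describe and compares, so only encoders have to be
    programmed.

    One root would not do for hardness: an equivalent automaton could split it into several states
    and use different vertex classes below each. With [N] roots, splitting all of them takes [2 N]
    states and leaves none for the vertices; and since each root needs a state of its own, at most
    [N] remain for vertices. Adjacent [u < v] are kept apart by marking: the loop that reads [u],
    marks, reads [v] and returns shows every colour, the loop with [u] and [v] exchanged misses that
    of the edge, yet from an unsplit root an automaton merging them takes the same transitions in
    both. *)

Section TapeView.
Variable M : TM.
Implicit Types (c : config M) (x : tm_st M * tsym (tm_k M) * move).

(** The tape by absolute cell number, the head standing at [h], so that moves become shifts of [h].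
    Cell 0 has no left neighbour in this numbering, whence the side condition of [symat_apply]. *)
Definition symat c (h i : nat) : tsym (tm_k M) :=
  if i < h then nth None (c_left c) (h - i.+1)
  else if i == h then c_head c else nth None (c_right c) (i - h.+1).

Definition shift_pos (h : nat) (m : move) : nat :=
  match m with None => h | Some true => h.+1 | Some false => h.-1 end.

Lemma symat_head c h : symat c h h = c_head c.
Proof. by rewrite /symat ltnn eqxx. Qed.

Lemma symat_apply c x h i : (x.2 = Some false -> 0 < h) ->
  symat (apply_tr c x) (shift_pos h x.2) i = if i == h then x.1.2 else symat c h i.
Proof.
case: x => [[q a] m] /= H; case: c => q0 l y r.
case: m H => [[]|] H; rewrite /symat /=.
- case: r => [|z r] /=; case: (ltngtP i h) => h1.
  + by rewrite ltnS (ltnW h1) subSS -(prednK (_ : 0 < h - i)) ?subn_gt0 //= subnS.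
  + rewrite ltnNge h1 /= ; case: (i =P h.+1) => [->|h2]; last by rewrite !nth_default.
    by rewrite subnn.
  + by rewrite h1 ltnSn subnn.
  + by rewrite ltnS (ltnW h1) subSS -(prednK (_ : 0 < h - i)) ?subn_gt0 //= subnS.
  + rewrite ltnNge h1 /= ; case: (i =P h.+1) => [->|h2]; first by rewrite subnn.
    have -> : i - h.+1 = (i - h.+2).+1 by lia.
    by [].
  + by rewrite h1 ltnSn subnn.
- case: h H => [/(_ erefl)//|h] _ /=.
  case: l => [|z l] /=; case: (ltngtP i h.+1) => h1.
  + rewrite ltnS in h1; case: (ltngtP i h) h1 => // h2 _; first by rewrite !nth_default.
    by rewrite nth_nil.
  + have -> : i < h = false by lia.
    have -> : i == h = false by lia.
    by have -> : i - h.+1 = (i - h.+2).+1 by lia.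
  + have -> : i < h = false by lia.
    have -> : i == h = false by lia.
    by rewrite h1 subnn.
  + rewrite ltnS in h1; case: (ltngtP i h) h1 => // h2 _.
      by have -> : h.+1 - i.+1 = (h - i.+1).+1 by lia.
    by rewrite h2 subnn.
  + have -> : i < h = false by lia.
    have -> : i == h = false by lia.
    by have -> : i - h.+1 = (i - h.+2).+1 by lia.
  + have -> : i < h = false by lia.
    have -> : i == h = false by lia.
    by rewrite h1 subnn.
- by case: ltngtP.
Qed.

Lemma reach_cat t1 t2 c1 c2 c3 : reach t1 c1 c2 -> reach t2 c2 c3 -> reach (t1 + t2) c1 c3.
Proof.
elim: t1 c1 => [|t IH] c1 /= => [->//|[c' [s r]] r2].
by exists c'; split=> //; apply: IH.
Qed.

Lemma c_st_apply c x : c_st (apply_tr c x) = x.1.1.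
Proof.
by case: x => [[q a] [[]|]] //=; [case: (c_right c) | case: (c_left c)].
Qed.

(** Stretches with a unique successor at each step and no accepting state before the last.
    Acceptance counts wherever it occurs, so only such a stretch can be cut off from the front of
    every accepting run, as [dpath_acc] does. *)
Inductive dpath : nat -> config M -> config M -> Prop :=
| dpath0 c : dpath 0 c c
| dpathS c x n c' : @tm_delta M (c_st c) (c_head c) = [:: x] -> ~~ @tm_acc M (c_st c) ->
    dpath n (apply_tr c x) c' -> dpath n.+1 c c'.

Lemma dpath_reach n c c' : dpath n c c' -> reach n c c'.
Proof.
elim=> [//|{}c x {}n {}c' e _ _ r] /=.
by exists (apply_tr c x); split=> //; exists x => //; rewrite e mem_head.
Qed.

Lemma dpath_cat n1 n2 c1 c2 c3 : dpath n1 c1 c2 -> dpath n2 c2 c3 -> dpath (n1 + n2) c1 c3.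
Proof. by elim=> [//|c x n c' e a _ IH] h; apply: (dpathS e a); apply: IH. Qed.

Lemma dpath1 c x : @tm_delta M (c_st c) (c_head c) = [:: x] -> ~~ @tm_acc M (c_st c) ->
  dpath 1 c (apply_tr c x).
Proof. by move=> e a; apply: (dpathS e a); constructor. Qed.

Lemma dpath_acc n c c' t ca : dpath n c c' -> reach t c ca -> @tm_acc M (c_st ca) ->
  exists2 t', t = n + t' & reach t' c' ca.
Proof.
move=> d; elim: d t => [{}c|{}c x {}n {}c' e a _ IH] t; first by exists t.
case: t => [|t] /=; first by move=> -> h; rewrite h in a.
case=> c1 [[y]]; rewrite e inE => /eqP-> -> r h.
by case: (IH _ r h) => t' -> ?; exists t'.
Qed.

End TapeView.

Lemma read_bits_mkseq k (s : seq (tsym k)) (f : nat -> bool) len :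
  (forall i, i < len -> nth None s i = Some (inl (f i))) -> nth None s len = None ->
  read_bits s = mkseq f len.
Proof.
rewrite /mkseq; elim: len s f => [|n IH] [|y s] f H0 H1 //=.
- by rewrite /= in H1; rewrite H1.
- by have := H0 0 isT.
have := H0 0 isT => /= ->; congr (_ :: _).
rewrite -[1]addn0 iotaDl -map_comp (IH s (f \o S)) => [|i Hi|] //; exact: (H0 i.+1).
Qed.

(** * A register machine simulated on one tape *)

(* An instruction of the simulating machine walks from the home cell to the first
   cell satisfying [mstop], rewrites it and its right neighbour, walks back and
   finally rewrites the home cell. *)
Record minstr (C : Type) := MInstr {
  mstop : C -> bool; mout : C -> bool; mrew1 : C -> C; mrew2 : C -> C; mrewh : C -> C }.

Section Machine.
Variable R : nat.

Definition cell := ({ffun 'I_3 -> option bool} * {ffun 'I_R.+1 -> bool})%type.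
Definition input_cell (o : option bool) : cell :=
  ([ffun a => if a == ord0 then o else None], [ffun=> false]).
(** Raw input symbols and blanks already count as unmarked cells, so the input needs no pass that
    converts it. *)
Definition mkcell (a : tsym #|{: cell}|) : cell :=
  match a with
  | None => input_cell None
  | Some (inl b) => input_cell (Some b)
  | Some (inr i) => enum_val i
  end.
Definition cellsym (c : cell) : tsym #|{: cell}| := Some (inr (enum_rank c)).
Lemma cellsymK c : mkcell (cellsym c) = c.
Proof. by rewrite /= enum_rankK. Qed.

Definition home (c : cell) : bool := c.2 ord0.
Definition outbit (c : cell) : option bool := c.1 (inord 1).

Variables (P : finType) (pstart : P) (fetch : P -> minstr cell)
  (next : P -> bool -> seq (option P)).

(* [inl (p, None)]: walking right; [inl (p, Some (false, o))]: on the right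
   neighbour of the stop cell; [inl (p, Some (true, o))]: walking home.
   [inr None]: start; [inr (Some None)]: program finished;
   [inr (Some (Some false))]: converting the output track; [inr (Some (Some true))]: halted. *)
Definition mstate : finType := ((P * option (bool * bool)) + option (option bool))%type.

Definition goto (x : option P) : mstate :=
  if x is Some p then inl (p, None) else inr (Some None).

Definition outsym (c : cell) : tsym #|{: cell}| :=
  if outbit c is Some b then Some (inl b) else None.

Definition mdelta (q : mstate) (a : tsym #|{: cell}|) :
    seq (mstate * tsym #|{: cell}| * move) :=
  let c := mkcell a in
  match q with
  | inl (p, None) =>
      if mstop (fetch p) c
      then [:: (inl (p, Some (false, mout (fetch p) c)), cellsym (mrew1 (fetch p) c), Some true)]
      else [:: (inl (p, None), cellsym c, Some true)]
  | inl (p, Some (false, o)) =>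
      [:: (inl (p, Some (true, o)), cellsym (mrew2 (fetch p) c), Some false)]
  | inl (p, Some (true, o)) =>
      if home c then [seq (goto x, cellsym (mrewh (fetch p) c), None) | x <- next p o]
      else [:: (q, cellsym c, Some false)]
  | inr None => [:: (goto (Some pstart), cellsym (c.1, [ffun=> true]), None)]
  | inr (Some None) =>
      if outbit c is Some _ then [:: (q, cellsym c, Some true)]
      else if home c then [:: (inr (Some (Some true)), None, None)]
      else [:: (inr (Some (Some false)), None, Some false)]
  | inr (Some (Some false)) =>
      if home c then [:: (inr (Some (Some true)), outsym c, None)]
      else [:: (q, outsym c, Some false)]
  | inr (Some (Some true)) => [::]
  end.

(** Reaching the end of the program accepts. The output track is converted only after that point, so
    one construction serves both for deciding and for computing. *)
Definition machine : TM :=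
  @MkTM #|{: cell}| mstate (inr None) (pred1 (inr (Some None))) mdelta.

Implicit Types (cf : config machine) (T : nat -> cell).

Definition rep cf T h := forall i, mkcell (symat cf h i) = T i.
Definition updf A (T : nat -> A) i c := fun j => if j == i then c else T j.

Lemma rep_apply cf T h x : rep cf T h -> (x.2 = Some false -> 0 < h) ->
  rep (apply_tr cf x) (updf T h (mkcell x.1.2)) (shift_pos h x.2).
Proof. by move=> r H i; rewrite symat_apply // /updf; case: eqP. Qed.

Lemma rep_ext cf T T' h : (forall i, T i = T' i) -> rep cf T h -> rep cf T' h.
Proof. by move=> e r i; rewrite -e. Qed.

Lemma rep_head cf T h : rep cf T h -> mkcell (c_head cf) = T h.
Proof. by move=> r; rewrite -r symat_head. Qed.

Definition at_state cf q T h := c_st cf = q /\ rep cf T h.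

Lemma walk_right p cf T h n : at_state cf (inl (p, None)) T h ->
  (forall i, h <= i < h + n -> ~~ mstop (fetch p) (T i)) ->
  exists2 cf', dpath n cf cf' & at_state cf' (inl (p, None)) T (h + n).
Proof.
elim: n cf h => [|n IH] cf h [e r] H.
  by exists cf; [constructor | rewrite addn0].
have hs := rep_head r.
set x : mstate * tsym #|{: cell}| * move := (inl (p, None), cellsym (T h), Some true).
have [|i Hi|cf' d a] := IH (apply_tr cf x) h.+1.
- split; first by rewrite c_st_apply.
  apply: rep_ext (rep_apply r _) => // i; rewrite /updf; case: eqP => // ->.
  by rewrite cellsymK.
- by apply: H; lia.
exists cf'; last by rewrite -addSnnS.
rewrite -add1n; apply: dpath_cat d; apply: dpath1.
  by rewrite e /= hs (negbTE (H h _)) //; lia.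
by rewrite e.
Qed.

Lemma walk_left q cf T h : (forall a, mdelta q a =
    if home (mkcell a) then mdelta q a else [:: (q, cellsym (mkcell a), Some false)]) ->
  q != inr (Some None) -> at_state cf q T h ->
  (forall i, home (T i) = (i == 0)) ->
  exists2 cf', dpath h cf cf' & at_state cf' q T 0.
Proof.
move=> Hq nq; elim: h cf => [|h IH] cf [e r] H; first by exists cf => //; constructor.
have hs := rep_head r.
set x : mstate * tsym #|{: cell}| * move := (q, cellsym (T h.+1), Some false).
have [||cf' d a] // := IH (apply_tr cf x).
- split; first by rewrite c_st_apply.
  apply: rep_ext (rep_apply r _) => // i; rewrite /updf; case: eqP => // ->.
  by rewrite cellsymK.
exists cf' => //.
rewrite -add1n; apply: dpath_cat d; apply: dpath1; last by rewrite e.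
by rewrite e /= Hq hs H /=.
Qed.

Definition meffect (m : minstr cell) T v :=
  let T1 := updf (updf T v (mrew1 m (T v))) v.+1 (mrew2 m (T v.+1)) in
  updf T1 0 (mrewh m (T1 0)).

Lemma instr_path p cf T v :
  at_state cf (inl (p, None)) T 0 -> mstop (fetch p) (T v) ->
  (forall i, i < v -> ~~ mstop (fetch p) (T i)) ->
  (forall i, home (updf (updf T v (mrew1 (fetch p) (T v))) v.+1
                        (mrew2 (fetch p) (T v.+1)) i) = (i == 0)) ->
  exists2 cf', dpath (2 * v + 2) cf cf' &
    [/\ ~~ tm_acc (c_st cf'),
        @tm_delta machine (c_st cf') (c_head cf') =
          [seq (goto x, cellsym (mrewh (fetch p)
             (updf (updf T v (mrew1 (fetch p) (T v))) v.+1 (mrew2 (fetch p) (T v.+1)) 0)), None)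
           | x <- next p (mout (fetch p) (T v))] &
        forall x, x \in next p (mout (fetch p) (T v)) ->
          at_state (apply_tr cf' (goto x, cellsym (mrewh (fetch p)
             (updf (updf T v (mrew1 (fetch p) (T v))) v.+1 (mrew2 (fetch p) (T v.+1)) 0)), None))
            (goto x) (meffect (fetch p) T v) 0].
Proof.
move=> a Hv Hn Hh.
have [|cf1 d1 [e1 r1]] := @walk_right p cf T 0 v a; first by move=> i; apply: Hn.
have hs1 := rep_head r1; rewrite add0n in hs1 r1.
set m := fetch p in Hv Hn Hh hs1 *; set o := mout m (T v).
pose x2 : mstate * tsym #|{: cell}| * move :=
  (inl (p, Some (false, o)), cellsym (mrew1 m (T v)), Some true).
set cf2 := apply_tr cf1 x2.
have d2 : dpath 1 cf1 cf2.
  by apply: dpath1; rewrite e1 //= hs1 Hv.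
have r2 : rep cf2 (updf T v (mrew1 m (T v))) v.+1.
  by have := @rep_apply _ _ _ x2 r1; rewrite cellsymK; apply.
have hs2 := rep_head r2; rewrite /updf eqn_leq ltnn /= in hs2.
pose x3 : mstate * tsym #|{: cell}| * move :=
  (inl (p, Some (true, o)), cellsym (mrew2 m (T v.+1)), Some false).
set cf3 := apply_tr cf2 x3.
have e2 : c_st cf2 = inl (p, Some (false, o)) by rewrite c_st_apply.
have d3 : dpath 1 cf2 cf3.
  by apply: dpath1; rewrite e2 //= hs2.
set T1 := updf (updf T v (mrew1 m (T v))) v.+1 (mrew2 m (T v.+1)) in Hh *.
have r3 : rep cf3 T1 v.
  by have := @rep_apply _ _ _ x3 r2; rewrite cellsymK; apply.
have [|||cf4 d4 [e4 r4]] := @walk_left (inl (p, Some (true, o))) cf3 T1 v _ _ _ Hh.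
- by move=> y /=; case: (home _).
- by [].
- by split=> //; rewrite c_st_apply.
exists cf4.
  have -> : 2 * v + 2 = v + (1 + (1 + v)) by lia.
  exact: dpath_cat d1 (dpath_cat d2 (dpath_cat d3 d4)).
have hs4 := rep_head r4.
split; first by rewrite e4.
  by rewrite e4 /= hs4 Hh.
move=> x xin; split; first by rewrite c_st_apply.
have := @rep_apply _ _ _ ((goto x, cellsym (mrewh m (T1 0)), None) : mstate * tsym #|{: cell}| * move) r4.
by rewrite cellsymK; apply.
Qed.

(** The first cell with empty output track is blanked because [read_bits] must stop there. The bits
    are written on the way back, since the head has to end on the first of them. *)
Lemma output_path cf T len :
  at_state cf (inr (Some None)) T 0 -> (forall i, home (T i) = (i == 0)) ->
  (forall i, i < len -> isSome (outbit (T i))) -> outbit (T len) = None ->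
  exists t cf', [/\ t <= 2 * len + 1, reach t cf cf', halted cf' &
    output cf' = mkseq (fun i => odflt false (outbit (T i))) len].
Proof.
move=> [e r] Hh Ho Hl.
have fwd n : n <= len -> exists2 cf1 : config machine, reach n cf cf1 & at_state cf1 (inr (Some None)) T n.
  elim: n => [_|n IH ln]; first by exists cf.
  have [cf1 r1 [e1 rp1]] := IH (ltnW ln).
  pose x : mstate * tsym #|{: cell}| * move := (inr (Some None), cellsym (T n), Some true).
  exists (apply_tr cf1 x).
    rewrite -addn1; apply: reach_cat r1 _; exists (apply_tr cf1 x); split=> //.
    exists x => //; rewrite e1 /= (rep_head rp1).
    by case: (outbit _) (Ho _ ln) => // b _; rewrite mem_head.
  split; first by rewrite c_st_apply.
  apply: rep_ext (rep_apply rp1 _) => // i; rewrite /updf; case: eqP => // ->.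
  by rewrite cellsymK.
have [cf1 r1 [e1 rp1]] := fwd len (leqnn _).
have hs1 := rep_head rp1.
have fin cfe : (forall i, i < len -> symat cfe 0 i = Some (inl (odflt false (outbit (T i))))) ->
    symat cfe 0 len = None -> output cfe = mkseq (fun i => odflt false (outbit (T i))) len.
  move=> H0 H1; have E i : symat cfe 0 i = nth None (c_head cfe :: c_right cfe) i.
    by rewrite /symat /=; case: i => [|i] //=; rewrite subSS subn0.
  rewrite /output; move: (c_head cfe :: c_right cfe) E => s E.
  by apply: read_bits_mkseq => [i /H0 <-|]; rewrite -E.
case: (posnP len) => [l0|lp].
  pose x : mstate * tsym #|{: cell}| * move := (inr (Some (Some true)), None, None).
  exists (len + 1), (apply_tr cf1 x); split; first by lia.
  - apply: reach_cat r1 _; exists (apply_tr cf1 x); split=> //.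
    by exists x => //; rewrite e1 /= hs1 Hl Hh l0 mem_head.
  - by rewrite /halted c_st_apply.
  - apply: fin => [i|]; first by rewrite l0.
    by have := @symat_apply machine cf1 x len len; rewrite l0 /= => ->.
pose x : mstate * tsym #|{: cell}| * move := (inr (Some (Some false)), None, Some false).
have bwd n : n < len -> exists2 cf2, reach n.+1 cf1 cf2 &
    [/\ c_st cf2 = inr (Some (Some false)),
      forall i, i < len - n -> mkcell (symat cf2 (len - n.+1) i) = T i,
      forall i, len - n <= i < len ->
        symat cf2 (len - n.+1) i = Some (inl (odflt false (outbit (T i)))) &
      symat cf2 (len - n.+1) len = None].
  elim: n => [_|n IH ln].
    have S := fun i => @symat_apply machine cf1 x len i (fun=> lp).
    exists (apply_tr cf1 x).
      exists (apply_tr cf1 x); split=> //.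
      by exists x => //; rewrite e1 /= hs1 Hl Hh; case: (len) lp => //= l _; rewrite mem_head.
    split; rewrite ?subn0 ?subn1; first by rewrite c_st_apply.
    + by move=> i Hi; rewrite S; case: eqP => [E|_]; [lia | exact: rp1].
    + by move=> i; lia.
    + by rewrite S eqxx.
  have [cf2 r2 [e2 A2 B2 C2]] := IH (ltnW ln).
  set h := len - n.+1 in A2 B2 C2.
  have hp : 0 < h by rewrite /h; lia.
  have hs2 : mkcell (c_head cf2) = T h by rewrite -A2 ?symat_head // /h; lia.
  pose y : mstate * tsym #|{: cell}| * move := (inr (Some (Some false)), outsym (T h), Some false).
  have S := fun i => @symat_apply machine cf2 y h i (fun=> hp).
  have Eh : shift_pos h y.2 = len - n.+2 by rewrite /= /h; lia.
  rewrite Eh in S.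
  exists (apply_tr cf2 y).
    rewrite -[n.+2]addn1; apply: reach_cat r2 _; exists (apply_tr cf2 y); split=> //.
    by exists y => //; rewrite e2 /= hs2 Hh eqn0Ngt hp /= mem_head.
  split; first by rewrite c_st_apply.
  + by move=> i Hi; rewrite S; case: eqP => [E|_]; [lia | apply: A2; lia].
  + move=> i Hi; rewrite S; case: eqP => [->|nE] /=.
      have /Ho : h < len by rewrite /h; lia.
      by rewrite /outsym; case: (outbit _).
    by apply: B2; move: nE; rewrite /h in Hi *; lia.
  + by rewrite S; case: eqP => // E; rewrite /h in E; lia.
have [|cf2 r2 [e2 A2 B2 C2]] := bwd len.-1; first by lia.
have E0 : len - len.-1.+1 = 0 by lia.
rewrite E0 in A2 B2 C2.
have hs2 : mkcell (c_head cf2) = T 0 by rewrite -A2 ?symat_head //; lia.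
pose y : mstate * tsym #|{: cell}| * move := (inr (Some (Some true)), outsym (T 0), None).
have S := fun i => @symat_apply machine cf2 y 0 i.
exists (len + (len.-1.+1 + 1)), (apply_tr cf2 y); split; first by lia.
- apply: reach_cat r1 _; apply: reach_cat r2 _; exists (apply_tr cf2 y); split=> //.
  by exists y => //; rewrite e2 /= hs2 Hh mem_head.
- by rewrite /halted c_st_apply.
apply: fin => [i Hi|]; rewrite S //=.
  case: eqP => [->|nE]; last by apply: B2; lia.
  by have := Ho 0 lp; rewrite /outsym; case: (outbit _).
by case: eqP => // E; lia.
Qed.

End Machine.

(** * A nondeterministic register language and its control flow graph *)

Inductive instr :=
| IInc of nat | IRst of nat | IWr of nat & nat & bool
| ILt of nat & nat | IRd of nat & nat & (option bool -> bool).

Inductive cmd :=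
| Op of instr | Seq of cmd & cmd | If of instr & cmd & cmd | While of instr & cmd
| Choose of cmd & cmd | Fail.

Record store := Store { reg : nat -> nat; arr : nat -> nat -> option bool }.

Definition effect (i : instr) (s : store) : store :=
  match i with
  | IInc x => Store (updf (reg s) x (reg s x).+1) (arr s)
  | IRst x => Store (updf (reg s) x 0) (arr s)
  | IWr a x b => Store (reg s) (updf (arr s) a (updf (arr s a) (reg s x) (Some b)))
  | _ => s
  end.

Definition outcome (i : instr) (s : store) : bool :=
  match i with
  | ILt x y => reg s x < reg s y
  | IRd a x f => f (arr s a (reg s x))
  | _ => true
  end.

Inductive ceval : cmd -> store -> nat -> store -> Prop :=
| EvOp i s : ceval (Op i) s 1 (effect i s)
| EvSeq c1 c2 s n1 s1 n2 s2 :
    ceval c1 s n1 s1 -> ceval c2 s1 n2 s2 -> ceval (Seq c1 c2) s (n1 + n2) s2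
| EvIf i c1 c2 s n s' :
    ceval (if outcome i s then c1 else c2) (effect i s) n s' -> ceval (If i c1 c2) s n.+1 s'
| EvWhileF i c s : ~~ outcome i s -> ceval (While i c) s 1 (effect i s)
| EvWhileT i c s n1 s1 n2 s2 : outcome i s ->
    ceval c (effect i s) n1 s1 -> ceval (While i c) s1 n2 s2 ->
    ceval (While i c) s (n1 + n2).+1 s2
| EvChoose (b : bool) c1 c2 s n s' :
    ceval (if b then c1 else c2) s n s' -> ceval (Choose c1 c2) s n.+1 s'.

(** Program points form a finite type, as machine states must. In a conditional, choice or loop,
    [None] is the point of the test. *)
Fixpoint pos (c : cmd) : finType :=
  match c with
  | Op _ | Fail => (unit : finType)
  | Seq a b => ((pos a + pos b)%type : finType)
  | If _ a b | Choose a b => (option (pos a + pos b)%type : finType)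
  | While _ a => (option (pos a) : finType)
  end.

Fixpoint pstart (c : cmd) : pos c :=
  match c return pos c with
  | Op _ | Fail => tt
  | Seq a b => inl (pstart a)
  | If _ _ _ | Choose _ _ | While _ _ => None
  end.

Definition nop := ILt 0 0.

Fixpoint pfetch (c : cmd) : pos c -> instr :=
  match c return pos c -> instr with
  | Op i => fun=> i
  | Fail => fun=> nop
  | Seq a b => fun p => match p with inl p => pfetch p | inr p => pfetch p end
  | If i a b => fun p =>
      match p with None => i | Some (inl p) => pfetch p | Some (inr p) => pfetch p end
  | Choose a b => fun p =>
      match p with None => nop | Some (inl p) => pfetch p | Some (inr p) => pfetch p end
  | While i a => fun p => match p with None => i | Some p => pfetch p end
  end.

Fixpoint pnext (c : cmd) : pos c -> bool -> seq (option (pos c)) :=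
  match c return pos c -> bool -> seq (option (pos c)) with
  | Op i => fun _ _ => [:: None]
  | Fail => fun _ _ => [::]
  | Seq a b => fun p o =>
      match p with
      | inl p => [seq Some (if x is Some p' then inl p' else inr (pstart b)) | x <- pnext p o]
      | inr p => [seq omap inr x | x <- pnext p o]
      end
  | If i a b => fun p o =>
      match p with
      | None => [:: Some (Some (if o then inl (pstart a) else inr (pstart b)))]
      | Some (inl p) => [seq omap (Some \o inl) x | x <- pnext p o]
      | Some (inr p) => [seq omap (Some \o inr) x | x <- pnext p o]
      end
  | Choose a b => fun p o =>
      match p with
      | None => [:: Some (Some (inl (pstart a))); Some (Some (inr (pstart b)))]
      | Some (inl p) => [seq omap (Some \o inl) x | x <- pnext p o]
      | Some (inr p) => [seq omap (Some \o inr) x | x <- pnext p o]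
      end
  | While i a => fun p o =>
      match p with
      | None => if o then [:: Some (Some (pstart a))] else [:: None]
      | Some p => [seq Some x | x <- pnext p o]
      end
  end.

Inductive ppath c : option (pos c) -> store -> nat -> option (pos c) -> store -> Prop :=
| PP0 x s : ppath x s 0 x s
| PPS p s x n y s' : x \in pnext p (outcome (pfetch p) s) ->
    ppath x (effect (pfetch p) s) n y s' -> ppath (Some p) s n.+1 y s'.

Lemma ppath_cat c x s n y s1 m z s2 :
  @ppath c x s n y s1 -> @ppath c y s1 m z s2 -> @ppath c x s (n + m) z s2.
Proof. by elim=> [//|p {}s {}x {}n {}y {}s1 xin _ IH] h; apply: (PPS xin); apply: IH. Qed.

Lemma ppath_Some c (p : pos c) s n s' : ppath (Some p) s n None s' ->
  exists x n', [/\ n = n'.+1, x \in pnext p (outcome (pfetch p) s) &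
    ppath x (effect (pfetch p) s) n' None s'].
Proof.
move e1 : (Some p) => x; move e2 : None => y h.
case: x s n y s' / h e1 e2 => [x s <- //|p' s x n y s' xin h [->] e].
by exists x, n.
Qed.

Section Embedding.
Variables (a c : cmd) (gp : pos a -> pos c) (gN : option (pos c)).
Let g x := if x is Some p then Some (gp p) else gN.
Hypothesis fetchE : forall p, pfetch (gp p) = pfetch p.
Hypothesis nextE : forall p o, pnext (gp p) o = map g (pnext p o).

Lemma ppath_embed x s n y s' : @ppath a x s n y s' -> ppath (g x) s n (g y) s'.
Proof.
elim=> [{}x {}s|p {}s {}x {}n {}y {}s' xin _ IH]; first exact: PP0.
by apply: (@PPS _ _ _ (g x)); rewrite ?fetchE // nextE map_f.
Qed.

(** Embedded code has a single exit: a successor of an image point is an image point or [gN]. A path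
    that ends therefore crosses [gN], and is cut there. *)
Lemma ppath_split p s n s' : ppath (Some (gp p)) s n None s' ->
  exists n1 s1 n2, [/\ n = n1 + n2, 0 < n1, @ppath a (Some p) s n1 None s1 &
    ppath gN s1 n2 None s'].
Proof.
elim: n p s => [|n IH] p s /ppath_Some [x [n' [//]]] [<-].
rewrite fetchE nextE => /mapP [x' xin ->] H4.
case: x' xin H4 => [p'|] xin /= H4.
  have [n1 [s1 [n2 [-> h1 h2 h3]]]] := IH _ _ H4.
  by exists n1.+1, s1, n2; split=> //; apply: PPS xin h2.
by exists 1, (effect (pfetch p) s), n; split=> //; apply: PPS xin _; apply: PP0.
Qed.
End Embedding.

Lemma ppath_None c s n y s' : @ppath c None s n y s' -> [/\ n = 0, y = None & s' = s].
Proof. by move e1 : None => x h; case: x s n y s' / h e1. Qed.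

Lemma ceval_ppath c s n s' : ceval c s n s' -> ppath (Some (pstart c)) s n None s'.
Proof.
elim=> {c s n s'}.
- by move=> i s; apply: (@PPS _ _ _ None) => //=; apply: PP0.
- move=> c1 c2 s n1 s1 n2 s2 _ h1 _ h2.
  have e1 := @ppath_embed c1 (Seq c1 c2) inl (Some (inr (pstart c2))) (fun=> erefl).
  apply: ppath_cat (e1 _ _ _ _ _ _ h1) _.
    by move=> p o /=; apply: eq_map => -[].
  apply: (@ppath_embed c2 (Seq c1 c2) inr None _ _ _ _ _ _ _ h2) => //.
- move=> i c1 c2 s n s' _ h.
  apply: (@PPS (If i c1 c2) None s
    (Some (Some (if outcome i s then inl (pstart c1) else inr (pstart c2)))));
    first by rewrite /= mem_head.
  case: (outcome i s) h => h.
  + apply: (@ppath_embed c1 (If i c1 c2) (Some \o inl) None _ _ _ _ _ _ _ h) => //.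
  + apply: (@ppath_embed c2 (If i c1 c2) (Some \o inr) None _ _ _ _ _ _ _ h) => //.
- by move=> i c s /negbTE o; apply: (@PPS (While i c) None s None); [rewrite /= o mem_head | apply: PP0].
- move=> i c s n1 s1 n2 s2 o _ h1 _ h2.
  apply: (@PPS (While i c) None s (Some (Some (pstart c)))); first by rewrite /= o mem_head.
  apply: ppath_cat h2.
  apply: (@ppath_embed c (While i c) Some (Some None) _ _ _ _ _ _ _ h1) => // p b /=.
  by apply: eq_map => -[].
- move=> b c1 c2 s n s' _ h.
  apply: (@PPS (Choose c1 c2) None s
    (Some (Some (if b then inl (pstart c1) else inr (pstart c2))))).
    by case: (b); rewrite !inE ?eqxx ?orbT.
  case: b h => h.
  + apply: (@ppath_embed c1 (Choose c1 c2) (Some \o inl) None _ _ _ _ _ _ _ h) => //.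
  + apply: (@ppath_embed c2 (Choose c1 c2) (Some \o inr) None _ _ _ _ _ _ _ h) => //.
Qed.

Lemma ppath_ceval c s n s' : ppath (Some (pstart c)) s n None s' -> ceval c s n s'.
Proof.
elim: c s n s' => [i|c1 IH1 c2 IH2|i c1 IH1 c2 IH2|i c1 IH1|c1 IH1 c2 IH2|] s n s'.
- move=> /ppath_Some [x [m [->]]]; rewrite /= inE => /eqP-> H4.
  by have [-> _ ->] := ppath_None H4; apply: EvOp.
- move=> h; have [||n1 [s1 [n2 [-> _ h1 h2]]]] :=
    @ppath_split c1 (Seq c1 c2) inl (Some (inr (pstart c2))) _ _ _ _ _ _ h => //.
    by move=> p o /=; apply: eq_map => -[].
  have [||n3 [s3 [n4 [-> _ h3 h4]]]] :=
    @ppath_split c2 (Seq c1 c2) inr None _ _ _ _ _ _ h2 => //.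
  have [-> _ ->] := ppath_None h4; rewrite addn0.
  by apply: EvSeq (IH1 _ _ _ h1) (IH2 _ _ _ h3).
- move=> /ppath_Some [x [m [->]]]; rewrite /= inE => /eqP-> H4.
  apply: EvIf; case: (outcome i s) H4 => H4.
  + have [||n3 [s3 [n4 [-> _ h3 h4]]]] :=
      @ppath_split c1 (If i c1 c2) (Some \o inl) None _ _ _ _ _ _ H4 => //.
    by have [-> _ ->] := ppath_None h4; rewrite addn0; apply: IH1.
  + have [||n3 [s3 [n4 [-> _ h3 h4]]]] :=
      @ppath_split c2 (If i c1 c2) (Some \o inr) None _ _ _ _ _ _ H4 => //.
    by have [-> _ ->] := ppath_None h4; rewrite addn0; apply: IH2.
- elim/ltn_ind: n s => n IHn s /ppath_Some [x [m [En]]] /=.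
  case: (boolP (outcome i s)) => o; rewrite inE => /eqP-> H4; rewrite {}En in IHn *.
    have [||n3 [s3 [n4 [E _ h3 h4]]]] :=
      @ppath_split c1 (While i c1) Some (Some None) _ _ _ _ _ _ H4 => //.
      by move=> p b /=; apply: eq_map => -[].
    rewrite E; apply: EvWhileT (IH1 _ _ _ h3) _ => //.
    by apply: IHn => //; rewrite E ltnS leq_addl.
  by have [-> _ ->] := ppath_None H4; apply: EvWhileF.
- move=> /ppath_Some [x [m [->]]]; rewrite /= !inE => /orP [] /eqP-> H4.
  + apply: (@EvChoose true).
    have [||n3 [s3 [n4 [-> _ h3 h4]]]] :=
      @ppath_split c1 (Choose c1 c2) (Some \o inl) None _ _ _ _ _ _ H4 => //.
    by have [-> _ ->] := ppath_None h4; rewrite addn0; apply: IH1.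
  + apply: (@EvChoose false).
    have [||n3 [s3 [n4 [-> _ h3 h4]]]] :=
      @ppath_split c2 (Choose c1 c2) (Some \o inr) None _ _ _ _ _ _ H4 => //.
    by have [-> _ ->] := ppath_None h4; rewrite addn0; apply: IH2.
- by move=> /ppath_Some [x [m []]].
Qed.

(** * Compilation to a Turing machine *)

Definition instr_bound (i : instr) : nat :=
  match i with
  | IInc x | IRst x | IWr _ x _ | IRd _ x _ => x
  | ILt x y => maxn x y
  end.

Definition instr_wf (i : instr) : bool :=
  match i with
  | IInc x | IRst x => 0 < x
  | IWr a _ _ | IRd a _ _ => a < 3
  | ILt _ _ => true
  end.

Fixpoint cmd_bound c : nat :=
  match c with
  | Op i => instr_bound i
  | Seq a b | Choose a b => maxn (cmd_bound a) (cmd_bound b)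
  | If i a b => maxn (instr_bound i) (maxn (cmd_bound a) (cmd_bound b))
  | While i a => maxn (instr_bound i) (cmd_bound a)
  | Fail => 0
  end.

Fixpoint cmd_wf c : bool :=
  match c with
  | Op i => instr_wf i
  | Seq a b | Choose a b => cmd_wf a && cmd_wf b
  | If i a b => [&& instr_wf i, cmd_wf a & cmd_wf b]
  | While i a => instr_wf i && cmd_wf a
  | Fail => true
  end.

Fixpoint choice_free c : bool :=
  match c with
  | Op _ | Fail => true
  | Seq a b | If _ a b => choice_free a && choice_free b
  | While _ a => choice_free a
  | Choose _ _ => false
  end.

Lemma pfetch_ok c (p : pos c) : cmd_wf c ->
  instr_wf (pfetch p) /\ instr_bound (pfetch p) <= cmd_bound c.
Proof.
elim: c p => [i|c1 IH1 c2 IH2|i c1 IH1 c2 IH2|i c1 IH1|c1 IH1 c2 IH2|] /=.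
- by [].
- by move=> [p|p] /andP[w1 w2]; [case: (IH1 p w1) | case: (IH2 p w2)] => ? ?; split=> //; lia.
- move=> [[p|p]|] /and3P[w0 w1 w2]; [case: (IH1 p w1) | case: (IH2 p w2) | ] => *;
  by split=> //; lia.
- by move=> [p|] /andP[w0 w1]; [case: (IH1 p w1) | ] => *; split=> //; lia.
- move=> [[p|p]|] /andP[w1 w2]; [case: (IH1 p w1) | case: (IH2 p w2) | ] => *;
  by split=> //=; lia.
- by [].
Qed.

Lemma pnext_det c (p : pos c) o : choice_free c -> size (pnext p o) <= 1.
Proof.
elim: c p => [i|c1 IH1 c2 IH2|i c1 IH1 c2 IH2|i c1 IH1|c1 IH1 c2 IH2|] //=.
- by move=> [p|p] /andP[w1 w2]; rewrite size_map; auto.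
- by move=> [[p|p]|] /andP[w1 w2]; rewrite ?size_map; auto.
- by move=> [p|] w1; rewrite ?size_map; auto; case: (o).
Qed.

Section Simulation.
Variables (c : cmd) (cwf : cmd_wf c).
Let R := cmd_bound c.

Definition marked (x : nat) (d : cell R) : bool := d.2 (inord x).
Definition set_mark (x : nat) (b : bool) (d : cell R) : cell R :=
  (d.1, [ffun y => if y == inord x then b else d.2 y]).
Definition set_bit (a : nat) (b : bool) (d : cell R) : cell R :=
  ([ffun y => if y == inord a then Some b else d.1 y], d.2).

Definition minstr_of (i : instr) : minstr (cell R) :=
  match i with
  | IInc x => MInstr (marked x) xpredT (set_mark x false) (set_mark x true) id
  | IRst x => MInstr (marked x) xpredT (set_mark x false) id (set_mark x true)
  | IWr a x b => MInstr (marked x) xpredT (set_bit a b) id id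
  | ILt x y => MInstr (fun d => marked x d || marked y d) (fun d => ~~ marked y d) id id id
  | IRd a x f => MInstr (marked x) (fun d => f (d.1 (inord a))) id id id
  end.

(** A register is a mark on the cell whose number is its value; the arrays are the tracks. Register
    0, which well-formed instructions never change, marks home. *)
Definition tape_of (s : store) (i : nat) : cell R :=
  ([ffun a : 'I_3 => arr s a i], [ffun x : 'I_R.+1 => reg s x == i]).

Lemma marked_tape s x i : x <= R -> marked x (tape_of s i) = (reg s x == i).
Proof. by move=> h; rewrite /marked ffunE inordK. Qed.

Lemma home_tape s i : reg s 0 = 0 -> home (tape_of s i) = (i == 0).
Proof. by move=> h; rewrite /home ffunE /= h eq_sym. Qed.

Lemma cell_eqP (d d' : cell R) : d.1 =1 d'.1 -> d.2 =1 d'.2 -> d = d'.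
Proof.
by case: d d' => [d1 d2] [d1' d2'] /= h1 h2; congr (_, _); apply/ffunP.
Qed.

Lemma inord_eqE x (y : 'I_R.+1) : x <= R -> (y == inord x) = (val y == x).
Proof. by move=> h; rewrite -val_eqE /= inordK. Qed.

Ltac split_ifs := repeat (let e := fresh "E" in case: ifP => [/eqP e|/eqP e]).

(** The stop cell carries the mark of the register addressed. A comparison stops at the nearer of
    two marks, and [x < y] holds exactly when the mark of [y] is not there. *)
Lemma instr_sim i s B : instr_wf i -> instr_bound i <= R -> reg s 0 = 0 ->
  (forall x, reg s x <= B) ->
  exists v, [/\ v <= B, mstop (minstr_of i) (tape_of s v),
    forall j, j < v -> ~~ mstop (minstr_of i) (tape_of s j),
    mout (minstr_of i) (tape_of s v) = outcome i s &
    (forall j, meffect (minstr_of i) (tape_of s) v j = tape_of (effect i s) j) /\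
    forall j, home (updf (updf (tape_of s) v (mrew1 (minstr_of i) (tape_of s v))) v.+1
                (mrew2 (minstr_of i) (tape_of s v.+1)) j) = (j == 0)].
Proof.
move=> wf bd r0 hB.
case: i wf bd => [x|x|a x b|x y|a x f] /= wf bd.
- exists (reg s x); split; rewrite ?marked_tape //.
    by move=> j Hj; rewrite marked_tape //; lia.
  split=> j; rewrite /meffect /updf /=.
    apply: cell_eqP => y.
      by split_ifs; rewrite /= ?ffunE; congr (arr _ _ _); lia.
    split_ifs; rewrite /= ?ffunE ?inord_eqE ?ffunE //= /updf; case: (val y =P x) => [Ey|?];
      rewrite ?Ey /=; lia.
  by rewrite -(home_tape j r0) /home; split_ifs; rewrite /= ?ffunE ?inord_eqE //=; split_ifs; lia.
- exists (reg s x); split; rewrite ?marked_tape //.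
    by move=> j Hj; rewrite marked_tape //; lia.
  split=> j; rewrite /meffect /updf /=.
    apply: cell_eqP => y.
      by split_ifs; rewrite /= ?ffunE; congr (arr _ _ _); lia.
    split_ifs; rewrite /= ?ffunE ?inord_eqE ?ffunE //= /updf; case: (val y =P x) => [Ey|?];
      rewrite ?Ey /=; lia.
  by rewrite -(home_tape j r0) /home; split_ifs; rewrite /= ?ffunE ?inord_eqE //=; split_ifs; lia.
- exists (reg s x); split; rewrite ?marked_tape //.
    by move=> j Hj; rewrite marked_tape //; lia.
  split=> j; rewrite /meffect /updf /=.
    apply: cell_eqP => y.
      split_ifs; rewrite /= ?ffunE -?val_eqE /= ?inordK // /updf; case: (val y =P a) => [Ey|?] //=;
        rewrite ?Ey; split_ifs => //; try (congr (arr _ _ _)); lia.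
    by split_ifs; rewrite /= ?ffunE; lia.
  by rewrite -(home_tape j r0) /home; split_ifs; rewrite /= ?ffunE //=; lia.
- exists (minn (reg s x) (reg s y)); split; rewrite ?marked_tape; try lia.
  + by have := hB x; lia.
  + by move=> j Hj; rewrite !marked_tape; lia.
  + split=> j; rewrite /meffect /updf /=.
      by split_ifs => //; congr tape_of; lia.
    by rewrite -(home_tape j r0) /home; split_ifs; rewrite /= ?ffunE //=; lia.
- exists (reg s x); split; rewrite ?marked_tape //.
  + by move=> j Hj; rewrite marked_tape //; lia.
  + by rewrite ffunE inordK.
  + split=> j; rewrite /meffect /updf /=.
      by split_ifs => //; congr tape_of; lia.
    by rewrite -(home_tape j r0) /home; split_ifs; rewrite /= ?ffunE //=; lia.
Qed.

Definition cmachine : TM :=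
  @machine R (pos c) (pstart c) (fun p => minstr_of (pfetch p)) (@pnext c).

Definition init_store (w : seq bool) : store :=
  Store (fun=> 0) (fun a i => if a == 0 then onth w i else None).

Lemma effect_reg0 i s : instr_wf i -> reg s 0 = 0 -> reg (effect i s) 0 = 0.
Proof. by case: i => //= [x|x] h r0; rewrite /updf; split_ifs; lia. Qed.

Lemma effect_regB i s B : (forall x, reg s x <= B) -> forall x, reg (effect i s) x <= B.+1.
Proof.
move=> hB y; have h := hB y; case: i => [x|x|a x b|x z|a x f] /=; try exact: leqW.
  by rewrite /updf; have := hB x; split_ifs; lia.
by rewrite /updf; split_ifs; lia.
Qed.

Notation mrep cf x s := (@at_state R (pos c) (pstart c) (fun p => minstr_of (pfetch p))
  (@pnext c) cf (goto x) (tape_of s) 0).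

Lemma at_state_ext (cf : config cmachine) q T T' h :
  (forall i, T i = T' i) -> at_state cf q T h -> at_state cf q T' h.
Proof. by move=> e [e1 r]; split=> //; apply: rep_ext r. Qed.

(** A register grows by at most one per instruction, so during [n] instructions every mark stays
    within [B + n] cells of home, and each instruction costs one walk there and back. *)
Lemma ppath_reach x s n y s' B (cf : config cmachine) :
  @ppath c x s n y s' -> reg s 0 = 0 -> (forall x, reg s x <= B) -> mrep cf x s ->
  exists t cf', [/\ t <= n * (2 * (B + n) + 3), reach t cf cf', mrep cf' y s' & reg s' 0 = 0].
Proof.
move=> h; elim: h B cf => [{}x {}s|p {}s {}x {}n {}y {}s' xin _ IH] B cf r0 hB a.
  by exists 0, cf.
have [wi bi] := pfetch_ok p cwf.
have [v [vB h1 h2 h3 [h4 h5]]] := instr_sim wi bi r0 hB.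
have [cf1 d1 [_ e1 H1]] := instr_path a h1 h2 h5.
rewrite h3 in e1 H1.
have a2 := at_state_ext h4 (H1 _ xin).
set cf2 := apply_tr _ _ in a2.
have [t [cf3 [tb r3 a3 r0']]] := IH B.+1 cf2 (effect_reg0 wi r0) (effect_regB _ hB) a2.
exists (2 * v + 2 + (1 + t)), cf3; split=> //.
  have : n * (2 * (B.+1 + n) + 3) + (2 * (B + n.+1) + 3) = n.+1 * (2 * (B + n.+1) + 3) by nia.
  by lia.
apply: reach_cat (dpath_reach d1) _; exists cf2; split=> //.
eexists; last by [].
by rewrite e1; apply: (map_f (fun x => (goto x, _, None)) xin).
Qed.

(** Between two visits home the machine has no choice and does not accept, so an accepting run
    splits into complete instructions. *)
Lemma reach_ppath t (cf ca : config cmachine) x s B :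
  reach t cf ca -> tm_acc (c_st ca) -> mrep cf x s -> reg s 0 = 0 ->
  (forall x, reg s x <= B) -> exists n s', @ppath c x s n None s'.
Proof.
elim/ltn_ind: t cf x s B => t IH cf [p|] s B r acc a r0 hB; last first.
  by exists 0, s; apply: PP0.
have [wi bi] := pfetch_ok p cwf.
have [v [vB h1 h2 h3 [h4 h5]]] := instr_sim wi bi r0 hB.
have [cf1 d1 [na e1 H1]] := instr_path a h1 h2 h5.
rewrite h3 in e1 H1.
have [t' Et r'] := dpath_acc d1 r acc.
case: t' Et r' => [|t'] Et /=; first by move=> E; rewrite -E acc in na.
case=> cf2 [[y yin ->] r2].
move: yin; rewrite e1 => /mapP [x xin Ey]; rewrite Ey in r2.
have a2 := at_state_ext h4 (H1 _ xin).
have [|n [s' P]] := IH t' _ _ _ _ B.+1 r2 acc a2 (effect_reg0 wi r0) (effect_regB _ hB).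
  by lia.
by exists n.+1, s'; apply: PPS xin P.
Qed.

Lemma init_path w : exists2 cf, dpath 1 (init_cfg cmachine w) cf &
  mrep cf (Some (pstart c)) (init_store w).
Proof.
have r0 : rep (init_cfg cmachine w) (fun i => input_cell R (onth w i)) 0.
  move=> i; rewrite /symat /init_cfg; case: w => [|b w] /=.
    by rewrite nth_nil; case: eqP; case: i.
  case: i => [//|i] /=; rewrite subSS subn0.
  case: (ltnP i (size w)) => h.
    by rewrite (nth_map false) //= onthE (nth_map false).
  by rewrite nth_default ?size_map //= onthE nth_default ?size_map.
have e0 : c_st (init_cfg cmachine w) = inr None by case: (w).
have hs := rep_head r0.
eexists.
  by apply: dpath1; [rewrite e0 /= hs | rewrite e0].
split; first by rewrite c_st_apply.
apply: (rep_ext _ (rep_apply r0 _)) => //= i; rewrite /updf /= enum_rankK.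
apply: cell_eqP => y /=; case: eqP => [->|ni] /=; rewrite !ffunE //=.
by case: i ni.
Qed.

Lemma cmd_reach w n s' : ceval c (init_store w) n s' ->
  exists t cf, [/\ t <= n * (2 * n + 3) + 1, reach t (init_cfg cmachine w) cf,
    mrep cf None s' & reg s' 0 = 0].
Proof.
move=> /ceval_ppath p; have [cf0 d0 a0] := init_path w.
have [//|//|t [cf [tb r a r0]]] := ppath_reach (B := 0) p _ _ a0.
by exists (1 + t), cf; split=> //; [lia | apply: reach_cat (dpath_reach d0) r].
Qed.

Lemma reach_cmd w t cf : reach t (init_cfg cmachine w) cf -> tm_acc (c_st cf) ->
  exists n s', ceval c (init_store w) n s'.
Proof.
move=> r acc; have [cf0 d0 a0] := init_path w.
have [t' _ r'] := dpath_acc d0 r acc.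
have [//|//|n [s' /ppath_ceval p]] := reach_ppath (B := 0) r' acc a0.
by exists n, s'.
Qed.

Lemma cmachine_det : choice_free c -> deterministic cmachine.
Proof.
move=> cf [[p [[[] o]|]]|[[[]|]|]] a //=.
- by case: ifP => // _; rewrite size_map pnext_det.
- by case: ifP.
- by case: ifP.
- by case: (outbit _) => //; case: ifP.
Qed.

End Simulation.

Lemma poly_computable_cmd c (f : seq bool -> seq bool) k : cmd_wf c -> choice_free c ->
  (forall w, exists n s', [/\ n * (2 * n + 3) + 1 + (2 * size (f w) + 1) <= pbound k (size w),
     ceval c (init_store w) n s' & forall i, arr s' 1 i = onth (f w) i]) ->
  poly_computable f.
Proof.
move=> wf cfr H; exists (cmachine c), k; split; first exact: cmachine_det.
move=> w; have [n [s' [nb ev ar]]] := H w.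
have [t [cf [tb r a r0]]] := cmd_reach wf ev.
have O i : outbit (tape_of c s' i) = onth (f w) i by rewrite /outbit ffunE inordK.
have [||| t' [cf' [tb' r' h o]]] := output_path (len := size (f w)) a.
- by move=> i; apply: home_tape.
- by move=> i Hi; rewrite O onthE (nth_map false).
- by rewrite O onthE nth_default // size_map.
exists (t + t'), cf'; split=> //; first by lia.
  exact: reach_cat r r'.
rewrite o; apply: (@eq_from_nth _ false); rewrite size_mkseq // => i Hi.
by rewrite nth_mkseq // O onthE (nth_map false).
Qed.

Lemma in_NP_cmd c (L : language) k : cmd_wf c ->
  (forall w n s', ceval c (init_store w) n s' -> L w) ->
  (forall w, L w -> exists n s', n * (2 * n + 3) + 1 <= pbound k (size w) /\
     ceval c (init_store w) n s') ->
  in_NP L.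
Proof.
move=> wf H1 H2; exists (cmachine c), k => w; split.
  move=> /H2 [n [s' [nb ev]]].
  have [t [cf [tb r [e _] r0]]] := cmd_reach wf ev.
  by exists t, cf; split=> //; [lia | rewrite e /=].
case=> t [cf [_ r acc]]; have [n [s' ev]] := reach_cmd wf r acc.
exact: H1 ev.
Qed.

(** * Polynomial bounds *)

(** The base is at least 2 so that a power absorbs any constant and grows with the exponent, even at
    [M = 0]. *)
Definition poly (f : nat -> nat) := exists d, forall M, f M <= (M + 2) ^ d.

Lemma poly_id : poly id.
Proof. by exists 1 => M; rewrite expn1 leq_addr. Qed.

Lemma poly_cst n : poly (fun=> n).
Proof.
exists n => M; apply: leq_trans (ltnW (ltn_expl n (isT : 1 < 2))) _.
by case: (n) => [|k]; rewrite ?expn0 ?leq_exp2r ?leq_addl.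
Qed.

Lemma leq_polyexp M a b : a <= b -> (M + 2) ^ a <= (M + 2) ^ b.
Proof. by move=> h; rewrite leq_pexp2l // addn2. Qed.

Lemma poly_add f g : poly f -> poly g -> poly (fun M => f M + g M).
Proof.
move=> [a ha] [b hb]; exists (maxn a b).+1 => M.
rewrite expnS; have h1 := leq_trans (ha M) (leq_polyexp M (leq_maxl a b)).
have h2 := leq_trans (hb M) (leq_polyexp M (leq_maxr a b)).
apply: (@leq_trans (2 * (M + 2) ^ maxn a b)); first by lia.
by rewrite leq_mul2r leq_addl orbT.
Qed.

Lemma poly_mul f g : poly f -> poly g -> poly (fun M => f M * g M).
Proof. by move=> [a ha] [b hb]; exists (a + b) => M; rewrite expnD leq_mul. Qed.

Lemma poly_comp f g : poly f -> poly g -> poly (fun M => f (g M)).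
Proof.
move=> [a ha] [b hb]; exists (b.+2 * a) => M; apply: leq_trans (ha _) _.
rewrite expnM; case: (posnP a) => [->|ap]; first by rewrite !expn0.
rewrite leq_exp2r //; have := hb M.
have : (M + 2) ^ b + 2 <= (M + 2) ^ b.+2.
  rewrite !expnS; have : 0 < (M + 2) ^ b by rewrite expn_gt0 addn2.
  by nia.
by lia.
Qed.

Lemma poly_pbound f : poly f -> exists k, forall M, f M <= pbound k M.
Proof.
(* For [M > 0] one has [M + 2 <= 3 * M], and [d] is below [3 ^ d]; for [M = 0] the additive constant
   of [pbound] suffices. *)
move=> [d hd]; exists (3 ^ d) => M; apply: leq_trans (hd M) _; rewrite /pbound.
case: M => [|M].
  by apply: leq_trans (leq_addl _ _); case: (d) => // n; rewrite leq_exp2r.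
apply: leq_trans (leq_addr _ _); apply: (@leq_trans ((3 * M.+1) ^ d)).
  by case: (d) => // n; rewrite leq_exp2r //; lia.
rewrite expnMn leq_mul2l; apply/orP; right.
by rewrite leq_pexp2l // ltnW // ltn_expl.
Qed.

Ltac poly_tac := repeat first
  [ exact: poly_id | exact: poly_cst | assumption | apply: poly_add | apply: poly_mul
  | match goal with |- poly (fun M => ?f (@?g M)) => apply: (@poly_comp f g) end ].

(** * Bounded arithmetic expressions and output terms *)

(* Variables are de Bruijn indices; in [EIter b i f c] the body [f] sees the current
   value at index 0 and the iteration number at index 1, and all values are cut at [c],
   which keeps every expression polynomially bounded. [ESrc] reads a bit source. *)
Inductive expr :=
| EVar of nat | ECst of nat | EAdd of expr & expr | EMul of expr & expr
| ELeq of expr & expr | EIter of expr & expr & expr & expr | ESrc of expr.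

Section Eval.
Variable src : nat -> bool.

Fixpoint eval (env : seq nat) (e : expr) : nat :=
  match e with
  | EVar k => nth 0 env k
  | ECst n => n
  | EAdd a b => eval env a + eval env b
  | EMul a b => eval env a * eval env b
  | ELeq a b => eval env a <= eval env b
  | EIter b i f c =>
      iteri (eval env b) (fun j v => minn (eval env c) (eval (v :: j :: env) f))
        (minn (eval env c) (eval env i))
  | ESrc a => src (eval env a)
  end.

End Eval.

Inductive out := OEmit of bool | OCat of out & out | OFor of expr & out.

Fixpoint outp (src : nat -> bool) (env : seq nat) (o : out) : seq bool :=
  match o with
  | OEmit b => [:: b]
  | OCat a b => outp src env a ++ outp src env b
  | OFor e a => flatten [seq outp src (j :: env) a | j <- iota 0 (eval src env e)]
  end.

(** * Compilation of expressions *)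

Definition CFor i n body := Seq (Op (IRst i)) (While (ILt i n) (Seq body (Op (IInc i)))).
Definition CCopy x y := CFor y x (Op nop).

Lemma CFor_eval i n body s N C (P : nat -> store -> Prop) :
  (forall j s1, P j s1 -> reg s1 i = j /\ reg s1 n = N) ->
  P 0 (effect (IRst i) s) ->
  (forall j s1, j < N -> P j s1 -> exists m s2,
     [/\ ceval body s1 m s2, m <= C & P j.+1 (effect (IInc i) s2)]) ->
  exists m s', [/\ ceval (CFor i n body) s m s', m <= N * (C + 2) + 2 & P N s'].
Proof.
move=> HP H0 HS.
have W k j s1 : j + k = N -> P j s1 -> exists m s',
    [/\ ceval (While (ILt i n) (Seq body (Op (IInc i)))) s1 m s', m <= k * (C + 2) + 1 & P N s'].
  elim: k j s1 => [|k IH] j s1 e p; have [e1 e2] := HP _ _ p.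
    exists 1, s1; split=> //; last by rewrite -e addn0.
    by apply: EvWhileF; rewrite /= e1 e2 -e addn0 ltnn.
  have [|m1 [s2 [v1 b1 p1]]] := HS j s1 _ p; first by lia.
  have [|m2 [s3 [v2 b2 p2]]] := IH j.+1 _ _ p1; first by lia.
  exists ((m1 + 1) + m2).+1, s3; split=> //; last by rewrite mulSn; lia.
  apply: EvWhileT v2; first by rewrite /= e1 e2; lia.
  by apply: EvSeq v1 _; apply: EvOp.
have [|m [s' [v b p]]] := W N 0 _ _ H0; first by [].
exists (1 + m), s'; split=> //; last by lia.
by apply: EvSeq v; apply: EvOp.
Qed.

Definition frame (k : nat) (s s' : store) :=
  (forall x, x < k -> reg s' x = reg s x) /\ arr s' = arr s.

Lemma frame_trans k s1 s2 s3 : frame k s1 s2 -> frame k s2 s3 -> frame k s1 s3.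
Proof. by move=> [h1 e1] [h2 e2]; split; [move=> x hx; rewrite h2 ?h1 | rewrite e2]. Qed.

Lemma frame_le k k' s1 s2 : k <= k' -> frame k' s1 s2 -> frame k s1 s2.
Proof. by move=> h [h1 e1]; split=> // x hx; apply: h1; lia. Qed.

Lemma CCopy_eval x y s : x != y -> exists m s',
  [/\ ceval (CCopy x y) s m s', m <= reg s x * 3 + 2,
      forall z, reg s' z = if z == y then reg s x else reg s z & arr s' = arr s].
Proof.
move=> nxy.
have [|||m [s' [v b [h1 h2]]]] := @CFor_eval y x (Op nop) s (reg s x) 1
   (fun j s1 => (forall z, reg s1 z = if z == y then j else reg s z) /\ arr s1 = arr s).
- by move=> j s1 [h _]; rewrite !h eqxx (negbTE nxy).
- by split=> // z; rewrite /= /updf.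
- move=> j s1 _ [h1 h2]; exists 1, s1; split=> //; first by apply: (EvOp nop).
  by split=> // z; rewrite /= /updf !h1 eqxx; case: eqP.
by exists m, s'; split.
Qed.

Lemma incs_eval k n s : exists s', [/\ ceval (iter n (Seq (Op (IInc k))) (Op nop)) s n.+1 s',
  reg s' k = n + reg s k & frame k s s'].
Proof.
elim: n s => [|n IH] s; first by exists s; split=> //; apply: (EvOp nop s).
have [s2 [v2 e2 f2]] := IH (effect (IInc k) s).
exists s2; split.
- by rewrite -[n.+2]add1n; apply: EvSeq v2; apply: EvOp.
- by rewrite e2 /= /updf eqxx addSnnS.
- by apply: frame_trans f2; split=> //= x hx; rewrite /updf; case: eqP; [lia |].
Qed.

(** The result goes to register [k], and all registers above [k] are scratch. Register 0 holds 0, so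
    a variable out of range has the default value 0 in the code as well as in [eval]. *)
Fixpoint code (A : nat) (k : nat) (ve : seq nat) (e : expr) : cmd :=
  match e with
  | EVar j => CCopy (nth 0 ve j) k
  | ECst n => Seq (Op (IRst k)) (iter n (Seq (Op (IInc k))) (Op nop))
  | EAdd a b =>
      Seq (code A k ve a) (Seq (code A k.+1 ve b) (CFor k.+2 k.+1 (Op (IInc k))))
  | EMul a b =>
      Seq (code A k.+1 ve a) (Seq (code A k.+2 ve b) (Seq (Op (IRst k))
        (CFor k.+3 k.+1 (CFor k.+4 k.+2 (Op (IInc k))))))
  | ELeq a b =>
      Seq (code A k.+1 ve a) (Seq (code A k.+2 ve b) (Seq (Op (IRst k))
        (If (ILt k.+2 k.+1) (Op nop) (Op (IInc k)))))
  | EIter b i f c =>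
      Seq (code A k.+2 ve b) (Seq (code A k.+3 ve c) (Seq (code A k.+4 ve i)
        (Seq (If (ILt k.+3 k.+4) (CCopy k.+3 k) (CCopy k.+4 k))
          (CFor k.+1 k.+2 (Seq (code A k.+4 (k :: k.+1 :: ve) f)
             (If (ILt k.+3 k.+4) (CCopy k.+3 k) (CCopy k.+4 k)))))))
  | ESrc a =>
      Seq (code A k.+1 ve a) (Seq (Op (IRst k))
        (If (IRd A k.+1 (fun o => o == Some true)) (Op (IInc k)) (Op nop)))
  end.

Section CodeCorrect.
Variable A : nat.

Definition env_ok (src : nat -> bool) k (ve : seq nat) (env : seq nat) (s : store) :=
  [/\ 0 < k, all (gtn k) ve, size ve = size env, reg s 0 = 0 &
      forall j, reg s (nth 0 ve j) = nth 0 env j] /\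
  forall i, (arr s A i == Some true) = src i.

Lemma nth_ve src k ve env s j : env_ok src k ve env s -> nth 0 ve j < k.
Proof.
case=> -[k0 /allP h _ _ _] _; case: (ltnP j (size ve)) => hj; last by rewrite nth_default.
exact: h (mem_nth _ hj).
Qed.

Lemma env_ok_frame src k k' ve env s s' : k <= k' ->
  env_ok src k ve env s -> frame k s s' -> env_ok src k' ve env s'.
Proof.
move=> kk ok [h1 h2]; have hn := fun j => nth_ve j ok.
case: ok => -[k0 hv sz r0 he] ha; split; last by rewrite h2.
split=> //; first by lia.
- by apply: sub_all hv => x /=; lia.
- by rewrite h1.
- by move=> j; rewrite h1.
Qed.

Definition code_ok e (v f : nat -> nat) := forall src k ve env s M,
  env_ok src k ve env s -> (forall j, nth 0 env j <= M) ->
  eval src env e <= v M /\ exists n s',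
  [/\ ceval (code A k ve e) s n s', n <= f M, reg s' k = eval src env e & frame k s s'].

Lemma min_copy_eval x y z s : z != x -> z != y -> exists m s',
  [/\ ceval (If (ILt x y) (CCopy x z) (CCopy y z)) s m s',
      m <= minn (reg s x) (reg s y) * 3 + 3,
      forall t, reg s' t = if t == z then minn (reg s x) (reg s y) else reg s t &
      arr s' = arr s].
Proof.
move=> zx zy.
have nz : (if reg s x < reg s y then x else y) != z by case: ifP; rewrite eq_sym.
have [m [s' [v b h1 h2]]] := CCopy_eval s nz.
exists m.+1, s'; split=> //; last 1 first.
- by move=> t; rewrite h1 /minn; case: ifP => // _; case: ifP.
- by apply: EvIf; move: v; rewrite /=; case: ifP.
- by move: b; rewrite /minn; case: ifP; lia.
Qed.

(** Values and running times are bounded together, since the length of a loop is a value. In [EIter]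
    the cap bounds every intermediate value, so the body always runs in an environment bounded by
    [M + vb M + vc M]; without it iterated squaring would break the bound. *)
Lemma code_correct e : exists v f, [/\ poly v, poly f & code_ok e v f].
Proof.
elim: e => [j|n|a [va [fa [pva pfa IHa]]] b [vb [fb [pvb pfb IHb]]]
  |a [va [fa [pva pfa IHa]]] b [vb [fb [pvb pfb IHb]]]
  |a [va [fa [pva pfa IHa]]] b [vb [fb [pvb pfb IHb]]]
  |b [vb [fb [pvb pfb IHb]]] i [vi [fi [pvi pfi IHi]]] f [vf [ff [pvf pff IHf]]]
     c [vc [fc [pvc pfc IHc]]]
  |a [va [fa [pva pfa IHa]]]].
- exists id, (fun M => M * 3 + 2); split; [poly_tac | poly_tac |].
  move=> src k ve env s M ok hM; split; first exact: hM.
  have hn := nth_ve j ok; case: ok => -[k0 hv sz r0 he] ha.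
  have [|m [s' [v b h1 h2]]] := @CCopy_eval (nth 0 ve j) k s; first by rewrite neq_ltn hn.
  exists m, s'; split=> //; [have := hM j | | ].
  + by rewrite -he; lia.
  + by rewrite h1 eqxx.
  + by split=> // x hx; rewrite h1; case: eqP => // ?; lia.
- exists (fun=> n), (fun=> n + 2); split; [poly_tac | poly_tac |].
  move=> src k ve env s M ok hM; split=> //.
  have [s' [v h1 h2]] := incs_eval k n (effect (IRst k) s).
  have f0 : frame k s (effect (IRst k) s).
    by split=> //= x hx; rewrite /updf; case: eqP; [lia |].
  exists (1 + n.+1), s'; split.
  + by apply: EvSeq v; apply: EvOp.
  + by lia.
  + by rewrite h1 /= /updf eqxx addn0.
  + exact: frame_trans f0 h2.
- exists (fun M => va M + vb M), (fun M => fa M + fb M + (vb M * 3 + 2)).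
  split; [poly_tac | poly_tac |].
  move=> src k ve env s M ok hM.
  have [Va [n1 [s1 [e1 b1 r1 f1]]]] := IHa _ _ _ _ _ _ ok hM.
  have ok1 : env_ok src k.+1 ve env s1 by apply: env_ok_frame f1.
  have [Vb [n2 [s2 [e2 b2 r2 f2]]]] := IHb _ _ _ _ _ _ ok1 hM.
  split=> /=; first by lia.
  have [|||n3 [s3 [e3 b3 [h1 h2 h3 h4]]]] := @CFor_eval k.+2 k.+1 (Op (IInc k)) s2
     (eval src env b) 1 (fun j s1 => [/\ reg s1 k.+2 = j, reg s1 k.+1 = eval src env b,
        reg s1 k = eval src env a + j & frame k s2 s1]).
  + by move=> j s3 [-> ->].
  + split; rewrite /= /updf ?eqxx //.
    * by case: eqP; [lia |].
    * by case: eqP; [lia | rewrite addn0 (proj1 f2) // r1].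
    * by split=> //= x hx; rewrite /updf; case: eqP => //; lia.
  + move=> j s3 _ [h1 h2 h3 [h4 h5]]; exists 1, (effect (IInc k) s3); split=> //.
      exact: EvOp.
    rewrite /= /updf /= !eqxx; split.
    * by case: eqP => //; lia.
    * by case: eqP; [lia | case: eqP => //; lia].
    * by case: eqP; [lia | rewrite h3; lia].
    * by split=> //= x hx; rewrite /updf; case: eqP; [lia | case: eqP; [lia | rewrite h4]].
  exists (n1 + (n2 + n3)), s3; split=> //.
  + by apply: EvSeq e1 _; apply: EvSeq e2 _.
  + have := leq_mul Vb (leqnn 3); lia.
  + by apply: frame_trans f1 (frame_trans (frame_le _ f2) h4).
- exists (fun M => va M * vb M),
    (fun M => fa M + fb M + (1 + (va M * (vb M * 3 + 4) + 2))).
  split; [poly_tac | poly_tac |].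
  move=> src k ve env s M ok hM.
  have ok0 : env_ok src k.+1 ve env s by apply: env_ok_frame ok _.
  have [Va [n1 [s1 [e1 b1 r1 f1]]]] := IHa _ _ _ _ _ _ ok0 hM.
  have ok1 : env_ok src k.+2 ve env s1 by apply: env_ok_frame f1.
  have [Vb [n2 [s2 [e2 b2 r2 f2]]]] := IHb _ _ _ _ _ _ ok1 hM.
  split=> /=; first by apply: leq_mul.
  set X := eval src env a in Va r1 *; set Y := eval src env b in Vb r2 *.
  have r1' : reg s2 k.+1 = X by rewrite (proj1 f2).
  have [|||n3 [s3 [e3 b3 [h1 h2 h3 h4 h5]]]] := @CFor_eval k.+3 k.+1
    (CFor k.+4 k.+2 (Op (IInc k))) (effect (IRst k) s2) X (Y * 3 + 2)
     (fun j s1 => [/\ reg s1 k.+3 = j, reg s1 k.+1 = X, reg s1 k.+2 = Y,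
        reg s1 k = j * Y & frame k s2 s1]).
  + by move=> j s3 [-> ->].
  + rewrite /= /updf; split; rewrite ?eqxx //.
    1,2: by case: eqP; [lia | case: eqP; [lia |]].
    * by case: eqP; [lia |].
    * by split=> //= x hx; rewrite /updf; case: eqP; [lia | case: eqP; [lia |]].
  + move=> j s3 _ [h1 h2 h3 h4 h5].
    have [|||n4 [s4 [e4 b4 [g1 g2 g3 g4 g5]]]] := @CFor_eval k.+4 k.+2 (Op (IInc k)) s3
     Y 1 (fun j s1 => [/\ reg s1 k.+4 = j, reg s1 k.+2 = Y, reg s1 k = reg s3 k + j,
        (reg s1 k.+1 = X /\ reg s1 k.+3 = reg s3 k.+3) & frame k s3 s1]).
    * by move=> ? ? [-> ->].
    * rewrite /= /updf; split; rewrite ?eqxx //; try (by case: eqP; [lia |]).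
        by case: eqP; [lia | rewrite addn0].
      by split; case: eqP; [lia | | lia |].
    * by split=> //= x hx; rewrite /updf; case: eqP; [lia |].
    * move=> i s5 _ [g1 g2 g3 [g4 g4'] g5]; exists 1, (effect (IInc k) s5); split=> //.
        exact: EvOp.
      rewrite /= /updf; split; rewrite ?eqxx //.
      - by case: eqP; [lia | rewrite g1].
      - by case: eqP; [lia | case: eqP; [lia |]].
      - by case: eqP; [lia | rewrite g3; lia].
      - by split; case: eqP; [lia | case: eqP; [lia |] | lia | case: eqP; [lia |]].
      - by split; [move=> x hx /=; rewrite /updf; case: eqP; [lia | case: eqP; [lia | rewrite (proj1 g5)]]
          | rewrite /= (proj2 g5)].
    exists n4, s4; split=> //.
    rewrite /= /updf; split; rewrite ?eqxx //.
    * by rewrite (proj2 g4) h1.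
    * by case: eqP; [lia | rewrite (proj1 g4)].
    * by case: eqP; [lia | rewrite g2].
    * by case: eqP; [lia | rewrite g3 h4; lia].
    * apply: frame_trans h5 _; apply: frame_trans g5 _.
      by split=> //= x hx; rewrite /updf; case: eqP; [lia |].
  exists (n1 + (n2 + (1 + n3))), s3; split=> //.
  + apply: EvSeq e1 _; apply: EvSeq e2 _; apply: EvSeq e3; exact: EvOp.
  + have : X * (Y * 3 + 2 + 2) <= va M * (vb M * 3 + 4) by apply: leq_mul; lia.
    lia.
  + by apply: frame_trans (frame_le (leqnSn _) f1) (frame_trans (frame_le _ f2) h5); lia.
- exists (fun=> 1), (fun M => fa M + fb M + 4).
  split; [poly_tac | poly_tac |].
  move=> src k ve env s M ok hM.
  have ok0 : env_ok src k.+1 ve env s by apply: env_ok_frame ok _.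
  have [Va [n1 [s1 [e1 b1 r1 f1]]]] := IHa _ _ _ _ _ _ ok0 hM.
  have ok1 : env_ok src k.+2 ve env s1 by apply: env_ok_frame f1.
  have [Vb [n2 [s2 [e2 b2 r2 f2]]]] := IHb _ _ _ _ _ _ ok1 hM.
  split=> /=; first exact: leq_b1.
  set X := eval src env a in Va r1 *; set Y := eval src env b in Vb r2 *.
  have r1' : reg s2 k.+1 = X by rewrite (proj1 f2).
  pose s3 := effect (IRst k) s2.
  have fr3 : frame k s2 s3 by split=> //= x hx; rewrite /updf; case: eqP; [lia |].
  have fr : frame k s s3.
    by apply: frame_trans (frame_le (leqnSn _) f1) (frame_trans (frame_le _ f2) fr3); lia.
  have oc : outcome (ILt k.+2 k.+1) s3 = ~~ (X <= Y).
    by rewrite /= /updf; case: eqP; [lia | case: eqP; [lia | rewrite r1' r2; lia]].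
  exists (n1 + (n2 + (1 + 2))), (if X <= Y then effect (IInc k) s3 else s3); split.
  + apply: EvSeq e1 _; apply: EvSeq e2 _; apply: EvSeq (EvOp _ _) _.
    apply: EvIf; rewrite oc /=; case: (X <= Y) => /=; last exact: (EvOp nop).
    exact: (EvOp (IInc k)).
  + by lia.
  + by rewrite /s3; case: (X <= Y); rewrite /= /updf !eqxx.
  + case: (X <= Y) => //; apply: frame_trans fr _.
    by split=> //= x hx; rewrite /updf; case: eqP; [lia |].
- exists vc, (fun M => fb M + fc M + fi M + (vc M * 3 + 3) +
    (vb M * ((ff (M + vb M + vc M) + (vc M * 3 + 3)) + 2) + 2)).
  split; [poly_tac | poly_tac |].
  move=> src k ve env s M ok hM.
  have ok0 : env_ok src k.+2 ve env s by apply: env_ok_frame ok _; [lia |].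
  have [Vb [n1 [s1 [e1 b1 r1 f1]]]] := IHb _ _ _ _ _ _ ok0 hM.
  have ok1 : env_ok src k.+3 ve env s1 by apply: env_ok_frame f1.
  have [Vc [n2 [s2 [e2 b2 r2 f2]]]] := IHc _ _ _ _ _ _ ok1 hM.
  have ok2 : env_ok src k.+4 ve env s2 by apply: env_ok_frame f2.
  have [Vi [n3 [s3 [e3 b3 r3 f3]]]] := IHi _ _ _ _ _ _ ok2 hM.
  have f13 : frame k.+2 s s3.
    by apply: frame_trans f1 (frame_trans (frame_le _ f2) (frame_le _ f3)); lia.
  set B := eval src env b in Vb r1 *; set C := eval src env c in Vc r2 *.
  pose step j v := minn C (eval src (v :: j :: env) f).
  pose val j := iteri j step (minn C (eval src env i)).
  have val_le j : val j <= C by case: j => [|j] /=; apply: geq_minl.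
  split=> /=; first exact: leq_trans (val_le B) Vc.
  have rB3 : reg s3 k.+2 = B by rewrite (proj1 f3) ?(proj1 f2) //; lia.
  have rC3 : reg s3 k.+3 = C by rewrite (proj1 f3).
  have [||n4 [s4 [e4 b4 h4 a4]]] := @min_copy_eval k.+3 k.+4 k s3; [lia | lia | ].
  rewrite rC3 r3 in b4 h4.
  have [|||n5 [s5 [e5 b5 [g1 g2 g3 g4 g5]]]] := @CFor_eval k.+1 k.+2
    (Seq (code A k.+4 [:: k, k.+1 & ve] f) (If (ILt k.+3 k.+4) (CCopy k.+3 k) (CCopy k.+4 k)))
    s4 B (ff (M + vb M + vc M) + (vc M * 3 + 3))
    (fun j s1 => [/\ reg s1 k.+1 = j, reg s1 k.+2 = B, reg s1 k.+3 = C,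
        reg s1 k = val j & frame k s s1]).
  + by move=> ? ? [-> ->].
  + rewrite /= /updf; split; rewrite ?eqxx //.
    * by case: eqP; [lia | rewrite h4 rB3; case: eqP; [lia |]].
    * by case: eqP; [lia | rewrite h4 rC3; case: eqP; [lia |]].
    * by case: eqP; [lia | rewrite h4 eqxx].
    * apply: frame_trans (frame_le _ f13) _; first by lia.
      by split=> //= x hx; rewrite /updf; case: eqP; [lia | rewrite h4; case: eqP; [lia |]].
  + move=> j s6 jB [g1 g2 g3 g4 g5].
    have ok6 : env_ok src k.+4 [:: k, k.+1 & ve] [:: val j, j & env] s6.
      have := env_ok_frame (leqnn k) ok g5 => -[[k0 hv sz r0 he] ha]; split=> //; split=> //.
      * by apply/and3P; split; rewrite /=; [lia | lia | apply: sub_all hv => x /=; lia].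
      * by rewrite /= sz.
      * by case=> [|[|l]] //=.
    have [|Vf [n7 [s7 [e7 b7 r7 f7]]]] := IHf _ _ _ _ _ (M + vb M + vc M) ok6.
      case=> [|[|l]] /=; [have := val_le j; lia | lia | have := hM l; lia].
    have rC7 : reg s7 k.+3 = C by rewrite (proj1 f7).
    have [||n8 [s8 [e8 b8 h8 a8]]] := @min_copy_eval k.+3 k.+4 k s7; [lia | lia | ].
    rewrite rC7 r7 in b8 h8.
    have r71 : reg s7 k.+1 = j by rewrite (proj1 f7) //; lia.
    have r72 : reg s7 k.+2 = B by rewrite (proj1 f7) //; lia.
    exists (n7 + n8), s8; split; first exact: EvSeq e7 e8.
      by lia.
    rewrite /= /updf; split; rewrite ?eqxx //.
    * by rewrite h8; case: eqP; [lia | rewrite r71].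
    * by case: eqP; [lia | rewrite h8; case: eqP; [lia |]].
    * by case: eqP; [lia | rewrite h8; case: eqP; [lia |]].
    * by case: eqP; [lia | rewrite h8 eqxx].
    * apply: frame_trans g5 _; apply: frame_trans (frame_le _ f7) _; first by lia.
      by split=> //= x hx; rewrite /updf; case: eqP; [lia | rewrite h8; case: eqP; [lia |]].
  exists (n1 + (n2 + (n3 + (n4 + n5)))), s5; split=> //.
  + by apply: EvSeq e1 _; apply: EvSeq e2 _; apply: EvSeq e3 _; apply: EvSeq e4 _.
  + have : B * (ff (M + vb M + vc M) + (vc M * 3 + 3) + 2) <=
           vb M * (ff (M + vb M + vc M) + (vc M * 3 + 3) + 2) by rewrite leq_mul2r Vb orbT.
    by lia.
- exists (fun=> 1), (fun M => fa M + 3).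
  split; [poly_tac | poly_tac |].
  move=> src k ve env s M ok hM.
  have ok0 : env_ok src k.+1 ve env s by apply: env_ok_frame ok _.
  have [Va [n1 [s1 [e1 b1 r1 f1]]]] := IHa _ _ _ _ _ _ ok0 hM.
  split=> /=; first exact: leq_b1.
  set X := eval src env a in Va r1 *.
  pose s3 := effect (IRst k) s1.
  have fr3 : frame k s1 s3 by split=> //= x hx; rewrite /updf; case: eqP; [lia |].
  have fr : frame k s s3.
    by apply: frame_trans (frame_le (leqnSn _) f1) fr3.
  have oc : outcome (IRd A k.+1 (fun o => o == Some true)) s3 = src X.
    rewrite /= /updf; have -> : (k.+1 == k) = false by lia.
    by rewrite r1 (proj2 f1) (proj2 ok).
  exists (n1 + (1 + 2)), (if src X then effect (IInc k) s3 else s3); split.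
  + apply: EvSeq e1 _; apply: EvSeq (EvOp _ _) _.
    apply: EvIf; rewrite oc /=; case: (src X) => /=; last exact: (EvOp nop).
    exact: (EvOp (IInc k)).
  + by lia.
  + by rewrite /s3; case: (src X); rewrite /= /updf !eqxx.
  + case: (src X) => //; apply: frame_trans fr _.
    by split=> //= x hx; rewrite /updf; case: eqP; [lia |].
Qed.

End CodeCorrect.

(** * Compilation of output terms *)

Fixpoint ocode (A k : nat) (ve : seq nat) (o : out) : cmd :=
  match o with
  | OEmit b => Seq (Op (IWr 1 1 b)) (Op (IInc 1))
  | OCat a b => Seq (ocode A k ve a) (ocode A k ve b)
  | OFor e a => Seq (code A k ve e) (CFor k.+1 k (ocode A k.+2 (k.+1 :: ve) a))
  end.

Definition written (l : seq bool) (s : store) :=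
  reg s 1 = size l /\ forall i, arr s 1 i = onth l i.

Definition oframe k (s s' : store) :=
  (forall x, x < k -> x != 1 -> reg s' x = reg s x) /\
  (forall a, a != 1 -> arr s' a = arr s a).

Lemma frame_oframe k s s' : frame k s s' -> oframe k s s'.
Proof. by move=> [h1 h2]; split=> [x hx _|a _]; [apply: h1 | rewrite h2]. Qed.

Lemma oframe_trans k s1 s2 s3 : oframe k s1 s2 -> oframe k s2 s3 -> oframe k s1 s3.
Proof.
move=> [h1 e1] [h2 e2]; split=> [x hx nx|a na]; first by rewrite h2 ?h1.
by rewrite e2 ?e1.
Qed.

Lemma oframe_le k k' s1 s2 : k <= k' -> oframe k' s1 s2 -> oframe k s1 s2.
Proof. by move=> h [h1 e1]; split=> // x hx; apply: h1; lia. Qed.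

Lemma onth_rcons (T : Type) (l : seq T) b i :
  onth (rcons l b) i = if i == size l then Some b else onth l i.
Proof.
rewrite !onthE map_rcons nth_rcons size_map.
by case: ltngtP => // h; rewrite nth_default // size_map ltnW.
Qed.

Lemma written_frame k l s s' : 1 < k -> frame k s s' -> written l s -> written l s'.
Proof. by move=> k1 [h1 h2] [w1 w2]; split; [rewrite h1 | rewrite h2]. Qed.

Section OCode.
Variable A : nat.
Hypothesis A1 : A != 1.

Lemma env_ok_oframe src k k' ve env s s' : k <= k' -> 1 \notin ve -> 
  env_ok A src k ve env s -> oframe k s s' -> env_ok A src k' ve env s'.
Proof.
move=> kk n1 ok [h1 h2]; have hn := fun j => nth_ve j ok.
have hn1 j : nth 0 ve j != 1.
  case: (ltnP j (size ve)) => hj; last by rewrite nth_default.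
  by apply: contra n1 => /eqP <-; apply: mem_nth.
case: ok => -[k0 hv sz r0 he] ha; split; last by rewrite h2.
split=> //; first by lia.
- by apply: sub_all hv => x /=; lia.
- by rewrite h1.
- by move=> j; rewrite h1.
Qed.

Lemma ocode_correct o : exists g f, [/\ poly g, poly f &
  forall src k ve env s M l, env_ok A src k ve env s -> 1 < k -> 1 \notin ve ->
    (forall j, nth 0 env j <= M) -> written l s ->
    size (outp src env o) <= g M /\ exists n s', [/\ ceval (ocode A k ve o) s n s', n <= f M,
      written (l ++ outp src env o) s' & oframe k s s']].
Proof.
elim: o => [b|a [ga [fa [pga pfa IHa]]] b [gb [fb [pgb pfb IHb]]]
  |e a [ga [fa [pga pfa IHa]]]].
- exists (fun=> 1), (fun=> 2); split; [poly_tac | poly_tac |].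
  move=> src k ve env s M l ok k1 n1 hM [w1 w2]; split=> //.
  exists (1 + 1), (effect (IInc 1) (effect (IWr 1 1 b) s)); split=> //.
  + by apply: EvSeq; apply: EvOp.
  + rewrite /= cats1; split; first by rewrite /= /updf eqxx w1 size_rcons.
    by move=> i; rewrite /= /updf eqxx w1 onth_rcons w2.
  + by split=> [x hx nx|x nx] /=; rewrite /updf (negbTE nx).
- exists (fun M => ga M + gb M), (fun M => fa M + fb M); split; [poly_tac | poly_tac |].
  move=> src k ve env s M l ok k1 n1 hM w.
  have [Sa [m1 [s1 [e1 b1 w1 f1]]]] := IHa _ _ _ _ _ _ _ ok k1 n1 hM w.
  have ok1 := env_ok_oframe (leqnn k) n1 ok f1.
  have [Sb [m2 [s2 [e2 b2 w2 f2]]]] := IHb _ _ _ _ _ _ _ ok1 k1 n1 hM w1.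
  split; first by rewrite /= size_cat; lia.
  exists (m1 + m2), s2; split; [exact: EvSeq e1 e2 | lia | by rewrite /= catA |].
  exact: oframe_trans f1 f2.
- have [v [f [pv pf Hc]]] := code_correct A e.
  exists (fun M => v M * ga (M + v M)), (fun M => f M + (v M * (fa (M + v M) + 2) + 2)).
  split; [poly_tac | poly_tac |].
  move=> src k ve env s M l ok k1 n1 hM w.
  have [Ve [m1 [s1 [e1 b1 r1 f1]]]] := Hc _ _ _ _ _ _ ok hM.
  set N := eval src env e in Ve r1 *.
  have hM' j : j < N -> forall i, nth 0 (j :: env) i <= M + v M.
    by move=> jN [|i] /=; [lia | have := hM i; lia].
  pose pre j := flatten [seq outp src (j :: env) a | j <- iota 0 j].
  have preS j : pre j.+1 = pre j ++ outp src (j :: env) a.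
    by rewrite /pre -addn1 iotaD map_cat flatten_cat /= cats0 add0n.
  have n1' : 1 \notin k.+1 :: ve by rewrite inE negb_or n1 andbT; lia.
  have ok1 j s2 : reg s2 k.+1 = j -> oframe k s1 s2 ->
      env_ok A src k.+2 (k.+1 :: ve) (j :: env) s2.
    move=> rj fr.
    have ok2 : env_ok A src k ve env s2.
      apply: env_ok_oframe (leqnn k) n1 ok _; apply: oframe_trans (frame_oframe f1) fr.
    case: ok2 => -[k0 hv sz r0 he] ha; split=> //; split=> //=.
    * by rewrite leqnn; apply: sub_all hv => x /=; lia.
    * by rewrite sz.
    * by case.
  have [|||m2 [s2 [e2 b2 [h1 h2 h3 h4]]]] := @CFor_eval k.+1 k
     (ocode A k.+2 (k.+1 :: ve) a) s1 N (fa (M + v M))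
     (fun j s2 => [/\ reg s2 k.+1 = j, reg s2 k = N, written (l ++ pre j) s2 & oframe k s1 s2]).
  + by move=> ? ? [-> ->].
  + have fr : frame k s1 (effect (IRst k.+1) s1).
      by split=> //= x hx; rewrite /updf; case: eqP; [lia |].
    split; rewrite /= ?/updf ?eqxx //.
    * by case: eqP; [lia |].
    * by rewrite cats0; apply: (written_frame _ fr) => //; apply: (written_frame _ f1).
    * exact: frame_oframe.
  + move=> j s2 jN [h1 h2 h3 h4].
    have [|_ [m3 [s3 [e3 b3 w3 f3]]]] :=
       IHa _ _ _ _ _ _ _ (ok1 _ _ h1 h4) _ n1' (hM' _ jN) h3; first by lia.
    exists m3, s3; split=> //.
    have k31 : k != 1 by lia.
    have r3 : reg s3 k.+1 = j by rewrite (proj1 f3) //; lia.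
    have rk : reg s3 k = N by rewrite (proj1 f3) //; lia.
    have fr : frame k.+1 s3 (effect (IInc k.+1) s3).
      by split=> //= x hx; rewrite /updf; case: eqP; [lia |].
    split.
    * by rewrite /= /updf eqxx r3.
    * by rewrite (proj1 fr).
    * by rewrite preS catA; apply: (written_frame _ fr) => //; lia.
    * apply: oframe_trans h4 _; apply: oframe_trans (oframe_le _ f3) _; first by lia.
      by apply: oframe_le (frame_oframe fr); lia.
  split.
    have Sj j : j < N -> size (outp src (j :: env) a) <= ga (M + v M).
      (* The induction hypothesis speaks of stores only, so one with loop variable [j] is made up to
         bound the output of round [j]. *)
      move=> jN; pose s3 := Store (updf (reg s1) k.+1 j) (arr s1).
      have fr : frame k s1 s3 by split=> //= x hx; rewrite /updf; case: eqP; [lia |].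
      have r3 : reg s3 k.+1 = j by rewrite /= /updf eqxx.
      have w3 := written_frame k1 fr (written_frame k1 f1 w).
      by have [|//] := IHa _ _ _ _ _ _ _ (ok1 _ _ r3 (frame_oframe fr)) _ n1' (hM' _ jN) w3; lia.
    have {}Sj n : n <= N -> size (pre n) <= n * ga (M + v M).
      elim: n => [//|n IHn] lt; rewrite preS size_cat mulSn addnC.
      by apply: leq_add; [apply: Sj | apply: IHn; apply: ltnW].
    by apply: leq_trans (Sj N (leqnn _)) _; rewrite leq_mul2r Ve orbT.
  exists (m1 + m2), s2; split=> //; first exact: EvSeq e1 e2.
  + have : N * (fa (M + v M) + 2) <= v M * (fa (M + v M) + 2) by rewrite leq_mul2r Ve orbT.
    by lia.
  + exact: oframe_trans (frame_oframe f1) h4.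
Qed.
End OCode.

(** * Inversion and determinism of evaluation *)

Lemma ceval_Op i s n s' : ceval (Op i) s n s' -> n = 1 /\ s' = effect i s.
Proof. by move=> h; inversion h. Qed.

Lemma ceval_Seq a b s n s' : ceval (Seq a b) s n s' ->
  exists n1 s1 n2, [/\ n = n1 + n2, ceval a s n1 s1 & ceval b s1 n2 s'].
Proof. by move=> h; inversion h; subst; exists n1, s1, n2. Qed.

Lemma ceval_If i a b s n s' : ceval (If i a b) s n s' ->
  exists2 m, n = m.+1 & ceval (if outcome i s then a else b) (effect i s) m s'.
Proof. by move=> h; inversion h; subst; exists n0. Qed.

Lemma ceval_While i a s n s' : ceval (While i a) s n s' ->
  if outcome i s then exists n1 s1 n2,
    [/\ n = (n1 + n2).+1, ceval a (effect i s) n1 s1 & ceval (While i a) s1 n2 s']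
  else n = 1 /\ s' = effect i s.
Proof.
move=> h; inversion h as [| | |? ? ? o|? ? ? n1 s1 n2 ? o h1 h2|]; subst.
  by rewrite (negbTE o).
by rewrite o; exists n1, s1, n2.
Qed.

(** The correctness lemmas exhibit one run of a program. Soundness of the verifier starts from a
    given run, whose choice-free parts are identified with the exhibited ones by this lemma. *)
Lemma ceval_det c s n1 s1 n2 s2 : choice_free c ->
  ceval c s n1 s1 -> ceval c s n2 s2 -> n1 = n2 /\ s1 = s2.
Proof.
move=> cf h; elim: h cf n2 s2 => {c s n1 s1}.
- by move=> i s _ n2 s2 /ceval_Op [-> ->].
- move=> c1 c2 s n1 s1 n2 s2 _ IH1 _ IH2 /andP[f1 f2] n3 s3 /ceval_Seq [m1 [t1 [m2 [-> h1 h2]]]].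
  have [-> E] := IH1 f1 _ _ h1; rewrite -E in h2.
  by have [-> ->] := IH2 f2 _ _ h2.
- move=> i c1 c2 s n s' _ IH /andP[f1 f2] n3 s3 /ceval_If [m -> h].
  have [|-> ->] // := IH _ _ _ h; by case: ifP.
- by move=> i c s o f n3 s3 /ceval_While; rewrite (negbTE o) => -[-> ->].
- move=> i c s n1 s1 n2 s2 o _ IH1 _ IH2 f n3 s3 /ceval_While; rewrite o.
  move=> [m1 [t1 [m2 [-> h1 h2]]]].
  have [-> E] := IH1 f _ _ h1; rewrite -E in h2.
  by have [-> ->] := IH2 f _ _ h2.
- by [].
Qed.

Lemma CCopy_wf x y : 0 < y -> cmd_wf (CCopy x y) && choice_free (CCopy x y).
Proof. by move=> h; rewrite /= h. Qed.

Lemma code_wf A k ve e : A < 3 -> 0 < k ->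
  cmd_wf (code A k ve e) && choice_free (code A k ve e).
Proof.
move=> A3; elim: e k ve => [j|n|a IHa b IHb|a IHa b IHb|a IHa b IHb|b IHb i IHi f IHf c IHc|a IHa] k ve k0.
- exact: CCopy_wf.
- by rewrite /= k0 /=; elim: n => //= n /andP[-> ->]; rewrite k0.
- by have /andP[h1 h2] := IHa k ve k0; have /andP[h3 h4] := IHb k.+1 ve isT; rewrite /= h1 h2 h3 h4 k0.
- by have /andP[h1 h2] := IHa k.+1 ve isT; have /andP[h3 h4] := IHb k.+2 ve isT; rewrite /= h1 h2 h3 h4 k0.
- by have /andP[h1 h2] := IHa k.+1 ve isT; have /andP[h3 h4] := IHb k.+2 ve isT; rewrite /= h1 h2 h3 h4 k0.
- have /andP[h1 h2] := IHb k.+2 ve isT; have /andP[h3 h4] := IHc k.+3 ve isT.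
  have /andP[h5 h6] := IHi k.+4 ve isT; have /andP[h7 h8] := IHf k.+4 [:: k, k.+1 & ve] isT.
  by rewrite /= h1 h2 h3 h4 h5 h6 h7 h8 k0.
- by have /andP[h1 h2] := IHa k.+1 ve isT; rewrite /= h1 h2 k0 A3.
Qed.

Lemma ocode_wf A k ve o : A < 3 -> 0 < k ->
  cmd_wf (ocode A k ve o) && choice_free (ocode A k ve o).
Proof.
move=> A3; elim: o k ve => [b|a IHa b IHb|e a IHa] k ve k0 //.
- by have /andP[h1 h2] := IHa k ve k0; have /andP[h3 h4] := IHb k ve k0; rewrite /= h1 h2 h3 h4.
- have /andP[h1 h2] := IHa k.+2 (k.+1 :: ve) isT; have /andP[h3 h4] := code_wf ve e A3 k0.
  by rewrite /= h1 h2 h3 h4.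
Qed.

(** * Polynomial-time functions and NP languages from expressions *)

Definition len_prog := While (IRd 0 2 isSome) (Op (IInc 2)).

Lemma len_eval w : exists n s, [/\ ceval len_prog (init_store w) n s, n <= 2 * size w + 1,
  forall x, reg s x = if x == 2 then size w else 0 & arr s = arr (init_store w)].
Proof.
have W k s : (forall x, reg s x = if x == 2 then size w - k else 0) -> k <= size w ->
    arr s = arr (init_store w) -> exists n s', [/\ ceval len_prog s n s', n <= 2 * k + 1,
      forall x, reg s' x = if x == 2 then size w else 0 & arr s' = arr (init_store w)].
  elim: k s => [|k IH] s hr hk ha.
    exists 1, s; split=> //; last by move=> x; rewrite hr subn0.
    by apply: EvWhileF; rewrite /= hr ha /= subn0 onthE nth_default // size_map.
  have [|||n [s' [e b h1 h2]]] := IH (effect (IInc 2) s).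
  - by move=> x; rewrite /= /updf !hr; case: eqP => // _; rewrite /=; lia.
  - exact: ltnW.
  - by [].
  exists (1 + n).+1, s'; split=> //; last by lia.
  apply: EvWhileT (EvOp _ _) e; rewrite /= hr ha /= onthE (nth_map false) //; lia.
by apply: W => // x; case: eqP => //; rewrite subnn.
Qed.

Lemma onth_eq_true w i : (onth w i == Some true) = nth false w i.
Proof.
rewrite onthE; case: (ltnP i (size w)) => h; last by rewrite !nth_default ?size_map.
by rewrite (nth_map false) //; case: nth.
Qed.

Theorem poly_computable_out o f :
  (forall w, f w = outp (nth false w) [:: size w] o) -> poly_computable f.
Proof.
move=> hf.
have [g [p [pg pp H]]] := @ocode_correct 0 isT o.
have [k hk] : exists k, forall M, (2 * M + 1 + p M) * (2 * (2 * M + 1 + p M) + 3) + 1 + (2 * g M + 1)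
    <= pbound k M by apply: poly_pbound; poly_tac.
have /andP[w1 w2] := @ocode_wf 0 3 [:: 2] o isT isT.
apply: (@poly_computable_cmd (Seq len_prog (ocode 0 3 [:: 2] o)) f k) => //= w.
have [n1 [s1 [e1 b1 r1 a1]]] := len_eval w.
have [|||||sz [n2 [s2 [e2 b2 [_ wr] _]]]] :=
    H (nth false w) 3 [:: 2] [:: size w] s1 (size w) [::] => //.
- split; last by move=> i; rewrite a1 /= onth_eq_true.
  by split=> // -[|[|j]] /=; rewrite r1.
- by case=> [|[|j]].
- by split; [rewrite r1 | move=> i; rewrite a1; case: i].
exists (n1 + n2), s2; split.
- apply: leq_trans (hk _); rewrite -hf in sz.
  have B : n1 + n2 <= 2 * size w + 1 + p (size w) by lia.
  have := leq_mul B (leq_add (leq_mul (leqnn 2) B) (leqnn 3)); lia.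
- exact: EvSeq e1 e2.
- by move=> i; rewrite wr /= -hf.
Qed.

Definition guess_body := Choose (Op (IWr 2 4 true)) (Op (IWr 2 4 false)).
Definition guess_loop := While (ILt 4 3) (Seq guess_body (Op (IInc 4))).

Lemma guess_inv s n s' : ceval guess_loop s n s' ->
  [/\ forall x, x != 4 -> reg s' x = reg s x, forall a, a != 2 -> arr s' a = arr s a &
      exists cert, forall i, arr s' 2 i =
        if reg s 4 <= i < reg s 3 then Some (cert i) else arr s 2 i].
Proof.
elim/ltn_ind: n s => n IH s /ceval_While /=; case: ifP => lt.
  case=> [n1 [s1 [n2 [En /ceval_Seq [m1 [t1 [m2 [_ h1 /ceval_Op [_ E1]]]]] h2]]]].
  have [b Et] : exists b, t1 = effect (IWr 2 4 b) s.
    inversion h1 as [| | | | |b ? ? ? ? ? h]; subst; exists b.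
    by case: b h => /ceval_Op [_ ->].
  have [|H1 H2 [cert H3]] := IH n2 _ s1 h2; first by lia.
  split.
  - by move=> x nx; rewrite H1 // E1 Et /= /updf (negbTE nx).
  - by move=> a na; rewrite H2 // E1 Et /= /updf (negbTE na).
  exists (fun i => if i == reg s 4 then b else cert i) => i.
  rewrite H3 E1 Et /= /updf /=.
  by case: (ltngtP (reg s 4) i) => h //=; rewrite -h lt.
case=> _ ->; split=> //; exists xpred0 => i.
by case: ifP => //; lia.
Qed.

Definition mismatch_test :=
  If (IRd 1 6 (fun o => o == Some true))
     (If (IRd 0 6 (fun o => o == Some true)) (Op nop) (Op (IInc 5)))
     (If (IRd 0 6 (fun o => o == Some false)) (Op nop) (Op (IInc 5))).

(* Arrays: 0 holds the input, 1 the output, 2 the guessed bits. Registers: 0 is the constant zero,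
   1 the output length, 2 the input length, 3 the number of guesses; 5 is nonzero after a failed
   test. *)
Definition verify_prog (phi : expr) (o : out) :=
  Seq (code 2 6 [:: 2] phi) (Seq (Op (IRst 5)) (Seq (If (ILt 0 6) (Op nop) (Op (IInc 5)))
    (Seq (ocode 2 6 [:: 2] o) (Seq (CFor 6 1 mismatch_test)
      (If (IRd 0 1 isSome) (Op (IInc 5)) (Op nop)))))).

Definition NP_prog (K phi : expr) (o : out) :=
  Seq len_prog (Seq (code 2 3 [:: 2] K) (Seq (CFor 4 3 guess_body)
    (Seq (verify_prog phi o) (If (ILt 0 5) Fail (Op nop))))).

Lemma onth_inj (T : Type) (l w : seq T) : (forall i, onth l i = onth w i) -> l = w.
Proof.
elim: l w => [|x l IH] [|y w] H //; try by have := H 0.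
by have [->] := H 0; congr (_ :: _); apply: IH => i; have := H i.+1.
Qed.

Lemma verify_correct phi o : exists f, poly f /\ forall cert w s,
  reg s 0 = 0 -> reg s 1 = 0 -> reg s 2 = size w ->
  (forall i, arr s 0 i = onth w i) -> (forall i, arr s 1 i = None) ->
  (forall i, (arr s 2 i == Some true) = cert i) ->
  exists n s', [/\ ceval (verify_prog phi o) s n s', n <= f (size w), reg s' 0 = 0 &
    (reg s' 5 == 0) = (0 < eval cert [:: size w] phi) && (outp cert [:: size w] o == w)].
Proof.
have [v [f [pv pf H1]]] := code_correct 2 phi.
have [g [p [pg pp H2]]] := @ocode_correct 2 isT o.
exists (fun M => f M + 1 + 2 + p M + (g M * 5 + 2) + 2); split; first poly_tac.
move=> cert w s r0 r1 r2 a0 a1 a2.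
have envM j : nth 0 [:: size w] j <= size w by case: j => [|[|j]].
have ok : env_ok 2 cert 6 [:: 2] [:: size w] s.
  by split=> //; split=> //; case=> [|[|j]] /=.
have [Vphi [n1 [s1 [e1 b1 h1 f1]]]] := H1 _ _ _ _ _ _ ok envM.
pose s2 := effect (IRst 5) s1.
pose s3 := if 0 < eval cert [:: size w] phi then s2 else effect (IInc 5) s2.
have e3 : ceval (If (ILt 0 6) (Op nop) (Op (IInc 5))) s2 2 s3.
  apply: EvIf; rewrite /s3 /= /updf /= h1 (proj1 f1) // r0.
  by case: ifP => _; [exact: (EvOp nop) | exact: EvOp].
have f3 : frame 5 s s3.
  apply: frame_trans (frame_le (isT : 5 <= 6) f1) _; rewrite /s3 /s2.
  by case: ifP => _; split=> //= x hx; rewrite /updf; have -> : (x == 5) = false by lia.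
have r35 : reg s3 5 = (eval cert [:: size w] phi == 0).
  by rewrite /s3; case: (eval _ _ _) => [|?].
have ok3 : env_ok 2 cert 6 [:: 2] [:: size w] s3.
  by split; [split=> //; [rewrite (proj1 f3) | case=> [|[|j]] /=; rewrite (proj1 f3)]
    | rewrite (proj2 f3)].
have w3 : written [::] s3.
  by split; [rewrite (proj1 f3) | move=> i; rewrite (proj2 f3) a1; case: i].
have [//|//|Sl [n4 [s4 [e4 b4 [wl wa] f4]]]] := H2 _ _ _ _ _ _ _ ok3 _ _ envM w3.
set l := outp _ _ _ in Sl wl wa *; rewrite cat0s in wl wa.
have [|||n5 [s5 [e5 b5 [h51 h52 h53 h54 h55]]]] := @CFor_eval 6 1 mismatch_test s4 (size l) 3
  (fun j s5 => [/\ reg s5 6 = j, reg s5 1 = size l, reg s5 0 = 0,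
     reg s5 5 = reg s3 5 + count (fun i => onth l i != onth w i) (iota 0 j) & arr s5 = arr s4]).
- by move=> ? ? [-> ->].
- rewrite /= /updf /=; split=> //; first by rewrite (proj1 f4) // (proj1 f3).
  by rewrite (proj1 f4) // addn0.
- move=> j s5 jl [g1 g2 g3 g4 g5].
  exists 3, (if onth l j != onth w j then effect (IInc 5) s5 else s5); split=> //.
    have A1 : arr s5 1 j = Some (nth false l j).
      by rewrite g5 wa onthE (nth_map false).
    have A0 : arr s5 0 j = onth w j by rewrite g5 (proj2 f4) // (proj2 f3) a0.
    apply: EvIf; rewrite /= g1 A1.
    have -> : onth l j = Some (nth false l j) by rewrite onthE (nth_map false).
    case: (nth false l j) => /=; apply: EvIf; rewrite /= g1 A0 eq_sym;
      by case: eqP => _; [exact: (EvOp nop) | exact: (EvOp (IInc 5))].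
  have -> : iota 0 j.+1 = iota 0 j ++ [:: j] by rewrite -addn1 iotaD.
  rewrite count_cat [count _ [:: j]]/= addn0.
  by case: ifP => _; rewrite /= /updf /=; split=> //; rewrite ?g1 ?g4 ?addn1 ?addn0 ?addnS.
pose s6 := if onth w (size l) then effect (IInc 5) s5 else s5.
exists (n1 + (1 + (2 + (n4 + (n5 + 2))))), s6; split.
- apply: EvSeq e1 _; apply: EvSeq (EvOp _ _) _; apply: EvSeq e3 _; apply: EvSeq e4 _.
  apply: EvSeq e5 _; apply: EvIf; rewrite /= h52 h55 (proj2 f4) // (proj2 f3) a0 /s6.
  by case: ifP => _; [exact: EvOp | exact: (EvOp nop)].
- have : size l * 5 <= g (size w) * 5 by rewrite leq_mul2r Sl orbT.
  by lia.
- by rewrite /s6; case: ifP => _; rewrite /= /updf.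
have -> : (reg s6 5 == 0) = (reg s5 5 == 0) && ~~ onth w (size l).
  by rewrite /s6; case: ifP => _; rewrite /= /updf ?andbT ?andbF.
rewrite h54 addn_eq0 r35; case: (eval _ _ _) => [|?] //=.
apply/andP/eqP => [[]|->].
  rewrite -leqn0 leqNgt -has_count => /hasPn H nw; apply: onth_inj => i.
  case: (ltnP i (size l)) => hi; first by have := H i; rewrite mem_iota /= hi negbK => /(_ isT) /eqP.
  rewrite !onthE !nth_default ?size_map //; apply: leq_trans hi.
  by rewrite leqNgt; apply: contra nw => h; rewrite onthE (nth_map false).
split; last by rewrite onthE nth_default // size_map.
by rewrite -leqn0 leqNgt -has_count; apply/hasPn => i _; rewrite eqxx.
Qed.

(** The certificate has to reproduce the input through [o], which replaces a parser. The number [K]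
    of guesses is computed before any guess is made, hence with the all-false source. *)
Theorem in_NP_out K phi o (L : language) :
  (forall w, L w <-> exists cert : nat -> bool,
     [/\ forall i, eval xpred0 [:: size w] K <= i -> cert i = false,
         0 < eval cert [:: size w] phi & outp cert [:: size w] o = w]) ->
  in_NP L.
Proof.
move=> HL.
have [v [f [pv pf HK]]] := code_correct 2 K.
have [g [pg HV]] := verify_correct phi o.
have [k hk] : exists k, forall M,
    (2 * M + 1 + (f M + ((v M * (2 + 2) + 2) + (g M + 2)))) *
      (2 * (2 * M + 1 + (f M + ((v M * (2 + 2) + 2) + (g M + 2)))) + 3) + 1 <= pbound k M.
  by apply: poly_pbound; poly_tac.
have /andP[w1 w2] := @code_wf 2 3 [:: 2] K isT isT.
have /andP[w3 w4] := @code_wf 2 6 [:: 2] phi isT isT.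
have /andP[w5 w6] := @ocode_wf 2 6 [:: 2] o isT isT.
have START w : exists n1 s1 n2 s2, [/\ ceval len_prog (init_store w) n1 s1,
    ceval (code 2 3 [:: 2] K) s1 n2 s2, n1 <= 2 * size w + 1 /\ n2 <= f (size w),
    [/\ reg s2 0 = 0, reg s2 1 = 0, reg s2 2 = size w & reg s2 3 = eval xpred0 [:: size w] K] &
    eval xpred0 [:: size w] K <= v (size w) /\ arr s2 = arr (init_store w)].
  have [n1 [s1 [e1 b1 r1 a1]]] := len_eval w.
  have [||Vk [n2 [s2 [e2 b2 r2 [f2 a2]]]]] := HK xpred0 3 [:: 2] [:: size w] s1 (size w).
  - split; last by move=> i; rewrite a1.
    by split=> // -[|[|j]] /=; rewrite r1.
  - by case=> [|[|j]].
  exists n1, s1, n2, s2; split=> //; last by rewrite a2 a1.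
  by split=> //; rewrite f2 // r1.
apply: (@in_NP_cmd (NP_prog K phi o) L k).
- by rewrite /= w1 w3 w5.
- move=> w n s' /ceval_Seq [m1 [t1 [m2 [_ h1 /ceval_Seq [m3 [t2 [m4 [_ h2]]]]]]]].
  move=> /ceval_Seq [m5 [t3 [m6 [_ h3 /ceval_Seq [m7 [t4 [m8 [_ h4 h5]]]]]]]].
  have [n1 [s1 [n2 [s2 [e1 e2 _ [r0 r1 r2 r3] [_ a2]]]]]] := START w.
  have [_ E1] := ceval_det (isT : choice_free len_prog) h1 e1; rewrite E1 in h2.
  have [_ E2] := ceval_det w2 h2 e2; rewrite E2 in h3.
  move: h3 => /ceval_Seq [m9 [t5 [m10 [_ /ceval_Op [_ E5] /guess_inv]]]].
  rewrite E5 /= /updf => -[g1 g2 [cert g3]].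
  pose ct i := (i < eval xpred0 [:: size w] K) && cert i.
  have [||||||n6 [s6 [e6 _ q0 q5]]] := HV ct w t3.
  1,2,3: by rewrite g1.
  + by move=> i; rewrite g2 //= a2.
  + by move=> i; rewrite g2 //= a2.
  + by move=> i; rewrite g3 /= r3 a2 /ct; case: ltnP => // _; case: (cert i).
  have cfv : choice_free (verify_prog phi o) by rewrite /= w4 w6.
  have [_ E6] := ceval_det cfv h4 e6; rewrite E6 in h5.
  move: h5 => /ceval_If [m11 _]; rewrite /= q0.
  case: ifP => [_ h|/negbT]; first by inversion h.
  rewrite -leqNgt leqn0 q5 => /andP[p1 /eqP p2] _.
  apply/HL; exists ct; split=> // i; by rewrite leqNgt /ct => /negbTE ->.
move=> w /HL [cert [c1 c2 c3]].
have [n1 [s1 [n2 [s2 [e1 e2 [b1 b2] [r0 r1 r2 r3] [Vk a2]]]]]] := START w.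
set N := eval xpred0 _ _ in c1 r3 Vk.
have [|||n3 [s3 [e3 b3 [h1 h2 [h3 h4 h5] h6 h7]]]] := @CFor_eval 4 3 guess_body s2 N 2
  (fun j s3 => [/\ reg s3 4 = j, reg s3 3 = N,
     [/\ reg s3 0 = 0, reg s3 1 = 0 & reg s3 2 = size w],
     forall a, a != 2 -> arr s3 a = arr s2 a &
     forall i, (arr s3 2 i == Some true) = (i < j) && cert i]).
- by move=> ? ? [-> ->].
- by rewrite /= /updf /=; split=> // i; rewrite a2.
- move=> j s3 jN [h1 h2 [h3 h4 h5] h6 h7].
  exists 2, (effect (IWr 2 4 (cert j)) s3); split=> //.
    by apply: (@EvChoose (cert j)); case: (cert j); exact: EvOp.
  rewrite /= /updf /=; split=> //; first by rewrite h1.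
    by move=> a na; rewrite (negbTE na) h6.
  move=> i; rewrite h1; case: (i =P j) => [->|nij]; first by rewrite ltnSn; case: (cert j).
  by rewrite h7; congr (_ && _); lia.
have [||||||n6 [s6 [e6 b6 q0 q5]]] := HV cert w s3 => //.
- by move=> i; rewrite h6 // a2.
- by move=> i; rewrite h6 // a2.
- by move=> i; rewrite h7; case: ltnP => // /c1 ->.
exists (n1 + (n2 + (n3 + (n6 + 2)))), s6; split.
  apply: leq_trans (hk (size w)).
  have B : n1 + (n2 + (n3 + (n6 + 2))) <=
     2 * size w + 1 + (f (size w) + ((v (size w) * (2 + 2) + 2) + (g (size w) + 2))).
    have : N * (2 + 2) <= v (size w) * (2 + 2) by rewrite leq_mul2r Vk.
    by lia.
  by have := leq_mul B (leq_add (leq_mul (leqnn 2) B) (leqnn 3)); lia.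
apply: EvSeq e1 _; apply: EvSeq e2 _; apply: EvSeq e3 _; apply: EvSeq e6 _.
apply: EvIf; rewrite /= q0 lt0n q5 c2 c3 eqxx /=; exact: (EvOp nop).
Qed.

(** * Definable functions *)

Fixpoint envT (n : nat) : Type := if n is m.+1 then (envT m * nat)%type else unit.
Fixpoint flat n : envT n -> seq nat :=
  match n with 0 => fun=> [::] | m.+1 => fun t => t.2 :: flat t.1 end.

(** Membership in the expression language for ordinary functions. The closure lemmas below follow
    the shape of a term, so programs can be written as mathematical definitions; the nested pair [t]
    is the de Bruijn environment. *)
Definition definable n (f : (nat -> bool) -> envT n -> nat) :=
  exists e, forall s t, eval s (flat t) e = f s t.
Definition bdefinable n (P : (nat -> bool) -> envT n -> bool) :=
  definable (fun s t => nat_of_bool (P s t)).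
Definition odefinable n (F : (nat -> bool) -> envT n -> seq bool) :=
  exists o, forall s t, outp s (flat t) o = F s t.

Lemma iteri_eq (T : Type) n (f g : nat -> T -> T) x : (forall i, f i =1 g i) ->
  iteri n f x = iteri n g x.
Proof. by move=> h; elim: n => //= n ->; rewrite h. Qed.

Lemma iota_recr m : iota 0 m.+1 = iota 0 m ++ [:: m].
Proof. by rewrite -addn1 iotaD. Qed.

Fixpoint lift_expr c e :=
  match e with
  | EVar k => EVar (if k < c then k else k.+1)
  | ECst n => ECst n
  | EAdd a b => EAdd (lift_expr c a) (lift_expr c b)
  | EMul a b => EMul (lift_expr c a) (lift_expr c b)
  | ELeq a b => ELeq (lift_expr c a) (lift_expr c b)
  | EIter b i f d => EIter (lift_expr c b) (lift_expr c i) (lift_expr c.+2 f) (lift_expr c d)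
  | ESrc a => ESrc (lift_expr c a)
  end.

Lemma eval_lift s e l1 l2 x :
  eval s (l1 ++ x :: l2) (lift_expr (size l1) e) = eval s (l1 ++ l2) e.
Proof.
elim: e l1 => [k|n|a IHa b IHb|a IHa b IHb|a IHa b IHb|b IHb i IHi f IHf d IHd|a IHa] l1 /=;
  rewrite ?IHa ?IHb //.
  rewrite !nth_cat; case: (ltnP k (size l1)) => h; first by rewrite h.
  by rewrite ltnNge leqW //= subSn.
rewrite IHi IHd; apply: iteri_eq => j v; congr minn.
exact: (IHf [:: v, j & l1]).
Qed.

Section Closure.
Variable n : nat.
Implicit Types (a b f : (nat -> bool) -> envT n -> nat) (P Q : (nat -> bool) -> envT n -> bool).

Lemma D_ext f g : (forall s t, f s t = g s t) -> definable g -> definable f.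
Proof. by move=> h [e he]; exists e => s t; rewrite he h. Qed.

Lemma B_ext P Q : (forall s t, P s t = Q s t) -> bdefinable Q -> bdefinable P.
Proof. by move=> h; apply: D_ext => s t; rewrite h. Qed.

Lemma D_weak f : definable f -> definable (fun s (t : envT n.+1) => f s t.1).
Proof. by move=> [e he]; exists (lift_expr 0 e) => s t; rewrite -he -(eval_lift s e [::] _ t.2). Qed.

Lemma D_var0 : definable (fun _ (t : envT n.+1) => t.2).
Proof. by exists (EVar 0). Qed.

Lemma D_cst k : definable (fun _ (_ : envT n) => k).
Proof. by exists (ECst k). Qed.

Lemma D_add a b : definable a -> definable b -> definable (fun s t => a s t + b s t).
Proof. by move=> [e1 h1] [e2 h2]; exists (EAdd e1 e2) => s t /=; rewrite h1 h2. Qed.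

Lemma D_mul a b : definable a -> definable b -> definable (fun s t => a s t * b s t).
Proof. by move=> [e1 h1] [e2 h2]; exists (EMul e1 e2) => s t /=; rewrite h1 h2. Qed.

Lemma D_S a : definable a -> definable (fun s t => (a s t).+1).
Proof. by move=> h; apply: D_ext (D_add h (D_cst 1)) => s t; rewrite addn1. Qed.

Lemma B_leq a b : definable a -> definable b -> bdefinable (fun s t => a s t <= b s t).
Proof. by move=> [e1 h1] [e2 h2]; exists (ELeq e1 e2) => s t /=; rewrite h1 h2. Qed.

Lemma B_src a : definable a -> bdefinable (fun s t => s (a s t)).
Proof. by move=> [e1 h1]; exists (ESrc e1) => s t /=; rewrite h1. Qed.

Lemma D_iter b i c (f : (nat -> bool) -> envT n -> nat -> nat -> nat) :
  definable b -> definable i -> definable c ->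
  definable (fun s (t : envT n.+2) => f s t.1.1 t.1.2 t.2) ->
  definable (fun s t => iteri (b s t) (fun j v => minn (c s t) (f s t j v)) (minn (c s t) (i s t))).
Proof.
move=> [e1 h1] [e2 h2] [e3 h3] [e4 h4]; exists (EIter e1 e2 e4 e3) => s t /=.
rewrite h1 h2 h3; apply: iteri_eq => j v; congr minn.
exact: (h4 s ((t, j), v)).
Qed.

Lemma B_cst (x : bool) : bdefinable (fun _ (_ : envT n) => x).
Proof. exact: D_cst. Qed.

Lemma B_nat P : bdefinable P -> definable (fun s t => nat_of_bool (P s t)).
Proof. by []. Qed.

Lemma B_not P : bdefinable P -> bdefinable (fun s t => ~~ P s t).
Proof. by move=> h; apply: B_ext (B_leq h (D_cst 0)) => s t; case: (P s t). Qed.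

Lemma B_and P Q : bdefinable P -> bdefinable Q -> bdefinable (fun s t => P s t && Q s t).
Proof. by move=> h1 h2; apply: D_ext (D_mul h1 h2) => s t; case: (P s t); case: (Q s t). Qed.

Lemma B_or P Q : bdefinable P -> bdefinable Q -> bdefinable (fun s t => P s t || Q s t).
Proof.
move=> h1 h2; apply: B_ext (B_not (B_and (B_not h1) (B_not h2))) => s t.
by case: (P s t); case: (Q s t).
Qed.

Lemma B_imp P Q : bdefinable P -> bdefinable Q -> bdefinable (fun s t => P s t ==> Q s t).
Proof. by move=> h1 h2; apply: B_ext (B_or (B_not h1) h2) => s t; rewrite implybE. Qed.

Lemma B_eq a b : definable a -> definable b -> bdefinable (fun s t => a s t == b s t).
Proof. by move=> h1 h2; apply: B_ext (B_and (B_leq h1 h2) (B_leq h2 h1)) => s t; rewrite eqn_leq. Qed.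

Lemma D_if P a b : bdefinable P -> definable a -> definable b ->
  definable (fun s t => if P s t then a s t else b s t).
Proof.
move=> h h1 h2; apply: D_ext (D_add (D_mul h h1) (D_mul (B_not h) h2)) => s t.
by case: (P s t); rewrite ?mul1n ?mul0n ?addn0.
Qed.

Lemma B_if P Q Q' : bdefinable P -> bdefinable Q -> bdefinable Q' ->
  bdefinable (fun s t => if P s t then Q s t else Q' s t).
Proof.
move=> h h1 h2; apply: D_ext (D_if h h1 h2) => s t; by case: (P s t).
Qed.

End Closure.

Section Counting.
Variable n : nat.
Implicit Type b : (nat -> bool) -> envT n -> nat.

(** A count never exceeds the number of rounds, so [b] itself serves as the cap of the iteration. *)
Lemma D_count b (P : (nat -> bool) -> envT n -> nat -> bool) : definable b ->
  bdefinable (fun s (t : envT n.+1) => P s t.1 t.2) ->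
  definable (fun s t => count (P s t) (iota 0 (b s t))).
Proof.
move=> hb [e he].
have hP : bdefinable (fun s (t : envT n.+2) => P s t.1.1 t.1.2).
  exists (lift_expr 0 e) => s t.
  by rewrite -[RHS](he s t.1) -(eval_lift s e [::] _ t.2).
apply: D_ext (D_iter (f := fun s t j v => v + P s t j) hb (D_cst _ 0) hb (D_add (D_var0 _) hP)).
move=> s t; have : b s t <= b s t by [].
move: {1 3 4}(b s t) => m; elim: m => [|m IH] hm; first by rewrite minn0.
rewrite iota_recr count_cat [iteri _ _ _]/= -IH 1?ltnW // [count _ [:: m]]/= addn0.
have := count_size (P s t) (iota 0 m); rewrite size_iota.
by case: (P s t m) => /=; lia.
Qed.

Lemma B_has b (P : (nat -> bool) -> envT n -> nat -> bool) : definable b ->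
  bdefinable (fun s (t : envT n.+1) => P s t.1 t.2) ->
  bdefinable (fun s t => has (P s t) (iota 0 (b s t))).
Proof.
move=> h1 h2; apply: B_ext (B_leq (D_cst _ 1) (D_count h1 h2)) => s t.
by rewrite has_count.
Qed.

End Counting.

Lemma B_all n b (P : (nat -> bool) -> envT n -> nat -> bool) : definable b ->
  bdefinable (fun s (t : envT n.+1) => P s t.1 t.2) ->
  bdefinable (fun s t => all (P s t) (iota 0 (b s t))).
Proof.
move=> h1 h2; apply: B_ext (B_not (B_has (P := fun s t i => ~~ P s t i) h1 (B_not h2))) => s t.
by rewrite has_predC negbK.
Qed.

Lemma B_weak n P : bdefinable P -> bdefinable (fun s (t : envT n.+1) => P s t.1).
Proof. exact: D_weak. Qed.

Ltac dvar := match goal with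
  | |- definable (fun _ t => t.2) => by exists (EVar 0)
  | |- definable (fun _ t => t.1.2) => by exists (EVar 1)
  | |- definable (fun _ t => t.1.1.2) => by exists (EVar 2)
  | |- definable (fun _ t => t.1.1.1.2) => by exists (EVar 3)
  | |- definable (fun _ t => t.1.1.1.1.2) => by exists (EVar 4)
  | |- definable (fun _ t => t.1.1.1.1.1.2) => by exists (EVar 5)
  | |- definable (fun _ t => t.1.1.1.1.1.1.2) => by exists (EVar 6)
  | |- definable (fun _ t => t.1.1.1.1.1.1.1.2) => by exists (EVar 7)
  | |- definable (fun _ t => t.1.1.1.1.1.1.1.1.2) => by exists (EVar 8)
  | |- definable (fun _ t => t.1.1.1.1.1.1.1.1.1.2) => by exists (EVar 9)
  | |- @definable (S ?n) (fun s t => ?f s t.1) => apply: (@D_weak n f)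
  | |- @definable (S ?n) (fun s t => ?f s t.1.1) => apply: (@D_weak n (fun s t => f s t.1)); dvar
  | |- @definable (S ?n) (fun s t => ?f s t.1.1.1) => apply: (@D_weak n (fun s t => f s t.1.1)); dvar
  | |- @bdefinable (S ?n) (fun s t => ?f s t.1) => apply: (@B_weak n f)
  | |- @bdefinable (S ?n) (fun s t => ?f s t.1.1) => apply: (@B_weak n (fun s t => f s t.1)); dvar
  | |- @bdefinable (S ?n) (fun s t => ?f s t.1.1.1) => apply: (@B_weak n (fun s t => f s t.1.1)); dvar
  end.

Ltac dbase := first [ assumption | dvar | lazymatch goal with
  | |- definable (fun s t => addn _ _) => apply: D_add
  | |- definable (fun s t => muln _ _) => apply: D_mul
  | |- definable (fun s t => nat_of_bool _) => apply: B_nat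
  | |- definable (fun s t => count _ (iota 0 _)) => apply: D_count
  | |- definable (fun s t => if _ then _ else _) => apply: D_if
  | |- definable (fun s t => S _) => apply: D_S
  | |- definable _ => apply: D_cst
  | |- bdefinable (fun s t => leq _ _) => apply: B_leq
  | |- bdefinable (fun s t => eq_op _ _) => apply: B_eq
  | |- bdefinable (fun s t => andb _ _) => apply: B_and
  | |- bdefinable (fun s t => orb _ _) => apply: B_or
  | |- bdefinable (fun s t => negb _) => apply: B_not
  | |- bdefinable (fun s t => implb _ _) => apply: B_imp
  | |- bdefinable (fun s t => all _ (iota 0 _)) => apply: B_all
  | |- bdefinable (fun s t => has _ (iota 0 _)) => apply: B_has
  | |- bdefinable (fun s t => if _ then _ else _) => apply: B_if
  | |- bdefinable (fun s t => s _) => apply: B_src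
  | |- bdefinable _ => apply: B_cst
  end ].

Section Derived.
Variable n : nat.
Implicit Types (a b c : (nat -> bool) -> envT n -> nat).

Lemma D_sub a b : definable a -> definable b -> definable (fun s t => a s t - b s t).
Proof.
move=> ha hb; apply: (D_ext (g := fun s t => count (fun i => b s t <= i) (iota 0 (a s t)))).
  move=> s t; elim: (a s t) => [//|m IH].
  by rewrite iota_recr count_cat -IH /= addn0; lia.
by repeat dbase.
Qed.

Lemma D_div a b : definable a -> definable b -> definable (fun s t => a s t %/ b s t).
Proof.
move=> ha hb; apply: (D_ext (g := fun s t =>
  (0 < b s t) * count (fun i => i.+1 * b s t <= a s t) (iota 0 (a s t)))).
  move=> s t; case: (posnP (b s t)) => [->|bp]; first by rewrite divn0 mul0n.
  rewrite mul1n.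
  have E i : (i.+1 * b s t <= a s t) = (i < a s t %/ b s t) by rewrite leq_divRL.
  rewrite (eq_count E).
  have : a s t %/ b s t <= a s t by apply: leq_div.
  elim: (a s t) (a s t %/ b s t) => [[]//|m IH] q hq.
  rewrite iota_recr count_cat /= addn0.
  case: (ltngtP q m.+1) hq => // hq _.
    by rewrite -IH // addn0.
  rewrite {1}hq addn1 (eq_in_count (a2 := xpredT)) ?count_predT ?size_iota //.
  by move=> i; rewrite mem_iota /=; lia.
by repeat dbase.
Qed.

Lemma D_mod a b : definable a -> definable b -> definable (fun s t => a s t %% b s t).
Proof.
move=> ha hb; apply: (D_ext (g := fun s t => a s t - a s t %/ b s t * b s t)).
  by move=> s t; rewrite {2}(divn_eq (a s t) (b s t)) addKn.
by apply: D_sub => //; apply: D_mul => //; apply: D_div.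
Qed.

Lemma D_min a b : definable a -> definable b -> definable (fun s t => minn (a s t) (b s t)).
Proof. by move=> ha hb; rewrite /minn; repeat dbase. Qed.

Lemma D_expc a k : definable a -> definable (fun s t => a s t ^ k).
Proof.
move=> ha; elim: k => [|k IH]; first exact: D_cst.
by apply: D_ext (D_mul ha IH) => s t; rewrite expnS.
Qed.

(** Repeated doubling, cut each time. This suffices to compare with a power or to divide by one,
    where a cap above the other operand changes nothing. *)
Lemma D_pow2 a c : definable a -> definable c ->
  definable (fun s t => minn (c s t) (2 ^ a s t)).
Proof.
move=> ha hc; apply: (D_ext (g := fun s t =>
  iteri (a s t) (fun _ v => minn (c s t) (v + v)) (minn (c s t) 1))).
  move=> s t; elim: (a s t) => [|m IH]; first by rewrite expn0.
  by rewrite /= -IH expnS; lia.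
by apply: (D_iter (f := fun s t j v => v + v) (i := fun _ _ => 1)); repeat dbase.
Qed.

(** The first hit is as large as the number of positions without a hit up to and including
    themselves. *)
Lemma D_find b (P : (nat -> bool) -> envT n -> nat -> bool) : definable b ->
  bdefinable (fun s (t : envT n.+1) => P s t.1 t.2) ->
  definable (fun s t => find (P s t) (iota 0 (b s t))).
Proof.
move=> hb [e he].
have hP : bdefinable (fun s (t : envT n.+2) => P s t.1.1 t.2).
  exists (lift_expr 1 e) => s t.
  by rewrite -[RHS](he s (t.1.1, t.2)) -(eval_lift s e [:: t.2] _ t.1.2).
apply: (D_ext (g := fun s t => count (fun i => ~~ has (P s t) (iota 0 i) && ~~ P s t i)
   (iota 0 (b s t)))).
  move=> s t; elim: (b s t) => [//|m IH].
  rewrite (iota_recr m) count_cat find_cat -IH size_iota /= addn0.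
  case: ifP => h /=; first by rewrite addn0.
  by rewrite hasNfind ?size_iota ?h //; case: (P s t m).
apply: D_count => //; apply: B_and; last by apply: B_not; exists e.
by apply: B_not; apply: B_has; [apply: D_var0 | apply: hP].
Qed.

Lemma O_ext (F G : (nat -> bool) -> envT n -> seq bool) :
  (forall s t, F s t = G s t) -> odefinable G -> odefinable F.
Proof. by move=> h [e he]; exists e => s t; rewrite he h. Qed.

Lemma O_emit (x : bool) : odefinable (fun _ (_ : envT n) => [:: x]).
Proof. by exists (OEmit x). Qed.

Lemma O_cat (F G : (nat -> bool) -> envT n -> seq bool) :
  odefinable F -> odefinable G -> odefinable (fun s t => F s t ++ G s t).
Proof. by move=> [e1 h1] [e2 h2]; exists (OCat e1 e2) => s t /=; rewrite h1 h2. Qed.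

Lemma O_for b (F : (nat -> bool) -> envT n -> nat -> seq bool) : definable b ->
  odefinable (fun s (t : envT n.+1) => F s t.1 t.2) ->
  odefinable (fun s t => flatten [seq F s t i | i <- iota 0 (b s t)]).
Proof.
move=> [e1 h1] [e2 h2]; exists (OFor e1 e2) => s t /=; rewrite h1; congr flatten.
by apply: eq_map => i; apply: (h2 s (t, i)).
Qed.

End Derived.

(** A loop of 0 or 1 rounds. It binds a variable that the body must skip, so the indices of the body
    are shifted first. *)
Lemma O_if n P (F : (nat -> bool) -> envT n -> seq bool) : bdefinable P -> odefinable F ->
  odefinable (fun s t => if P s t then F s t else [::]).
Proof.
move=> hP [e he].
have [e1 h1] := hP.
have [o ho] : exists o, forall s env x, outp s (x :: env) o = outp s env e.
  clear.
  have [o ho] : exists o, forall s l1 l2 x, size l1 = 0 -> outp s (l1 ++ x :: l2) o = outp s (l1 ++ l2) e.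
    move: 0; elim: e => [b|a IHa b IHb|e a IHa] k.
    + by exists (OEmit b).
    + have [oa ha] := IHa k; have [ob hb] := IHb k.
      by exists (OCat oa ob) => s l1 l2 x h /=; rewrite ha ?hb.
    + have [oa ha] := IHa k.+1; exists (OFor (lift_expr k e) oa) => s l1 l2 x h /=.
      rewrite -{1}h eval_lift; congr flatten; apply: eq_map => j.
      by apply: (ha s (j :: l1)); rewrite /= h.
  by exists o => s env x; apply: (ho s [::]).
exists (OFor e1 o) => s t /=; rewrite h1; case: (P s t) => //=.
by rewrite ho he cats0.
Qed.

Ltac dstep := lazymatch goal with
  | |- definable (fun s t => minn _ (2 ^ _)) => apply: D_pow2
  | |- definable (fun s t => minn _ _) => apply: D_min
  | |- definable (fun s t => subn _ _) => apply: D_sub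
  | |- definable (fun s t => divn _ _) => apply: D_div
  | |- definable (fun s t => modn _ _) => apply: D_mod
  | |- definable (fun s t => expn _ _) => apply: D_expc
  | |- definable (fun s t => find _ (iota 0 _)) => apply: D_find
  | |- _ => dbase
  end.

Ltac dtac := repeat (cbv beta; dstep).

(** * Definability of the encodings *)

(** The binary length, as a bounded count so that it stays definable. *)
Definition nbits n := count (fun i => 2 ^ i <= n) (iota 0 n).

Lemma nbits_eq n k : 2 ^ k <= n < 2 ^ k.+1 -> nbits n = k.+1.
Proof.
move=> /andP[h1 h2]; rewrite /nbits.
have E i : (2 ^ i <= n) = (i <= k).
  apply/idP/idP => h; last by apply: leq_trans h1; rewrite leq_pexp2l.
  by rewrite -ltnS -(ltn_exp2l _ _ (isT : 1 < 2)); apply: leq_ltn_trans h2.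
rewrite (eq_count E); have kn : k.+1 <= n by apply: leq_trans h1; apply: ltn_expl.
rewrite -(subnKC kn) iotaD count_cat -[RHS]addn0; congr addn.
  rewrite (eq_in_count (a2 := xpredT)) ?count_predT ?size_iota // => i.
  by rewrite mem_iota /=; lia.
by apply/eqP; rewrite -leqn0 leqNgt -has_count; apply/hasPn => i; rewrite mem_iota; lia.
Qed.

Definition bits n := mkseq (fun i => odd (n %/ 2 ^ i)) (nbits n).

Lemma pow2_between n : 0 < n -> exists k, 2 ^ k <= n < 2 ^ k.+1.
Proof. by move=> h; exists (trunc_log 2 n); rewrite trunc_logP // trunc_log_ltn. Qed.

Lemma nbits_double n (b : bool) : 0 < n -> nbits (b + n.*2) = (nbits n).+1.
Proof.
move=> h; have [k hk] := pow2_between h; rewrite (nbits_eq hk); apply: nbits_eq.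
by move: hk; rewrite !expnS; case: b => /=; lia.
Qed.

Lemma bits_double n (b : bool) : 0 < n -> bits (b + n.*2) = b :: bits n.
Proof.
move=> h; rewrite /bits /mkseq nbits_double //=; congr (_ :: _).
  by rewrite divn1 oddD odd_double addbF; case: b.
rewrite -[1]addn0 iotaDl -map_comp; apply: eq_map => i /=.
congr odd; rewrite expnD divnMA; congr (_ %/ _).
by rewrite expn1 divn2 half_bit_double.
Qed.

Lemma bin_bits n : bin n = bits n.
Proof.
rewrite /bin -{2}(bin_of_natK n); case: (bin_of_nat n) => [|p] //=.
elim: p => [p IH|p IH|] //=.
- rewrite IH -[LHS](@bits_double _ true) //; last by case: (p) => //= *; lia.
  by congr bits; rewrite /= NatTrec.doubleE add1n.
- rewrite IH -[LHS](@bits_double _ false) //; last by case: (p) => //= *; lia.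
  by congr bits; rewrite /= NatTrec.doubleE.
Qed.

Lemma flatten_filter_map (T U : Type) (p : pred T) (f : T -> seq U) (s : seq T) :
  flatten [seq f x | x <- s & p x] = flatten [seq if p x then f x else [::] | x <- s].
Proof. by elim: s => //= x s <-; case: (p x). Qed.

Section Encodings.
Variable n : nat.
Implicit Types (a b : (nat -> bool) -> envT n -> nat) (P : (nat -> bool) -> envT n -> bool).

Lemma O_bit P : bdefinable P -> odefinable (fun s t => [:: P s t]).
Proof.
move=> h; apply: O_ext (O_cat (O_if h (O_emit _ true)) (O_if (B_not h) (O_emit _ false))) => s t.
by case: (P s t).
Qed.

Lemma B_odd a : definable a -> bdefinable (fun s t => odd (a s t)).
Proof.
by move=> h; apply: (B_ext (Q := fun s t => a s t %% 2 == 1)); [by move=> s t; rewrite modn2; case: odd | dtac].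
Qed.

Lemma B_pow2_leq a b : definable a -> definable b -> bdefinable (fun s t => 2 ^ a s t <= b s t).
Proof.
move=> ha hb; apply: (B_ext (Q := fun s t => minn (b s t).+1 (2 ^ a s t) <= b s t)); last by dtac.
by move=> s t; rewrite geq_min ltnn.
Qed.

Lemma B_testbit a b : definable a -> definable b ->
  bdefinable (fun s t => odd (a s t %/ 2 ^ b s t)).
Proof.
move=> ha hb; apply: (B_ext (Q := fun s t => odd (a s t %/ minn (a s t).+1 (2 ^ b s t)))).
  move=> s t; case: (leqP (2 ^ b s t) (a s t)) => h; first by rewrite (minn_idPr _) // ltnW.
  by rewrite (minn_idPl h) !divn_small.
by apply: B_odd; dtac.
Qed.

Lemma O_enc_unary a : definable a -> odefinable (fun s t => enc_unary (a s t)).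
Proof.
move=> h; apply: (O_cat (F := fun s t => nseq (a s t) true)); last exact: O_emit.
apply: O_ext (O_for (F := fun _ _ _ => [:: true]) h (O_emit _ true)) => s t.
by elim: (a s t) => //= m ->; rewrite -[1]addn0 iotaDl -map_comp.
Qed.

End Encodings.

Definition enc_bits (l : seq bool) := flatten [seq [:: x; x] | x <- l] ++ [:: false; true].

Lemma O_enc_bits n (b : (nat -> bool) -> envT n -> nat) (P : (nat -> bool) -> envT n -> nat -> bool) :
  definable b -> bdefinable (fun s (t : envT n.+1) => P s t.1 t.2) ->
  odefinable (fun s t => enc_bits (mkseq (P s t) (b s t))).
Proof.
move=> hb hP; apply: O_cat; last by apply: (O_cat (F := fun _ _ => [:: false])); apply: O_emit.
apply: (O_ext (G := fun s t => flatten [seq [:: P s t i; P s t i] | i <- iota 0 (b s t)])).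
  by move=> s t; rewrite /mkseq -map_comp.
apply: (O_for (F := fun s t i => [:: P s t i; P s t i])) => //.
exact: (O_cat (O_bit hP) (O_bit hP)).
Qed.

Section Encodings2.
Variable n : nat.
Implicit Types (a b : (nat -> bool) -> envT n -> nat) (P : (nat -> bool) -> envT n -> bool).

Lemma O_enc_nat a : definable a -> odefinable (fun s t => enc_nat (a s t)).
Proof.
move=> h; apply: (O_ext (G := fun s t =>
  enc_bits (mkseq (fun i => odd (a s t %/ 2 ^ i)) (nbits (a s t))))).
  by move=> s t; rewrite /enc_nat bin_bits.
apply: (O_enc_bits (P := fun s t i => odd (a s t %/ 2 ^ i))).
  rewrite /nbits; apply: D_count => //; apply: B_pow2_leq; dtac.
by apply: B_testbit; dtac.
Qed.

End Encodings2.

Section Encodings3.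
Variable n : nat.
Implicit Types (a b : (nat -> bool) -> envT n -> nat) (P : (nat -> bool) -> envT n -> bool).

Lemma O_enc_list b (P : (nat -> bool) -> envT n -> nat -> bool)
    (f : (nat -> bool) -> envT n -> nat -> nat) : definable b ->
  bdefinable (fun s (t : envT n.+1) => P s t.1 t.2) ->
  definable (fun s (t : envT n.+1) => f s t.1 t.2) ->
  odefinable (fun s t => enc_list [seq f s t i | i <- iota 0 (b s t) & P s t i]).
Proof.
move=> hb hP hf; rewrite /enc_list; apply: (O_ext (G := fun s t =>
  enc_nat (count (P s t) (iota 0 (b s t))) ++
  flatten [seq if P s t i then enc_nat (f s t i) else [::] | i <- iota 0 (b s t)])).
  by move=> s t; rewrite size_map size_filter -map_comp flatten_filter_map.
apply: O_cat; first by apply: O_enc_nat; dtac.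
apply: (O_for (F := fun s t i => if P s t i then enc_nat (f s t i) else [::])) => //.
by apply: O_if => //; apply: O_enc_nat.
Qed.

Lemma O_enc_aut (nQ nS nC ini m : (nat -> bool) -> envT n -> nat)
    (D : (nat -> bool) -> envT n -> nat -> bool)
    (sr le ds : (nat -> bool) -> envT n -> nat -> nat)
    (cl : (nat -> bool) -> envT n -> nat -> seq nat) :
  definable nQ -> definable nS -> definable nC -> definable ini -> definable m ->
  bdefinable (fun s (t : envT n.+1) => D s t.1 t.2) ->
  definable (fun s (t : envT n.+1) => sr s t.1 t.2) ->
  definable (fun s (t : envT n.+1) => le s t.1 t.2) ->
  definable (fun s (t : envT n.+1) => ds s t.1 t.2) ->
  odefinable (fun s (t : envT n.+1) => enc_list (cl s t.1 t.2)) ->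
  odefinable (fun s t => enc_aut (Aut (nQ s t) (nS s t) (nC s t) (ini s t)
    [seq Tr (sr s t k) (le s t k) (ds s t k) (cl s t k) | k <- iota 0 (m s t) & D s t k])).
Proof.
move=> hQ hS hC hi hm hD hs hl hd hc; rewrite /enc_aut /=.
apply: O_cat; first exact: O_enc_unary.
apply: O_cat; first exact: O_enc_unary.
apply: O_cat; first exact: O_enc_unary.
apply: O_cat; first exact: O_enc_nat.
apply: (O_ext (G := fun s t =>
  enc_nat (count (D s t) (iota 0 (m s t))) ++
  flatten [seq if D s t i then enc_trans (Tr (sr s t i) (le s t i) (ds s t i) (cl s t i)) else [::]
     | i <- iota 0 (m s t)])).
  by move=> s t; rewrite size_map size_filter -map_comp flatten_filter_map.
apply: O_cat; first by apply: O_enc_nat; dtac.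
apply: (O_for (F := fun s t i =>
  if D s t i then enc_trans (Tr (sr s t i) (le s t i) (ds s t i) (cl s t i)) else [::])) => //.
apply: O_if => //; rewrite /enc_trans /=.
by do 3 (apply: O_cat; first exact: O_enc_nat).
Qed.

End Encodings3.

Theorem poly_computable_definable (F : (nat -> bool) -> nat -> seq bool) f :
  odefinable (fun s (t : envT 1) => F s t.2) ->
  (forall w, f w = F (nth false w) (size w)) -> poly_computable f.
Proof.
move=> [o ho] hf; apply: (poly_computable_out (o := o)) => w.
by rewrite hf; have := ho (nth false w) (tt, size w) => /= <-.
Qed.

Theorem in_NP_definable (K : nat -> nat) (phi : (nat -> bool) -> nat -> bool)
    (F : (nat -> bool) -> nat -> seq bool) (L : language) :
  definable (fun _ (t : envT 1) => K t.2) -> bdefinable (fun s (t : envT 1) => phi s t.2) ->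
  odefinable (fun s (t : envT 1) => F s t.2) ->
  (forall w, L w <-> exists cert : nat -> bool,
    [/\ forall i, K (size w) <= i -> cert i = false, phi cert (size w) & F cert (size w) = w]) ->
  in_NP L.
Proof.
move=> [eK hK] [ep hp] [o ho] H; apply: (in_NP_out (K := eK) (phi := ep) (o := o)) => w.
rewrite H; split=> -[ct [h1 h2 h3]]; exists ct; split.
- by move=> i; have /= -> := hK xpred0 (tt, size w); apply: h1.
- by have /= -> := hp ct (tt, size w); rewrite h2.
- by have /= -> := ho ct (tt, size w).
- by move=> i; have /= <- := hK xpred0 (tt, size w); apply: h1.
- by have /= E := hp ct (tt, size w); move: h2; rewrite E; case: (phi _ _).
- by have /= <- := ho ct (tt, size w).
Qed.

(** * Deterministic transition systems on infinite words *)

Definition io (P : nat -> bool) := forall N, exists i, N <= i /\ P i.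

Section System.
Variables (T : Type) (step : T -> nat -> T).

Fixpoint srun (x : T) (w : nat -> nat) (i : nat) : T :=
  if i is j.+1 then step (srun x w j) (w j) else x.

Lemma srunD x w i j : srun x w (i + j) = srun (srun x w i) (fun k => w (i + k)) j.
Proof. by elim: j => [|j IH]; rewrite ?addn0 ?addnS //= IH. Qed.

Lemma srun_ext x w w' i : (forall j, j < i -> w j = w' j) -> srun x w i = srun x w' i.
Proof.
elim: i => [//|i IH] h /=; rewrite IH ?h // => j hj; apply: h; exact: ltnW.
Qed.

Lemma srun_take x (v : seq nat) w i : i <= size v -> (forall j, j < i -> w j = nth 0 v j) ->
  srun x w i = foldl step x (take i v).
Proof.
elim: i => [|i IH] hi h; first by rewrite take0.
by rewrite /= IH ?(take_nth 0) // 1?ltnW ?foldl_rcons ?h // => j hj; apply: h; apply: ltnW.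
Qed.

Definition lasso (u z : seq nat) (i : nat) : nat :=
  if i < size u then nth 0 u i else nth 0 z ((i - size u) %% size z).

Lemma lasso_word n u z : z != [::] -> all (gtn n) u -> all (gtn n) z -> is_word n (lasso u z).
Proof.
move=> nz /all_nthP hu /all_nthP hz i; rewrite /lasso; case: ifP => h; first exact: hu.
by apply: hz; rewrite ltn_mod lt0n size_eq0.
Qed.

Lemma srun_lasso x u z k r : foldl step (foldl step x u) z = foldl step x u ->
  r < size z ->
  srun x (lasso u z) (size u + (k * size z + r)) = foldl step (foldl step x u) (take r z) /\
  lasso u z (size u + (k * size z + r)) = nth 0 z r.
Proof.
move=> hz hr.
have L k' r' : r' < size z -> lasso u z (size u + (k' * size z + r')) = nth 0 z r'.
  by move=> h; rewrite /lasso ltnNge leq_addr /= addKn modnMDl modn_small.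
split; last exact: L.
rewrite srunD (@srun_take x u) ?take_size //; last by move=> j hj; rewrite /lasso hj.
rewrite srunD; set y := foldl step x u in hz *.
have -> : srun y (fun j => lasso u z (size u + j)) (k * size z) = y.
  elim: k => [//|k IH]; rewrite mulSn addnC srunD IH (@srun_take y z) ?take_size // => j hj.
  by rewrite L.
by apply: srun_take => [|j hj]; [apply: ltnW | apply: L; apply: ltn_trans hr].
Qed.

Lemma io_lasso x u z (H : T -> nat -> bool) :
  foldl step (foldl step x u) z = foldl step x u -> z != [::] ->
  (io (fun i => H (srun x (lasso u z) i) (lasso u z i)) <->
   exists2 r, r < size z & H (foldl step (foldl step x u) (take r z)) (nth 0 z r)).
Proof.
move=> hz nz; have z0 : 0 < size z by rewrite lt0n size_eq0.
split.
  move=> /(_ (size u)) [i [hi]].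
  have E : i = size u + ((i - size u) %/ size z * size z + (i - size u) %% size z).
    by rewrite -divn_eq subnKC.
  rewrite E; have [|-> -> h] := @srun_lasso x u z ((i - size u) %/ size z) ((i - size u) %% size z) hz.
    by rewrite ltn_mod.
  by exists ((i - size u) %% size z); rewrite ?ltn_mod.
case=> r hr hH N; exists (size u + (N * size z + r)).
have [-> ->] := srun_lasso N hz hr; split=> //.
by have : N <= N * size z; [rewrite leq_pmulr | lia].
Qed.

(** * Rankings as certificates of inclusion *)

Section Ranking.
Variables (x0 : T) (nS kA kB : nat) (hA hB : nat -> T -> nat -> bool).

(* A certificate that words seeing every A-colour infinitely often see every B-colour
   infinitely often: along a run avoiding the B-colour [d] the rank stabilises, and from
   then on the fixed A-colour [kap d] is avoided. *)
Definition ranking (S : T -> bool) (rho kap : nat -> T -> nat) :=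
  [/\ S x0, forall x a, S x -> a < nS -> S (step x a) &
      forall d x, d < kB -> S x -> kap d x < kA /\ forall a, a < nS -> ~~ hB d x a ->
        rho d (step x a) < rho d x \/
        [/\ rho d (step x a) = rho d x, kap d (step x a) = kap d x & ~~ hA (kap d x) x a]].

Lemma nonincr_stable (f : nat -> nat) N : (forall i, N <= i -> f i.+1 <= f i) ->
  exists2 M, N <= M & forall i, M <= i -> f i = f M.
Proof.
move: {2}(f N) (leqnn (f N)) => n; elim: n N => [|n IH] N hn h.
  exists N => // i hi; have : f i <= f N.
    elim: i hi => [|i IH]; first by rewrite leqn0 => /eqP ->.
    rewrite leq_eqVlt => /orP [/eqP->//|hi]; apply: leq_trans (IH hi); exact: h.
  by lia.
have [[i [hi fi]]|nex] := classic (exists i, N <= i /\ f i < f N).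
  have [||M hM H] := IH i; [by lia | by move=> j hj; apply: h; lia |].
  by exists M => //; lia.
exists N => // i hi; have : f i <= f N.
  elim: i hi => [|i IHi]; first by rewrite leqn0 => /eqP ->.
  rewrite leq_eqVlt => /orP [/eqP->//|hi]; apply: leq_trans (IHi hi); exact: h.
by rewrite leq_eqVlt => /orP [/eqP//|lt]; case: nex; exists i.
Qed.

Lemma ranking_sound S rho kap w : ranking S rho kap -> is_word nS w ->
  (forall c, c < kA -> io (fun i => hA c (srun x0 w i) (w i))) ->
  forall d, d < kB -> io (fun i => hB d (srun x0 w i) (w i)).
Proof.
move=> [S0 S1 HR] ww all d dB N; apply: NNPP => nex.
have SS i : S (srun x0 w i) by elim: i => //= i IH; apply: S1.
have nB i : N <= i -> ~~ hB d (srun x0 w i) (w i).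
  by move=> hi; apply/negP => h; apply: nex; exists i.
have St i (hi : N <= i) := proj2 (HR d _ dB (SS i)) (w i) (ww i) (nB i hi).
have [|M hM HM] := @nonincr_stable (fun i => rho d (srun x0 w i)) N.
  by move=> i hi; case: (St i hi) => /= [/ltnW//|[->]].
have St' i : M <= i -> kap d (srun x0 w i.+1) = kap d (srun x0 w i) /\
    ~~ hA (kap d (srun x0 w i)) (srun x0 w i) (w i).
  move=> hi; case: (St i (leq_trans hM hi)) => [|[_ h1 h2]] //.
  by have := HM i hi; have := HM i.+1 (leqW hi) => /= -> ->; rewrite ltnn.
have kc i : M <= i -> kap d (srun x0 w i) = kap d (srun x0 w M).
  elim: i => [|i IH]; first by rewrite leqn0 => /eqP ->.
  rewrite leq_eqVlt => /orP [/eqP->//|hi]; rewrite -(IH hi); exact: (proj1 (St' i hi)).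
have kA' := proj1 (HR d _ dB (SS M)).
have [i [hi]] := all _ kA' M.
by rewrite -(kc i hi); apply/negP; exact: (proj2 (St' i hi)).
Qed.

End Ranking.
End System.

Section RankingComplete.
Variables (T : finType) (step : T -> nat -> T) (x0 : T) (nS kA kB : nat).
Variables (hA hB : nat -> T -> nat -> bool).
Hypothesis kA0 : 0 < kA.
Hypothesis incl : forall w, is_word nS w ->
  (forall c, c < kA -> io (fun i => hA c (srun step x0 w i) (w i))) ->
  forall d, d < kB -> io (fun i => hB d (srun step x0 w i) (w i)).

Let edge (P : T -> nat -> bool) : rel T :=
  fun x y => [exists a : 'I_nS, P x a && (step x a == y)].

Definition stays (P : T -> nat -> bool) x (v : seq nat) :=
  all (gtn nS) v /\ forall r, r < size v -> P (foldl step x (take r v)) (nth 0 v r).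

Lemma stays_cat P x v1 v2 : stays P x v1 -> stays P (foldl step x v1) v2 -> stays P x (v1 ++ v2).
Proof.
move=> [a1 h1] [a2 h2]; split; first by rewrite all_cat a1.
move=> r; rewrite size_cat take_cat nth_cat => hr; case: ltnP => h; first exact: h1.
by rewrite foldl_cat; apply: h2; lia.
Qed.

Lemma connect_word P x y : connect (edge P) x y -> exists2 v, stays P x v & foldl step x v = y.
Proof.
move=> /connectP [p]; elim: p x => [|z p IH] x /=; first by move=> _ ->; exists [::].
move=> /andP[/existsP [a /andP[Pa /eqP <-]] hp] hl.
have [v hv e] := IH _ hp hl.
exists ((a : nat) :: v); last by [].
apply: (@stays_cat P x [:: (a : nat)] v) => //; split; first by rewrite /= ltn_ord.
by case.
Qed.

Lemma edge_step (P : T -> nat -> bool) x a : a < nS -> P x a -> edge P x (step x a).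
Proof. by move=> ha h; apply/existsP; exists (Ordinal ha); rewrite h eqxx. Qed.

Let avoid d := fun x a => ~~ hB d x a.
Let scc_free d x c := [forall y, forall a : 'I_nS,
  [&& connect (edge (avoid d)) x y, avoid d y a & connect (edge (avoid d)) (step y a) x]
    ==> ~~ hA c y a].

(** The rank is the number of states reachable without [d], constant inside a component and smaller
    once it is left. If a component showed every A-colour, a loop through all of them, repeated for
    ever, would violate [incl]. *)
Lemma ranking_complete : exists (S : T -> bool) rho kap,
  ranking step x0 nS kA kB hA hB S rho kap /\
  forall d x, rho d x <= #|T|.
Proof.
exists (connect (edge (fun _ _ => true)) x0), (fun d x => #|connect (edge (avoid d)) x|),
  (fun d x => find (scc_free d x) (iota 0 kA)); split; last by move=> d x; apply: max_card.
split; first exact: connect0.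
  move=> x a h ha; apply: connect_trans h _; apply: connect1; exact: edge_step.
move=> d x dB Sx.
have hasF : has (scc_free d x) (iota 0 kA).
  case: (boolP (has _ _)) => // /hasPn nf.
  have [u hu eu] := connect_word Sx.
  (* One round trip from [x] inside the component per colour, one after the other. *)
  have loop (cs : seq nat) : {subset cs <= iota 0 kA} -> exists v, [/\ stays (avoid d) x v, foldl step x v = x &
      forall c, c \in cs -> exists2 r, r < size v & hA c (foldl step x (take r v)) (nth 0 v r)].
    elim: cs => [|c cs IH] sub; first by exists [::].
    have [|v [v1 v2 v3]] := IH; first by move=> c' h; apply: sub; rewrite inE h orbT.
    have /nf : c \in iota 0 kA by apply: sub; rewrite mem_head.
    rewrite negb_forall => /existsP [y]; rewrite negb_forall => /existsP [a].
    rewrite negb_imply negbK => /andP[/and3P[c1 c2 c3] hc].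
    have [t1 s1 e1] := connect_word c1; have [t2 s2 e2] := connect_word c3.
    have sl : stays (avoid d) x (t1 ++ (a : nat) :: t2).
      apply: stays_cat => //; rewrite e1; apply: (@stays_cat _ _ [:: (a : nat)]) => //.
      by split; [rewrite /= ltn_ord | case].
    have el : foldl step x (t1 ++ (a : nat) :: t2) = x by rewrite foldl_cat /= e1 e2.
    exists ((t1 ++ (a : nat) :: t2) ++ v); split.
    - by apply: stays_cat => //; rewrite el.
    - by rewrite foldl_cat el.
    move=> c'; rewrite inE => /orP [/eqP->|/v3 [r hr hc']].
      exists (size t1); first by rewrite !size_cat /=; lia.
      rewrite -catA takel_cat // take_size e1 nth_cat ltnn subnn /=.
      by [].
    exists (size (t1 ++ (a : nat) :: t2) + r); first by rewrite [X in _ < X]size_cat ltn_add2l.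
    rewrite take_cat nth_cat ltnNge leq_addr /= addKn foldl_cat el; exact: hc'.
  have [|v [[v1 v1'] v2 v3]] := loop (iota 0 kA); first by [].
  (* As [kA > 0], the loop visits at least colour 0. For completed automata the extra colour
     guarantees this. *)
  have nv : v != [::].
    by have [|r] := v3 0; [rewrite mem_iota | case: (v)].
  have ev : foldl step (foldl step x0 u) v = foldl step x0 u by rewrite eu.
  have [] := (proj1 (io_lasso (hB d) ev nv)) (@incl (lasso u v) _ _ d dB).
  - by apply: lasso_word => //; case: hu.
  - move=> c hc; apply/(io_lasso (hA c) ev nv); rewrite eu; apply: v3.
    by rewrite mem_iota.
  by move=> r hr; rewrite eu => h; have := v1' r hr; rewrite /avoid h.
split; first by rewrite -[X in _ < X](size_iota 0) -has_find.
move=> a ha nb; have e1 := edge_step ha (nb : avoid d x a).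
have sub : connect (edge (avoid d)) (step x a) \subset connect (edge (avoid d)) x.
  by apply/subsetP => y; apply: connect_trans; apply: connect1.
(* Equally many reachable states means the same ones, so [x] can be reached back: the component, and
   with it the chosen colour, is unchanged. *)
have := subset_leq_card sub; rewrite leq_eqVlt => /orP [/eqP E|]; last by left.
right; have back : connect (edge (avoid d)) (step x a) x.
  have : connect (edge (avoid d)) (step x a) =i connect (edge (avoid d)) x.
    by apply/subset_cardP.
  by move=> /(_ x); rewrite [RHS]connect0.
have F c : scc_free d (step x a) c = scc_free d x c.
  apply: eq_forallb => y; apply: eq_forallb => a'; congr (_ ==> _).
  congr [&& _, _ & _]; apply/idP/idP => h.
  - exact: connect_trans (connect1 e1) h.
  - exact: connect_trans back h.
  - exact: connect_trans h back.
  - exact: connect_trans h (connect1 e1).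
have kE := eq_find F (iota 0 kA).
split=> //.
have := nth_find 0 hasF; rewrite nth_iota ?add0n; last by rewrite -[X in _ < X](size_iota 0) -has_find.
by move=> /forallP /(_ x) /forallP /(_ (Ordinal ha)); rewrite connect0 /= /avoid nb back.
Qed.

End RankingComplete.

(** * Completed automata *)

(* The automaton is completed by the sink state [a_nQ A]. Colour [a_nC A] is added to every
   genuine transition, and [b] tells whether the sink carries all colours or none: this turns
   generalised Büchi ([b = false]) and the complement of generalised coBüchi ([b = true])
   acceptance into the same condition [allinf]. *)
Definition tix (A : aut) (p a : nat) : nat :=
  find (fun t => (t_src t == p) && (t_let t == a)) (a_tr A).
Definition live A p a := tix A p a < size (a_tr A).
Definition cstep A p a := if live A p a then t_dst (nth tr0 (a_tr A) (tix A p a)) else a_nQ A.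
Definition chas (b : bool) A c p a :=
  if live A p a then (c == a_nC A) || (c \in t_col (nth tr0 (a_tr A) (tix A p a))) else b.

Definition crun A := srun (cstep A) (a_init A).
Definition allinf b A w :=
  forall c, c < (a_nC A).+1 -> io (fun i => chas b A c (crun A w i) (w i)).

Section Completion.
Variables (A : aut) (wfA : wf_det A).

Lemma wf_tr k : k < size (a_tr A) -> let t := nth tr0 (a_tr A) k in
  [&& t_src t < a_nQ A, t_let t < a_nS A, t_dst t < a_nQ A,
      all (fun c => c < a_nC A) (t_col t) & uniq (t_col t)].
Proof. by case/and3P: wfA => _ /all_nthP h _ /h. Qed.

Lemma tix_nth k : k < size (a_tr A) ->
  tix A (t_src (nth tr0 (a_tr A) k)) (t_let (nth tr0 (a_tr A) k)) = k.
Proof.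
move=> hk; case/and3P: wfA => _ _ uq; rewrite /tix.
set P := fun t => _.
have hP : has P (a_tr A).
  by apply/(has_nthP tr0); exists k; rewrite // /P !eqxx.
have := nth_find tr0 hP; rewrite /P => /andP[/eqP e1 /eqP e2].
rewrite has_find in hP.
apply/eqP; rewrite -(nth_uniq (0, 0) _ _ uq) ?size_map //.
by rewrite !(nth_map tr0) // -/P e1 e2.
Qed.

Lemma tix_live p a : live A p a -> t_src (nth tr0 (a_tr A) (tix A p a)) = p /\
  t_let (nth tr0 (a_tr A) (tix A p a)) = a.
Proof. by rewrite /live /tix -has_find => h; have /andP[/eqP-> /eqP->] := nth_find tr0 h. Qed.

Lemma sink_dead a : live A (a_nQ A) a = false.
Proof.
apply/negP => h; have [e _] := tix_live h; have /and5P[] := wf_tr h.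
by rewrite e ltnn.
Qed.

Lemma cstep_le p a : cstep A p a <= a_nQ A.
Proof. by rewrite /cstep; case: ifP => // h; have /and5P[_ _ /ltnW] := wf_tr h. Qed.

Lemma crun_le w i : crun A w i <= a_nQ A.
Proof.
case: i => [|i] /=; last exact: cstep_le.
by case/and3P: wfA => /ltnW.
Qed.

Lemma cstep_sink a : cstep A (a_nQ A) a = a_nQ A.
Proof. by rewrite /cstep sink_dead. Qed.

Lemma dead_forever w i j : ~~ live A (crun A w i) (w i) -> i < j -> crun A w j = a_nQ A.
Proof.
move=> d; elim: j => [//|j IH]; rewrite ltnS leq_eqVlt => /orP [/eqP<-|/IH /= E].
  by rewrite /crun /= -/(crun A w i) /cstep (negbTE d).
by rewrite /crun /= -/(crun A w j) E cstep_sink.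
Qed.

Lemma live_run w : (forall i, live A (crun A w i) (w i)) ->
  is_run A w (fun i => tix A (crun A w i) (w i)).
Proof.
move=> h; split=> // [|i|i].
- by have [-> _] := tix_live (h 0).
- by have [_ ->] := tix_live (h i).
- have [-> _] := tix_live (h i.+1); rewrite /crun /= -/(crun A w i).
  by rewrite /cstep h.
Qed.

Lemma run_live w rho : is_run A w rho ->
  forall i, live A (crun A w i) (w i) /\ tix A (crun A w i) (w i) = rho i.
Proof.
move=> [h1 h2 h3 h4].
have E i : crun A w i = t_src (nth tr0 (a_tr A) (rho i)).
  elim: i => [|i IH]; first by rewrite h2.
  rewrite /crun /= -/(crun A w i) IH -h3 /cstep /live tix_nth // h1; exact: h4.
by move=> i; rewrite /live E -h3 tix_nth.
Qed.

(** The extra colour occurs infinitely often exactly when the run never dies, so dead runs are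
    excluded even if [A] has no colours. *)
Lemma accepts_GB_allinf w : accepts_GB A w <-> allinf false A w.
Proof.
split.
  case=> rho [/run_live hr ha] c; rewrite ltnS leq_eqVlt => /orP [/eqP->|hc] N.
    by exists N; split=> //; rewrite /chas (proj1 (hr N)) eqxx.
  have [i [hi ci]] := ha c hc N; exists i; split=> //.
  by rewrite /chas (proj1 (hr i)) (proj2 (hr i)); move: ci; rewrite /label => ->; rewrite orbT.
move=> ha; have lv i : live A (crun A w i) (w i).
  apply/negPn/negP => d; have [j [hj]] := ha (a_nC A) (ltnSn _) i.+1.
  by rewrite (dead_forever d hj) /chas sink_dead.
exists (fun i => tix A (crun A w i) (w i)); split; first exact: live_run.
move=> c hc N; have [i [hi]] := ha c (ltnW hc) N.
by rewrite /chas lv (ltn_eqF hc) /= => h; exists i.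
Qed.

(** The sink shows every colour, so a word that violates [allinf] has an infinite run; the colour it
    avoids is not the extra one, which every transition carries. *)
Lemma accepts_GcoB_allinf w : accepts_GcoB A w <-> ~ allinf true A w.
Proof.
split.
  case=> rho [/run_live hr [c [hc [N hN]]]] ha.
  have [i [hi]] := ha c (ltnW hc) N; rewrite /chas (proj1 (hr i)) (ltn_eqF hc) /=.
  by rewrite (proj2 (hr i)); apply/negP; exact: hN.
move=> na.
have [c [hc [N hN]]] : exists c, c < (a_nC A).+1 /\ exists N, forall i, N <= i ->
    ~~ chas true A c (crun A w i) (w i).
  apply: NNPP => nex; apply: na => c hc N; apply: NNPP => ne; apply: nex.
  exists c; split=> //; exists N => i hi; apply/negP => h; apply: ne; by exists i.
have lv i : live A (crun A w i) (w i).
  apply/negPn/negP => d; have := hN (maxn N i.+1) (leq_maxl _ _).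
  by rewrite (dead_forever d (leq_maxr _ _)) /chas sink_dead.
exists (fun i => tix A (crun A w i) (w i)); split; first exact: live_run.
have hc' : c < a_nC A.
  move: hc; rewrite ltnS leq_eqVlt => /orP [/eqP E|//].
  by have := hN N (leqnn _); rewrite /chas lv E eqxx.
exists c; split=> //; exists N => i /hN; by rewrite /chas lv (ltn_eqF hc').
Qed.

End Completion.

(** * One minimisation problem for both conditions *)

Definition MIN (b : bool) : language := fun x =>
  exists (A : aut) (n : nat), [/\ x = enc_inst A n, wf_det A &
    exists B : aut, [/\ wf_det B, a_nQ B <= n, a_nS B = a_nS A &
      forall w, is_word (a_nS A) w -> (allinf b A w <-> allinf b B w)]].

Lemma DGBW_MIN x : DGBW_min x <-> MIN false x.
Proof.
split=> -[A [n [ex wA [B [wB nB sB H]]]]]; exists A, n; split=> //; exists B; split=> // w ww.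
  by rewrite -!accepts_GB_allinf //; apply: H.
by rewrite !accepts_GB_allinf //; apply: H.
Qed.

(** Two languages are equal exactly when their complements are. *)
Lemma DGCW_MIN x : DGCW_min x <-> MIN true x.
Proof.
split=> -[A [n [ex wA [B [wB nB sB H]]]]]; exists A, n; split=> //; exists B; split=> // w ww.
  have := H w ww; rewrite !accepts_GcoB_allinf // => h.
  by split=> h'; apply: NNPP => /h.
by rewrite !accepts_GcoB_allinf //; have := H w ww; tauto.
Qed.

Lemma NP_complete_ext (L L' : language) : (forall x, L x <-> L' x) ->
  NP_complete L' -> NP_complete L.
Proof.
move=> E [[M [c H]] hard]; split.
  by exists M, c => w; rewrite E; apply: H.
by move=> K /hard [f [pf hf]]; exists f; split=> // w; rewrite E.
Qed.

(** * Automata given by tables *)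

Section Table.
Variables (nQ nS nC ini : nat) (D : nat -> nat -> bool) (ds : nat -> nat -> nat)
  (lb : nat -> nat -> nat -> bool).

(** A transition is numbered [p * nS + a], and the filtered range is the form of list that
    [O_enc_aut] can write. *)
Definition tabaut : aut := Aut nQ nS nC ini
  [seq Tr (k %/ nS) (k %% nS) (ds (k %/ nS) (k %% nS))
     [seq c | c <- iota 0 nC & lb (k %/ nS) (k %% nS) c]
   | k <- iota 0 (nQ * nS) & D (k %/ nS) (k %% nS)].

Hypothesis ini_ok : ini < nQ.
Hypothesis ds_ok : forall p a, p < nQ -> a < nS -> D p a -> ds p a < nQ.

Lemma tabaut_wf : wf_det tabaut.
Proof.
apply/and3P; split=> //=.
  rewrite all_map; apply/allP => k; rewrite mem_filter mem_iota => /andP[Dk /= hk].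
  have nS0 : 0 < nS by lia.
  have kQ : k %/ nS < nQ by rewrite ltn_divLR.
  have kS : k %% nS < nS by rewrite ltn_mod.
  rewrite /= kQ kS ds_ok //= map_id filter_uniq ?iota_uniq // andbT.
  by apply/allP => c; rewrite mem_filter mem_iota => /andP[_ /andP[]].
rewrite -map_comp map_inj_in_uniq ?filter_uniq ?iota_uniq //.
move=> k k' _ _ /= [e1 e2].
by rewrite (divn_eq k nS) (divn_eq k' nS) e1 e2.
Qed.

Lemma tabaut_nth p a : p < nQ -> a < nS -> D p a -> live tabaut p a /\
  nth tr0 (a_tr tabaut) (tix tabaut p a) = Tr p a (ds p a) [seq c | c <- iota 0 nC & lb p a c].
Proof.
move=> hp ha hD.
have E1 : (p * nS + a) %/ nS = p by rewrite divnMDl ?divn_small ?addn0; lia.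
have E2 : (p * nS + a) %% nS = a by rewrite modnMDl modn_small.
have [k hk Ek] : exists2 k, k < size (a_tr tabaut) &
    nth tr0 (a_tr tabaut) k = Tr p a (ds p a) [seq c | c <- iota 0 nC & lb p a c].
  have kin : p * nS + a \in [seq k <- iota 0 (nQ * nS) | D (k %/ nS) (k %% nS)].
    by rewrite mem_filter E1 E2 hD mem_iota /=; nia.
  exists (index (p * nS + a) [seq k <- iota 0 (nQ * nS) | D (k %/ nS) (k %% nS)]).
    by rewrite size_map index_mem.
  by rewrite (nth_map 0) ?index_mem // nth_index // E1 E2.
have := tix_nth tabaut_wf hk; rewrite Ek /= => Et.
by rewrite /live Et hk Ek.
Qed.

Lemma tabaut_dead p a : ~~ [&& p < nQ, a < nS & D p a] -> live tabaut p a = false.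
Proof.
move=> nd; apply/negP => h; move/negP: nd; apply.
have [e1 e2] := tix_live h; have := wf_tr tabaut_wf h.
rewrite /= e1 e2 => /and5P[-> -> _ _ _] /=.
move: e1 e2; rewrite /live size_map in h; rewrite (nth_map 0) //=.
have := mem_nth 0 h; rewrite mem_filter => /andP[hD _] e1 e2.
by rewrite e1 e2 in hD.
Qed.

Lemma cstep_tab p a :
  cstep tabaut p a = if [&& p < nQ, a < nS & D p a] then ds p a else nQ.
Proof.
rewrite /cstep; case: (boolP [&& p < nQ, a < nS & D p a]) => [/and3P[hp ha hD]|nd];
  last by rewrite tabaut_dead.
by have [-> ->] := tabaut_nth hp ha hD.
Qed.

Lemma chas_tab b c p a : c <= nC -> chas b tabaut c p a =
  if [&& p < nQ, a < nS & D p a] then (c == nC) || lb p a c else b.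
Proof.
move=> hc; rewrite /chas; case: (boolP [&& p < nQ, a < nS & D p a]) => [/and3P[hp ha hD]|nd];
  last by rewrite tabaut_dead.
have [-> ->] := tabaut_nth hp ha hD; rewrite /= map_id mem_filter mem_iota /=.
by case: eqP hc => //= n; rewrite leq_eqVlt => /orP [/eqP//|->]; rewrite andbT.
Qed.

End Table.

Lemma all_iotaP n (P : pred nat) : reflect (forall i, i < n -> P i) (all P (iota 0 n)).
Proof.
by apply: (iffP allP) => h i; have := h i; rewrite mem_iota.
Qed.

(** * A polynomial-time checkable certificate for equivalence *)

Section Check.
Variables (b : bool) (nQ nS nC iA : nat) (sA : nat -> nat -> nat) (hA : nat -> nat -> nat -> bool).
Variables (nQB nCB iB : nat) (ds : nat -> nat -> nat) (lb : nat -> nat -> nat -> bool).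

(** A destination out of range stands for the sink. Thus every guessed table describes a legal
    deterministic automaton, up to its initial state. *)
Definition tstep q a := if (q < nQB) && (ds q a < nQB) then ds q a else nQB.
Definition thas d q a := if (q < nQB) && (ds q a < nQB) then (d == nCB) || lb q a d else b.

Variables (S : nat -> nat -> bool) (r1 k1 r2 k2 : nat -> nat -> nat -> nat).

Definition rank_ok kA kB (hX hY : nat -> nat -> nat -> nat -> bool)
    (r k : nat -> nat -> nat -> nat) :=
  all (fun d => all (fun p => all (fun q => S p q ==> (k d p q < kA) &&
    all (fun a => ~~ hY d p q a ==>
      (r d (sA p a) (tstep q a) < r d p q) ||
      [&& r d (sA p a) (tstep q a) == r d p q, k d (sA p a) (tstep q a) == k d p q
        & ~~ hX (k d p q) p q a]) (iota 0 nS))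
    (iota 0 nQB.+1)) (iota 0 nQ.+1)) (iota 0 kB).

Definition check :=
  [&& iB < nQB, S iA iB,
      all (fun p => all (fun q => S p q ==> all (fun a => S (sA p a) (tstep q a)) (iota 0 nS))
        (iota 0 nQB.+1)) (iota 0 nQ.+1),
      rank_ok nC.+1 nCB.+1 (fun c p q a => hA c p a) (fun d p q a => thas d q a) r1 k1 &
      rank_ok nCB.+1 nC.+1 (fun d p q a => thas d q a) (fun c p q a => hA c p a) r2 k2].

Definition pstep (x : nat * nat) a := (sA x.1 a, tstep x.2 a).

Lemma srun_pair (x : nat * nat) w i :
  srun pstep x w i = (srun sA x.1 w i, srun tstep x.2 w i).
Proof. by case: x => p q; elim: i => //= i ->. Qed.

Hypothesis iA_le : iA <= nQ.
Hypothesis sA_le : forall p a, sA p a <= nQ.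

Lemma tstep_le q a : tstep q a <= nQB.
Proof. by rewrite /tstep; case: ifP => // /andP[_ /ltnW]. Qed.

Lemma check_sound w : check -> is_word nS w ->
  (forall c, c < nC.+1 -> io (fun i => hA c (srun sA iA w i) (w i))) <->
  (forall d, d < nCB.+1 -> io (fun i => thas d (srun tstep iB w i) (w i))).
Proof.
move=> /and5P[hi S0 /allP Sc R1 R2] ww.
have sa x : srun pstep (iA, iB) w x = (srun sA iA w x, srun tstep iB w x) by rewrite srun_pair.
pose SS (x : nat * nat) := [&& x.1 <= nQ, x.2 <= nQB & S x.1 x.2].
have rk kA kB hX hY r k : rank_ok kA kB hX hY r k ->
    ranking pstep (iA, iB) nS kA kB (fun c x a => hX c x.1 x.2 a) (fun c x a => hY c x.1 x.2 a)
      SS (fun d x => r d x.1 x.2) (fun d x => k d x.1 x.2).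
  move=> /allP H; split.
  - by rewrite /SS /= iA_le ltnW.
  - move=> [p q] a /and3P[/= hp hq hs] ha; rewrite /SS /= sA_le tstep_le /=.
    have /Sc /allP/(_ q) : p \in iota 0 nQ.+1 by rewrite mem_iota.
    by rewrite mem_iota /= ltnS => /(_ hq) /implyP /(_ hs) /allP /(_ a); rewrite mem_iota; apply.
  - move=> d [p q] hd /and3P[/= hp hq hs].
    have /H /allP /(_ p) : d \in iota 0 kB by rewrite mem_iota.
    rewrite mem_iota ltnS => /(_ hp) /allP /(_ q); rewrite mem_iota ltnS => /(_ hq).
    move=> /implyP /(_ hs) /andP[-> /allP Ha]; split=> // a ha nh.
    have /Ha /implyP /(_ nh) : a \in iota 0 nS by rewrite mem_iota.
    by case/orP => [->|/and3P[/eqP-> /eqP-> ->]]; [left | right].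
split=> H d hd N.
  have [|i [h1]] := ranking_sound (rk _ _ _ _ _ _ R1) ww _ hd N; last by rewrite sa; exists i.
  move=> c hc M; have [i [h1 h2]] := H c hc M; exists i; by rewrite sa.
have [|i [h1]] := ranking_sound (rk _ _ _ _ _ _ R2) ww _ hd N; last by rewrite sa; exists i.
move=> c hc M; have [i [h1 h2]] := H c hc M; exists i; by rewrite sa.
Qed.

End Check.

Section CheckComplete.
Variables (b : bool) (A B : aut) (wfA : wf_det A) (wfB : wf_det B).
Hypothesis equiv : forall w, is_word (a_nS A) w -> (allinf b A w <-> allinf b B w).

Let T := ('I_(a_nQ A).+1 * 'I_(a_nQ B).+1)%type.
Let stepT (x : T) a : T := (inord (cstep A x.1 a), inord (cstep B x.2 a)).
Let x0 : T := (inord (a_init A), inord (a_init B)).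

Lemma srunT w i : srun stepT x0 w i = (inord (crun A w i), inord (crun B w i)) :> T.
Proof.
have iAle : a_init A <= a_nQ A by case/and3P: wfA => /ltnW.
have iBle : a_init B <= a_nQ B by case/and3P: wfB => /ltnW.
elim: i => [//|i IH] /=; rewrite IH /stepT /=; congr (_, _); congr inord;
  rewrite inordK // ltnS; exact: crun_le.
Qed.

Definition pairT (p q : nat) : T := (inord p, inord q).

Lemma pairT_step p q a : p <= a_nQ A -> q <= a_nQ B ->
  pairT (cstep A p a) (cstep B q a) = stepT (pairT p q) a.
Proof. by move=> hp hq; rewrite /stepT /= !inordK. Qed.

(* Only the colours of [B] named by the certificate that runs rejected by [A] are rejected
   by [B] matter: the other colours of [B] can be dropped, so polynomially many suffice. *)
Lemma check_complete : exists nCB (lb : nat -> nat -> nat -> bool) S r1 k1 r2 k2,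
  [/\ check b (a_nQ A) (a_nS A) (a_nC A) (a_init A) (cstep A) (chas b A) (a_nQ B) nCB (a_init B)
        (cstep B) lb S r1 k1 r2 k2,
      nCB <= (a_nC A).+1 * ((a_nQ A).+1 * (a_nQ B).+1),
      forall d p q, r1 d p q <= (a_nQ A).+1 * (a_nQ B).+1 /\
                    r2 d p q <= (a_nQ A).+1 * (a_nQ B).+1,
      forall d p q, k1 d p q <= (a_nC A).+1 &
      forall d p q, k2 d p q <= nCB].
Proof.
have iAle : a_init A <= a_nQ A by case/and3P: wfA => /ltnW.
have iBlt : a_init B < a_nQ B by case/and3P: wfB.
pose kA := (a_nC A).+1; pose kB := (a_nC B).+1.
pose hA c (x : T) a := chas b A c x.1 a; pose hB c (x : T) a := chas b B c x.2 a.
have toA w c : io (fun i => hA c (srun stepT x0 w i) (w i)) <->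
    io (fun i => chas b A c (crun A w i) (w i)).
  by split=> h N; have [i [hi hc]] := h N; exists i; split=> //; move: hc;
    rewrite /hA srunT /= inordK // ltnS crun_le.
have toB w c : io (fun i => hB c (srun stepT x0 w i) (w i)) <->
    io (fun i => chas b B c (crun B w i) (w i)).
  by split=> h N; have [i [hi hc]] := h N; exists i; split=> //; move: hc;
    rewrite /hB srunT /= inordK // ltnS crun_le.
(* The inclusion of [B] in [A] comes first: the colours [kap2] of [B] that it names decide what is
   kept in [D]. *)
have [|S2 [rho2 [kap2 [RK2 bd2]]]] :=
    @ranking_complete T stepT x0 (a_nS A) kB kA hB hA (ltn0Sn _).
  move=> w ww H c hc; apply/toA; apply: (proj2 (equiv ww)) => // d hd.
  by apply/toB; apply: H.
pose D := undup [seq d <- [seq kap2 c x | c <- iota 0 kA, x <- enum {: T}] | d < a_nC B].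
have sD : size D <= kA * #|{: T}|.
  apply: leq_trans (size_undup _) _; rewrite size_filter; apply: leq_trans (count_size _ _) _.
  by rewrite size_allpairs size_iota -cardE.
(* Position [size D] stands for the extra colour of [B], which is not listed in [D]; it is also what
   [index] returns for that colour. *)
pose col i := if i < size D then nth 0 D i else a_nC B.
pose hD i (x : T) a := hB (col i) x a.
have colP i : i < (size D).+1 -> col i < kB.
  rewrite /col => _; case: ifP => // h; have := mem_nth 0 h.
  by rewrite mem_undup mem_filter ltnS => /andP[/ltnW].
pose kap2' c x := index (kap2 c x) D.
have colK c x : c < kA -> kap2 c x < kB -> col (kap2' c x) = kap2 c x.
  move=> hc hk; rewrite /col /kap2' index_mem; case: ifP => h; first by rewrite nth_index.
  case: (ltnP (kap2 c x) (a_nC B)) => lt; last by apply/eqP; rewrite eqn_leq lt.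
  case/negP: (negbT h); rewrite mem_undup mem_filter lt andTb; apply/allpairsPdep.
  by exists c, x; rewrite mem_iota mem_enum.
(* The other inclusion survives the removal of colours, since less is asked of [B]. *)
have [|S1 [rho1 [kap1 [RK1 bd1]]]] :=
    @ranking_complete T stepT x0 (a_nS A) kA (size D).+1 hA hD (ltn0Sn _).
  move=> w ww H d /colP hd; apply/toB; apply: (proj1 (equiv ww)) => // c hc.
  by apply/toA; apply: H.
pose S (x : T) := S1 x && S2 x.
have [S10 S1s R1] := RK1; have [S20 S2s R2] := RK2.
pose lb q a d := if live B q a then col d \in t_col (nth tr0 (a_tr B) (tix B q a)) else false.
(* The minimum with [kA] bounds the entries outside [S1], of which the ranking says nothing. *)
exists (size D), lb, (fun p q => S (pairT p q)), (fun d p q => rho1 d (pairT p q)),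
  (fun d p q => minn kA (kap1 d (pairT p q))), (fun d p q => rho2 d (pairT p q)),
  (fun d p q => kap2' d (pairT p q)).
have stB q a : q <= a_nQ B -> tstep (a_nQ B) (cstep B) q a = cstep B q a.
  move=> hq; rewrite /tstep; case: ifP => // /negbT; rewrite negb_and -!leqNgt => /orP [h|h].
    have -> : q = a_nQ B by apply/eqP; rewrite eqn_leq hq.
    by rewrite cstep_sink.
  by apply/eqP; rewrite eqn_leq h cstep_le.
have liveE q a : q <= a_nQ B -> (q < a_nQ B) && (cstep B q a < a_nQ B) = live B q a.
  move=> hq; case: (boolP (live B q a)) => h.
    rewrite /cstep h; have /and5P[_ _ -> _ _] := wf_tr wfB h; rewrite andbT ltn_neqAle hq andbT.
    by apply: contraL h => /eqP ->; rewrite sink_dead.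
  by rewrite /cstep (negbTE h) ltnn andbF.
have hasE q a d : q <= a_nQ B -> d < (size D).+1 ->
    thas b (a_nQ B) (size D) (cstep B) lb d q a = chas b B (col d) q a.
  move=> hq hd; rewrite /thas /chas liveE // /lb; case: (live B q a) => //; congr (_ || _).
  rewrite /col; move: hd; rewrite ltnS leq_eqVlt => /orP [/eqP->|hd].
    by rewrite ltnn !eqxx.
  rewrite hd (ltn_eqF hd); have := mem_nth 0 hd.
  by rewrite mem_undup mem_filter => /andP[/ltn_eqF ->].
have cT : #|{: T}| = (a_nQ A).+1 * (a_nQ B).+1 by rewrite card_prod !card_ord.
split.
- apply/and5P; split=> //.
  + by rewrite /S S10.
  + apply/all_iotaP => p hp; apply/all_iotaP => q hq.
    apply/implyP => /andP[h1 h2]; apply/all_iotaP => a ha.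
    by rewrite stB // pairT_step // /S S1s // S2s.
  + apply/all_iotaP => d hd.
    apply/all_iotaP => p hp; apply/all_iotaP => q hq.
    apply/implyP => /andP[h1 h2]; have [hk Hk] := R1 d _ hd h1.
    have mk : minn kA (kap1 d (pairT p q)) = kap1 d (pairT p q) by apply/minn_idPr/ltnW.
    rewrite mk hk /=; apply/all_iotaP => a ha; apply/implyP.
    rewrite hasE // stB // pairT_step // => nh.
    have := Hk a ha; rewrite /hD /hB /= inordK // => /(_ nh) [->//|[-> -> h]].
    rewrite mk !eqxx /=; move: h; rewrite /hA /= inordK // => ->; by rewrite orbT.
  + apply/all_iotaP => d hd.
    apply/all_iotaP => p hp; apply/all_iotaP => q hq.
    apply/implyP => /andP[h1 h2]; have [hk Hk] := R2 d _ hd h2.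
    have kD : kap2' d (pairT p q) < (size D).+1 by rewrite ltnS index_size.
    rewrite kD /=; apply/all_iotaP => a ha; apply/implyP => nh.
    rewrite hasE // stB // pairT_step // colK //.
    have := Hk a ha; rewrite /hA /= inordK // => /(_ nh) [->//|[-> e h]].
    rewrite /kap2' e !eqxx /=; move: h; rewrite /hB /= inordK // => ->; by rewrite orbT.
- by rewrite -cT.
- by move=> d p q; rewrite -cT bd1 bd2.
- by move=> d p q; apply: geq_minl.
- by move=> d p q; apply: index_size.
Qed.

End CheckComplete.

Lemma eq_all_iota n (P Q : pred nat) : (forall i, i < n -> P i = Q i) ->
  all P (iota 0 n) = all Q (iota 0 n).
Proof. by move=> h; apply: eq_in_all => i; rewrite mem_iota => /h. Qed.

(** Tables of bounded size agree with the intended functions only on bounded arguments, and the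
    check looks at no others. *)
Lemma check_ext b nQ nS nC iA sA sA' hA hA' nQB nCB iB ds ds' lb lb' (S S' : nat -> nat -> bool)
    r1 r1' k1 k1' r2 r2' k2 k2' :
  (forall p a, sA p a = sA' p a) -> (forall p a, sA p a <= nQ) -> iA <= nQ -> iB <= nQB ->
  (forall c p a, hA c p a = hA' c p a) ->
  (forall q a, q < nQB -> a < nS -> ds q a = ds' q a) ->
  (forall q a d, q < nQB -> a < nS -> d < nCB.+1 -> lb q a d = lb' q a d) ->
  (forall p q, p <= nQ -> q <= nQB -> S p q = S' p q) ->
  (forall d p q, d < nCB.+1 -> p <= nQ -> q <= nQB ->
     r1 d p q = r1' d p q /\ k1 d p q = k1' d p q) ->
  (forall d p q, d < nC.+1 -> p <= nQ -> q <= nQB ->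
     r2 d p q = r2' d p q /\ k2 d p q = k2' d p q) ->
  check b nQ nS nC iA sA hA nQB nCB iB ds lb S r1 k1 r2 k2 ->
  check b nQ nS nC iA sA' hA' nQB nCB iB ds' lb' S' r1' k1' r2' k2'.
Proof.
move=> es sle iAle iBle eh ed el eS e1 e2.
have et q a : q <= nQB -> a < nS -> tstep nQB ds q a = tstep nQB ds' q a.
  by rewrite /tstep => hq ha; case: (ltnP q nQB) => h //=; rewrite ed.
have eth d q a : q <= nQB -> a < nS -> d < nCB.+1 ->
    thas b nQB nCB ds lb d q a = thas b nQB nCB ds' lb' d q a.
  by rewrite /thas => hq ha hd; case: (ltnP q nQB) => h //=; rewrite ed // el.
have tle q a : tstep nQB ds q a <= nQB by apply: tstep_le.
move=> /and5P[h0 h1 h2 h3 h4]; apply/and5P; split=> //.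
- by rewrite -eS.
- apply/all_iotaP => p hp; apply/all_iotaP => q hq.
  move/all_iotaP: h2 => /(_ p hp) /all_iotaP /(_ q hq); rewrite -eS //.
  case: (S p q) => //= /all_iotaP h; apply/all_iotaP => a ha; have := h a ha.
  by rewrite -es -et // eS.
- apply/all_iotaP => d hd; apply/all_iotaP => p hp; apply/all_iotaP => q hq.
  move/all_iotaP: h3 => /(_ d hd) /all_iotaP /(_ p hp) /all_iotaP /(_ q hq); rewrite -eS //.
  have [<- <-] := e1 d p q hd hp hq.
  case: (S p q) => //= /andP[-> /all_iotaP h]; apply/all_iotaP => a ha; have := h a ha.
  rewrite -eth // -es -et // -eh.
  by have [<- <-] := e1 d (sA p a) (tstep nQB ds q a) hd (sle p a) (tle q a).
- apply/all_iotaP => d hd; apply/all_iotaP => p hp; apply/all_iotaP => q hq.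
  move/all_iotaP: h4 => /(_ d hd) /all_iotaP /(_ p hp) /all_iotaP /(_ q hq); rewrite -eS //.
  have [<- <-] := e2 d p q hd hp hq.
  case: (S p q) => //= /andP[hk /all_iotaP h]; rewrite hk /=.
  apply/all_iotaP => a ha; have := h a ha.
  rewrite -eth // -es -et // -eh.
  by have [<- <-] := e2 d (sA p a) (tstep nQB ds q a) hd (sle p a) (tle q a).
Qed.

(** * Automata given by transition lists *)

Section ListAut.
Variables (b : bool) (nQ nS nC ini ntr : nat) (sr le dt nl : nat -> nat) (co : nat -> nat -> nat).

(** The trivial filters give the lists the form that [O_enc_aut] and [O_enc_list] write. *)
Definition listaut : aut := Aut nQ nS nC ini
  [seq Tr (sr k) (le k) (dt k) [seq co k j | j <- iota 0 (nl k) & true] | k <- iota 0 ntr & true].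

Definition ltix p a := find (fun k => (sr k == p) && (le k == a)) (iota 0 ntr).
Definition lstep p a := if ltix p a < ntr then dt (ltix p a) else nQ.
Definition lhas c p a :=
  if ltix p a < ntr then (c == nC) || has (fun j => co (ltix p a) j == c) (iota 0 (nl (ltix p a)))
  else b.

Definition lwf :=
  [&& ini < nQ,
    all (fun k => [&& sr k < nQ, le k < nS, dt k < nQ, all (fun j => co k j < nC) (iota 0 (nl k)) &
      all (fun j => all (fun j' => (co k j == co k j') ==> (j == j')) (iota 0 (nl k)))
          (iota 0 (nl k))]) (iota 0 ntr) &
    all (fun k => all (fun k' => ((sr k == sr k') && (le k == le k')) ==> (k == k')) (iota 0 ntr))
        (iota 0 ntr)].

Lemma uniq_map_iota (T : eqType) (f : nat -> T) n :
  uniq [seq f i | i <- iota 0 n] =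
  all (fun i => all (fun j => (f i == f j) ==> (i == j)) (iota 0 n)) (iota 0 n).
Proof.
apply/idP/all_iotaP => [uq i hi|h].
  apply/all_iotaP => j hj; apply/implyP => /eqP e.
  rewrite -(nth_uniq (f 0) _ _ uq) ?size_map ?size_iota //.
  by rewrite !(nth_map 0) ?size_iota // !nth_iota // !add0n e.
rewrite map_inj_in_uniq ?iota_uniq // => i j; rewrite !mem_iota /= => hi hj e.
by have /all_iotaP /(_ j hj) := h i hi; rewrite e eqxx => /eqP.
Qed.

Lemma listaut_wf : wf_det listaut = lwf.
Proof.
rewrite /wf_det /lwf /= !filter_predT; congr [&& _, _ & _].
  rewrite all_map; apply: eq_all_iota => k hk /=; do 3 congr andb.
  by rewrite !filter_predT all_map uniq_map_iota.
rewrite -map_comp uniq_map_iota; apply: eq_all_iota => k hk; apply: eq_all_iota => k' hk' /=.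
by rewrite xpair_eqE.
Qed.

Lemma tix_list p a : tix listaut p a = ltix p a.
Proof. by rewrite /tix /listaut /= filter_predT find_map. Qed.

Lemma size_list : size (a_tr listaut) = ntr.
Proof. by rewrite /= filter_predT size_map size_iota. Qed.

Lemma cstep_list p a : cstep listaut p a = lstep p a.
Proof.
rewrite /cstep /live tix_list size_list /lstep; case: ifP => // h.
by rewrite /= filter_predT (nth_map 0) ?size_iota // nth_iota.
Qed.

Lemma chas_list c p a : chas b listaut c p a = lhas c p a.
Proof.
rewrite /chas /live tix_list size_list /lhas; case: ifP => // h.
rewrite /= filter_predT (nth_map 0) ?size_iota // nth_iota //= add0n filter_predT; congr (_ || _).
by apply/mapP/hasP => [[j hj ->]|[j hj /eqP <-]]; exists j.
Qed.

End ListAut.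

Lemma aut_list A : A = listaut (a_nQ A) (a_nS A) (a_nC A) (a_init A) (size (a_tr A))
  (fun k => t_src (nth tr0 (a_tr A) k)) (fun k => t_let (nth tr0 (a_tr A) k))
  (fun k => t_dst (nth tr0 (a_tr A) k)) (fun k => size (t_col (nth tr0 (a_tr A) k)))
  (fun k j => nth 0 (t_col (nth tr0 (a_tr A) k)) j).
Proof.
case: A => nQ nS nC ini tr; congr Aut; rewrite /= filter_predT.
rewrite -[LHS](mkseq_nth tr0); apply: eq_map => k.
by rewrite filter_predT -/(mkseq _ _) mkseq_nth; case: nth.
Qed.

(** * Binary numbers as bit lists *)

Definition nval (l : seq bool) := foldr (fun (x : bool) v => x + v.*2) 0 l.

Lemma nval_cons x l : nval (x :: l) = x + (nval l).*2.
Proof. by []. Qed.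

Lemma nval_gt0 l : last false l -> 0 < nval l.
Proof.
elim: l => [//|x [|y l] IH] h; first by case: x h.
by have := IH h; rewrite (nval_cons x); lia.
Qed.

(** Bits are listed from the least significant one, so the condition excludes leading zeros. *)
Lemma bin_nval l : (l == [::]) || last false l -> bin (nval l) = l.
Proof.
rewrite bin_bits; elim: l => [//|x [|y l] IH] h; first by case: x h.
by rewrite (nval_cons x) bits_double ?nval_gt0 ?IH.
Qed.

Lemma bin_canonical n : ((bin n == [::]) || last false (bin n)) /\ nval (bin n) = n.
Proof.
rewrite /bin -{4}(bin_of_natK n); case: (bin_of_nat n) => [|p]; first by [].
split; first by apply/orP; right; elim: p (false) => /=.
by elim: p => [p IH|p IH|] //=; rewrite IH NatTrec.doubleE.
Qed.

Lemma iteri_eq_lt (T : Type) n (f g : nat -> T -> T) x :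
  (forall i v, i < n -> f i v = g i v) -> iteri n f x = iteri n g x.
Proof.
by elim: n => //= n IH h; rewrite h // IH // => i v hi; apply: h; apply: ltnW.
Qed.

(** Horner's rule from the most significant bit. The cap is needed because the number may be
    exponential in its length. *)
Lemma capped_nval (c : nat) (l : seq bool) :
  iteri (size l) (fun j v => minn c (nth false l (size l - j.+1) + (v + v))) (minn c 0) =
  minn c (nval l).
Proof.
elim: l => [//|x l IH]; rewrite [size _]/= [LHS]/= subnn.
rewrite (_ : iteri _ _ _ = minn c (nval l)) /=; first by lia.
rewrite -IH; apply: iteri_eq_lt => j v h; congr minn; congr addn.
by rewrite subSS; have -> : size l - j = (size l - j.+1).+1 by lia.
Qed.

(** * The certificate *)

(* A certificate is a bit string encoding 22 tables of rank 3 with entries in unary. Tables 0 to 9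
   describe [A] (numbers of states, letters and colours, initial state, number of transitions; their
   sources, letters, destinations, numbers of colours, colours), 10 and 11 the bits of the bound,
   12 to 16 the automaton [B] (numbers of states and colours, initial state, steps, labels) and 17
   to 21 the reachable pairs and the two rankings. *)
Definition zz m := (m + 2) ^ 4.
Definition ctab (s : nat -> bool) m g i j k :=
  count (fun l => s ((((g * zz m + i) * zz m + j) * zz m + k) * zz m + l)) (iota 0 (zz m)).

Lemma count_ltn v z : v <= z -> count (fun l => l < v) (iota 0 z) = v.
Proof.
move=> h; rewrite -(subnKC h) iotaD count_cat -[RHS]addn0; congr addn.
  rewrite (eq_in_count (a2 := xpredT)) ?count_predT ?size_iota // => i.
  by rewrite mem_iota.
by apply/eqP; rewrite -leqn0 leqNgt -has_count; apply/hasPn => i; rewrite mem_iota; lia.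
Qed.

(** The address of a bit is a numeral in base [zz m] with the table number in front, and its digits
    come back by division. *)
Lemma cert_exists m (V : nat -> nat -> nat -> nat -> nat) : exists s : nat -> bool,
  (forall i, 22 * zz m * zz m * zz m * zz m <= i -> s i = false) /\
  forall g i j k, g < 22 -> i < zz m -> j < zz m -> k < zz m -> V g i j k <= zz m ->
    ctab s m g i j k = V g i j k.
Proof.
have z0 : 0 < zz m by rewrite expn_gt0 addn2.
set z := zz m in z0 *.
exists (fun x => (x %/ z %/ z %/ z %/ z < 22) &&
  (x %% z < V (x %/ z %/ z %/ z %/ z) (x %/ z %/ z %/ z %% z) (x %/ z %/ z %% z) (x %/ z %% z))).
split=> [x hx|g i j k hg hi hj hk hV].
  by apply/negbTE; rewrite negb_and -leqNgt !leq_divRL // hx.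
rewrite /ctab -/z -[RHS](count_ltn hV); apply: eq_in_count => l; rewrite mem_iota => /= hl.
have D v a : a < z -> (v * z + a) %/ z = v by move=> h; rewrite divnMDl // divn_small ?addn0.
have M v a : a < z -> (v * z + a) %% z = a by move=> h; rewrite modnMDl modn_small.
by rewrite !(D _ l) // !(M _ l) // !(D _ k) // !(M _ k) // !(D _ j) // !(M _ j) // !(D _ i) // (M _ i) // hg.
Qed.

Section Formula.
Variables (b : bool) (s : nat -> bool) (m : nat).
Let t := ctab s m.

(** The second clause makes the bits of the bound canonical, so that the output is an encoding. The
    third limits [B] to the number of states of [A], so that capping the bound there in the fourth
    loses nothing. *)
Definition np_phi :=
  [&& lwf (t 0 0 0 0) (t 1 0 0 0) (t 2 0 0 0) (t 3 0 0 0) (t 4 0 0 0) (fun k => t 5 k 0 0)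
        (fun k => t 6 k 0 0) (fun k => t 7 k 0 0) (fun k => t 8 k 0 0) (fun k j => t 9 k j 0),
      (t 10 0 0 0 == 0) || (0 < t 11 (t 10 0 0 0 - 1) 0 0),
      t 12 0 0 0 <= t 0 0 0 0,
      t 12 0 0 0 <= iteri (t 10 0 0 0) (fun j v => minn (t 0 0 0 0)
         ((0 < t 11 (t 10 0 0 0 - j.+1) 0 0) + (v + v))) (minn (t 0 0 0 0) 0) &
      check b (t 0 0 0 0) (t 1 0 0 0) (t 2 0 0 0) (t 3 0 0 0)
        (lstep (t 0 0 0 0) (t 4 0 0 0) (fun k => t 5 k 0 0) (fun k => t 6 k 0 0) (fun k => t 7 k 0 0))
        (lhas b (t 2 0 0 0) (t 4 0 0 0) (fun k => t 5 k 0 0) (fun k => t 6 k 0 0)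
           (fun k => t 8 k 0 0) (fun k j => t 9 k j 0))
        (t 12 0 0 0) (t 13 0 0 0) (t 14 0 0 0) (fun q a => t 15 q a 0)
        (fun q a d => 0 < t 16 q a d) (fun p q => 0 < t 17 p q 0)
        (fun d p q => t 18 d p q) (fun d p q => t 19 d p q)
        (fun d p q => t 20 d p q) (fun d p q => t 21 d p q)].

Definition np_aut := listaut (t 0 0 0 0) (t 1 0 0 0) (t 2 0 0 0) (t 3 0 0 0) (t 4 0 0 0)
  (fun k => t 5 k 0 0) (fun k => t 6 k 0 0) (fun k => t 7 k 0 0) (fun k => t 8 k 0 0)
  (fun k j => t 9 k j 0).

Definition np_out :=
  enc_aut np_aut ++ enc_bits (mkseq (fun i => 0 < t 11 i 0 0) (t 10 0 0 0)).

End Formula.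

Lemma D_ctab n (m i j k : (nat -> bool) -> envT n -> nat) g : definable m -> definable i ->
  definable j -> definable k -> definable (fun s t => ctab s (m s t) g (i s t) (j s t) (k s t)).
Proof. by move=> hm hi hj hk; rewrite /ctab /zz; dtac. Qed.

Ltac ctac := repeat (cbv beta; lazymatch goal with
  | |- definable (fun s t => ctab _ _ _ _ _ _) => apply: D_ctab
  | |- _ => dstep end).

Lemma np_out_definable : odefinable (fun s (t : envT 1) => np_out s t.2).
Proof.
apply: O_cat.
  apply: O_enc_aut; try (by ctac).
  by apply: (O_enc_list (b := fun s (t : envT 2) => ctab s t.1.2 8 t.2 0 0) (P := fun _ _ _ => true)
    (f := fun s t j => ctab s t.1.2 9 t.2 j 0)); ctac.
by apply: (O_enc_bits (b := fun s (t : envT 1) => ctab s t.2 10 0 0 0)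
  (P := fun s t i => 0 < ctab s t.2 11 i 0 0)); ctac.
Qed.

Lemma np_phi_definable b : bdefinable (fun s (t : envT 1) => np_phi b s t.2).
Proof.
rewrite /np_phi; apply: B_and.
  by rewrite /lwf; ctac.
apply: B_and; first by ctac.
apply: B_and; first by ctac.
apply: B_and.
  apply: B_leq; first by ctac.
  apply: (@D_iter 1 (fun s t => ctab s t.2 10 0 0 0) (fun _ _ => 0) (fun s t => ctab s t.2 0 0 0 0)
    (fun s t j v => (0 < ctab s t.2 11 (ctab s t.2 10 0 0 0 - j.+1) 0 0) + (v + v))); ctac.
rewrite /check /rank_ok /tstep /thas /lstep /lhas /ltix; ctac.
Qed.

Lemma enc_nat_bits n : enc_nat n = enc_bits (bin n).
Proof. by []. Qed.

Lemma size_flatten_double (l : seq bool) : size (flatten [seq [:: x; x] | x <- l]) = (size l).*2.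
Proof. by elim: l => //= x l ->. Qed.

Lemma size_enc_inst A n : [/\ a_nQ A <= size (enc_inst A n), a_nS A <= size (enc_inst A n),
  a_nC A <= size (enc_inst A n), size (a_tr A) <= size (enc_inst A n) &
  size (bin n) <= size (enc_inst A n)].
Proof.
rewrite /enc_inst /enc_aut !size_cat !size_nseq !size_flatten_double.
have : size (a_tr A) <= size (flatten (map enc_trans (a_tr A))).
  elim: (a_tr A) => //= t l IH; rewrite size_cat.
  by have : 1 <= size (enc_trans t); [rewrite !size_cat /=; lia | lia].
by move=> h; split; lia.
Qed.

Lemma np_sound b s m : np_phi b s m -> MIN b (np_out s m).
Proof.
rewrite /np_phi /np_out; set t := ctab s m => /and5P[wf can hB hn ck].
pose l := mkseq (fun i => 0 < t 11 i 0 0) (t 10 0 0 0).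
have sl : size l = t 10 0 0 0 by rewrite size_mkseq.
have bl : bin (nval l) = l.
  apply: bin_nval; case/orP: can => [/eqP e|h]; first by rewrite -size_eq0 sl e.
  case: (posnP (t 10 0 0 0)) => e; first by rewrite -size_eq0 sl e.
  by rewrite -nth_last sl -subn1 nth_mkseq ?h ?orbT //; lia.
rewrite -(listaut_wf) in wf.
exists (np_aut s m), (nval l); split=> //; first by rewrite /enc_inst enc_nat_bits bl.
have hcap : t 12 0 0 0 <= nval l.
  have := capped_nval (t 0 0 0 0) l; rewrite sl => E.
  move: hn; rewrite (_ : iteri _ _ _ = minn (t 0 0 0 0) (nval l)); first by rewrite leq_min => /andP[].
  by rewrite -E; apply: iteri_eq_lt => j v hj; rewrite nth_mkseq //; lia.
have /and5P[iB _ _ _ _] := ck.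
set D := fun q a => t 15 q a 0 < t 12 0 0 0.
exists (tabaut (t 12 0 0 0) (t 1 0 0 0) (t 13 0 0 0) (t 14 0 0 0) D
  (fun q a => t 15 q a 0) (fun q a d => 0 < t 16 q a d)).
have ok p a : p < t 12 0 0 0 -> a < t 1 0 0 0 -> D p a -> t 15 p a 0 < t 12 0 0 0 by [].
split=> //; first exact: tabaut_wf.
set B := tabaut _ _ _ _ _ _ _; move=> w ww.
have runA i : crun (np_aut s m) w i = srun (lstep (t 0 0 0 0) (t 4 0 0 0) (fun k => t 5 k 0 0)
    (fun k => t 6 k 0 0) (fun k => t 7 k 0 0)) (t 3 0 0 0) w i.
  by rewrite /crun; elim: i => //= i ->; rewrite cstep_list.
have runB i : crun B w i = srun (tstep (t 12 0 0 0) (fun q a => t 15 q a 0)) (t 14 0 0 0) w i.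
  rewrite /crun; elim: i => //= i ->; rewrite cstep_tab //; have -> : w i < t 1 0 0 0 by apply: ww.
  by rewrite /tstep.
have [] := check_sound _ _ ck ww.
- by case/and3P: wf => /ltnW.
- by move=> p a; have := cstep_le wf p a; rewrite cstep_list.
move=> h1 h2; split=> H c hc N.
  have [|i [hi hb]] := h1 _ c hc N.
    move=> d hd M; have [i [hi]] := H d hd M; rewrite chas_list runA => h; by exists i.
  exists i; split=> //; rewrite chas_tab // runB; have -> : w i < t 1 0 0 0 by apply: ww.
  exact: hb.
have [|i [hi hb]] := h2 _ c hc N.
  move=> d hd M; have [i [hi]] := H d hd M; rewrite chas_tab // runB.
  have -> : w i < t 1 0 0 0 by apply: ww.
  by move=> h; exists i.
by exists i; rewrite chas_list runA.
Qed.

Lemma np_complete b A n : wf_det A ->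
  (exists B : aut, [/\ wf_det B, a_nQ B <= n, a_nS B = a_nS A &
      forall w, is_word (a_nS A) w -> (allinf b A w <-> allinf b B w)]) ->
  exists s, let m := size (enc_inst A n) in
   [/\ forall i, 22 * zz m * zz m * zz m * zz m <= i -> s i = false, np_phi b s m &
       np_out s m = enc_inst A n].
Proof.
move=> wfA [B0 [wfB0 nB0 sB0 eq0]].
have [B [wfB nB sB eqv BA]] : exists B, [/\ wf_det B, a_nQ B <= n, a_nS B = a_nS A,
   forall w, is_word (a_nS A) w -> (allinf b A w <-> allinf b B w) & a_nQ B <= a_nQ A].
  (* If [B0] is larger than [A], then [A] is within the bound and takes its place. *)
  case: (leqP (a_nQ B0) (a_nQ A)) => h; first by exists B0.
  by exists A; split=> //; lia.
have [nCB [lb [S [r1 [k1 [r2 [k2 [ck bC br bk1 bk2]]]]]]]] := check_complete wfA wfB eqv.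
have [mQ mS mC mT mB] := size_enc_inst A n.
set m := size _ in mQ mS mC mT mB *.
pose tr i := nth tr0 (a_tr A) i.
pose V g i j k := match g with
  | 0 => a_nQ A | 1 => a_nS A | 2 => a_nC A | 3 => a_init A | 4 => size (a_tr A)
  | 5 => t_src (tr i) | 6 => t_let (tr i) | 7 => t_dst (tr i) | 8 => size (t_col (tr i))
  | 9 => nth 0 (t_col (tr i)) j | 10 => size (bin n) | 11 => nth false (bin n) i
  | 12 => a_nQ B | 13 => nCB | 14 => a_init B | 15 => cstep B i j | 16 => lb i j k
  | 17 => S i j | 18 => r1 i j k | 19 => k1 i j k | 20 => r2 i j k | _ => k2 i j k end.
pose P3 := m.+1 * (m.+1 * m.+1).
(* [P3] bounds the number of kept colours: A-colours times states of the product. This cube is the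
   largest table size, hence the fourth power in [zz]. *)
have z3 : P3 < zz m.
  have : P3 <= (m + 2) * ((m + 2) * (m + 2)) by rewrite /P3; do 2 (apply: leq_mul; first by lia); lia.
  by rewrite /zz !expnS expn0 muln1; nia.
have z2 : m.+1 * m.+1 <= P3 by rewrite /P3; nia.
have z1 : m.+1 <= m.+1 * m.+1 by nia.
have iAlt : a_init A < a_nQ A by case/and3P: wfA.
have iBlt : a_init B < a_nQ B by case/and3P: wfB.
have bCB : nCB <= P3.
  by apply: leq_trans bC _; rewrite /P3; do 2 (apply: leq_mul; first by lia); lia.
have b2 : (a_nQ A).+1 * (a_nQ B).+1 <= m.+1 * m.+1 by apply: leq_mul; lia.
have trP i : [&& t_src (tr i) <= m, t_let (tr i) <= m, t_dst (tr i) <= m,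
    all (fun c => c < a_nC A) (t_col (tr i)) & uniq (t_col (tr i))].
  rewrite /tr; case: (ltnP i (size (a_tr A))) => h; last by rewrite nth_default.
  by have /and5P[h1 h2 h3 h4 h5] := wf_tr wfA h; apply/and5P; split=> //; lia.
have colP i : size (t_col (tr i)) <= a_nC A.
  have /and5P[_ _ _ /allP h5 h6] := trP i.
  by rewrite -[X in _ <= X](size_iota 0); apply: uniq_leq_size => // c /h5; rewrite mem_iota.
have Vb g i j k : V g i j k <= zz m.
  have /and5P[h1 h2 h3 /allP h5 h6] := trP i; have h7 := colP i.
  rewrite /V; do 21?[case: g => [|g]]; try lia.
  - case: (ltnP j (size (t_col (tr i)))) => h; last by rewrite nth_default.
    by have /= := h5 _ (mem_nth 0 h); lia.
  - by have := cstep_le wfB i j; lia.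
  - by have := proj1 (br i j k); lia.
  - by have := bk1 i j k; lia.
  - by have := proj2 (br i j k); lia.
  - by have := bk2 i j k; lia.
have [s [s0 sV]] := cert_exists m V; exists s.
have E g i j k : g < 22 -> i < zz m -> j < zz m -> k < zz m -> ctab s m g i j k = V g i j k.
  by move=> *; apply: sV.
have z0 : 0 < zz m by lia.
have eA : np_aut s m = A.
  rewrite [RHS]aut_list /np_aut /listaut !E //=; congr Aut; rewrite !filter_predT.
  apply/eq_in_map => k; rewrite mem_iota => /= hk; rewrite !E //=; try lia.
  congr Tr; rewrite !filter_predT; apply/eq_in_map => j; rewrite mem_iota => /= hj.
  by rewrite E //; have := colP k; lia.
have nb : ctab s m 10 0 0 0 = size (bin n) by rewrite E.
have bit i : i < size (bin n) -> (0 < ctab s m 11 i 0 0) = nth false (bin n) i.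
  by move=> h; rewrite E //=; [rewrite lt0b | lia].
have [can nv] := bin_canonical n.
split=> //; last first.
  rewrite /np_out eA /enc_inst enc_nat_bits; congr (_ ++ enc_bits _).
  apply: (@eq_from_nth _ false); rewrite size_mkseq ?nb // => i hi.
  by rewrite nth_mkseq // bit.
apply/and5P; split.
- by rewrite -listaut_wf -/(np_aut s m) eA.
- rewrite nb; case/orP: can => h; first by rewrite (eqP h).
  by case: (posnP (size (bin n))) => // h0; rewrite bit ?subn1 ?nth_last ?h //; lia.
- by rewrite !E.
- rewrite nb (_ : iteri _ _ _ = minn (ctab s m 0 0 0 0) n); first by rewrite !E //= leq_min BA.
  rewrite -[in RHS]nv -capped_nval; apply: iteri_eq_lt => j v hj; congr minn; congr addn.
  by rewrite bit //; lia.
rewrite !(E 0 0 0 0) // !(E 1 0 0 0) // !(E 2 0 0 0) // !(E 3 0 0 0) // !(E 12 0 0 0) // !(E 13 0 0 0) //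
  !(E 14 0 0 0) //.
apply: check_ext ck => /=.
- move=> p a; rewrite -[in LHS]eA cstep_list; by rewrite (E 0 0 0 0).
- by move=> p a; apply: cstep_le.
- by lia.
- by lia.
- move=> c p a; rewrite -[in LHS]eA chas_list; by rewrite (E 2 0 0 0).
- by move=> q a hq ha; rewrite E //; lia.
- by move=> q a d hq ha hd; rewrite E //=; [rewrite lt0b | lia | lia | lia].
- by move=> p q hp hq; rewrite E //=; [rewrite lt0b | lia | lia].
- by move=> d p q hd hp hq; rewrite !E //; lia.
- by move=> d p q hd hp hq; rewrite !E //; lia.
Qed.

Theorem MIN_in_NP b : in_NP (MIN b).
Proof.
apply: (in_NP_definable (K := fun m => 22 * zz m * zz m * zz m * zz m)
  (phi := fun s m => np_phi b s m) (F := fun s m => np_out s m)).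
- by rewrite /zz; dtac.
- exact: np_phi_definable.
- exact: np_out_definable.
move=> w; split.
  move=> [A [n [-> wA H]]]; have [s [h1 h2 h3]] := np_complete wA H.
  by exists s.
by move=> [s [_ h <-]]; apply: np_sound h.
Qed.

(** * From graph colouring to automata *)

(* States [j < N] are copies of a root, states [N + f x] remember (the class of) the vertex [x]
   just read. Letters: a vertex [x < V]; [V + j], returning to root [j]; [V + N + j], returning to
   root [j] and marking. Colour [u * V + v] of an edge is seen when a vertex other than [u], [v] is
   read and when [u] is marked. *)
Section Graph.
Variables (V N : nat) (E : nat -> nat -> bool).

Definition gS := V + (N + N).
Definition gdef p a := if p < N then (a < V) || (a == V + p) else V <= a.
Definition gdst (f : nat -> nat) p a :=
  if p < N then (if a < V then N + f a else p) else (a - V) %% N.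
Definition glab (f : nat -> nat) p a c :=
  ~~ E (c %/ V) (c %% V) ||
  (if p < N then [&& a < V, a != c %/ V & a != c %% V] else (V + N <= a) && (p == N + f (c %/ V))).
Definition gaut M f := tabaut (N + M) gS (V * V) 0 gdef (gdst f) (glab f).

Hypothesis N0 : 0 < N.
Hypothesis V0 : 0 < V.
Hypothesis EV : forall u v, E u v -> u < v < V.

Section Steps.
Variables (M : nat) (f : nat -> nat).
Hypothesis fM : forall x, x < V -> f x < M.

Lemma gdst_ok p a : p < N + M -> a < gS -> gdef p a -> gdst f p a < N + M.
Proof.
rewrite /gdef /gdst => hp ha; case: (ltnP p N) => h.
  by case: ltnP => [/fM|]; lia.
by move=> _; have := ltn_pmod (a - V) N0; lia.
Qed.

Lemma gini_ok : 0 < N + M. Proof. by lia. Qed.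

Lemma gaut_wf : wf_det (gaut M f).
Proof. exact: tabaut_wf gini_ok gdst_ok. Qed.

Lemma gstep_root j x : j < N -> x < V -> cstep (gaut M f) j x = N + f x.
Proof.
move=> hj hx; rewrite cstep_tab; [|exact: gini_ok|exact: gdst_ok].
have -> : j < N + M by lia.
have -> : x < gS by rewrite /gS; lia.
by rewrite /gdef /gdst hj hx.
Qed.

Lemma gstep_self j : j < N -> cstep (gaut M f) j (V + j) = j.
Proof.
move=> hj; rewrite cstep_tab; [|exact: gini_ok|exact: gdst_ok].
have -> : j < N + M by lia.
have -> : V + j < gS by rewrite /gS; lia.
by rewrite /gdef /gdst hj eqxx orbT /= ltnNge leq_addr.
Qed.

Lemma gstep_root_dead j a : j < N -> V <= a -> a != V + j -> cstep (gaut M f) j a = N + M.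
Proof.
move=> hj ha nj; rewrite cstep_tab; [|exact: gini_ok|exact: gdst_ok].
by rewrite /gdef hj (negbTE nj) [a < V]ltnNge ha /= !andbF.
Qed.

Lemma gstep_ret p a : p < M -> V <= a < gS -> cstep (gaut M f) (N + p) a = (a - V) %% N.
Proof.
move=> hp ha; rewrite cstep_tab; [|exact: gini_ok|exact: gdst_ok].
have nN : N + p < N = false by lia.
have -> : N + p < N + M by lia.
by case/andP: ha => h1 h2; rewrite /gdef /gdst nN h1 h2.
Qed.

Lemma gstep_ret_dead p a : p < M -> a < V -> cstep (gaut M f) (N + p) a = N + M.
Proof.
move=> hp ha; rewrite cstep_tab; [|exact: gini_ok|exact: gdst_ok].
have nN : N + p < N = false by lia.
by rewrite /gdef nN [V <= a]leqNgt ha /= !andbF.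
Qed.

Lemma ghas b c p a : c <= V * V -> a < gS -> chas b (gaut M f) c p a =
  if (p < N + M) && gdef p a then (c == V * V) || glab f p a c else b.
Proof.
move=> hc ha; rewrite chas_tab //; [|exact: gini_ok|exact: gdst_ok].
by rewrite ha.
Qed.

End Steps.

Lemma col_inv u v : u < V -> v < V -> (u * V + v < V * V) * ((u * V + v) %/ V = u) * ((u * V + v) %% V = v).
Proof.
move=> hu hv; rewrite divnMDl // divn_small // addn0 modnMDl modn_small //; split=> //; split=> //.
by nia.
Qed.

(** * A colouring yields a small equivalent automaton *)

Section Forward.
Variables (b : bool) (col : nat -> nat).
Hypothesis colN : forall x, x < V -> col x < N.
Hypothesis colE : forall u v, E u v -> col u != col v.

Let A := gaut V id.
Let B := gaut N col.

Lemma id_ok x : x < V -> id x < V. Proof. by []. Qed.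

(** Merging vertices only makes more marks visible. If [u] appears marked because some other [x] of
    its class was read, then [x != u], and [x != v] because [v] has another colour; so reading [x]
    showed the colour of the edge [u v] one step before. *)
Lemma colouring_equiv w : is_word gS w -> (allinf b A w <-> allinf b B w).
Proof.
move=> ww.
pose R i := (crun A w i < N /\ crun B w i = crun A w i) \/
  (exists i', [/\ i = i'.+1, w i' < V, crun A w i' < N, crun A w i = N + w i' &
     crun B w i = N + col (w i')]) \/
  (crun A w i = N + V /\ crun B w i = N + N).
have HR i : R i.
  elim: i => [|i IH]; first by left.
  have cA : crun A w i.+1 = cstep A (crun A w i) (w i) by [].
  have cB : crun B w i.+1 = cstep B (crun B w i) (w i) by [].
  rewrite /R cA cB; case: IH => [[h1 ->]|[[i' [_ h1 h2 -> ->]]|[-> ->]]].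
  - case: (ltnP (w i) V) => hw.
      right; left; exists i; split=> //.
        by rewrite gstep_root //; exact: id_ok.
      by rewrite gstep_root.
    case: (w i =P V + crun A w i) => [->|/eqP hn].
      by left; rewrite gstep_self // gstep_self.
    by right; right; rewrite gstep_root_dead // gstep_root_dead.
  - have hc := colN h1; case: (ltnP (w i) V) => hw.
      by right; right; rewrite gstep_ret_dead // gstep_ret_dead.
    have hw' : V <= w i < gS by rewrite hw; apply: ww.
    by left; rewrite gstep_ret // gstep_ret // ltn_mod.
  - right; right; split; [apply: (cstep_sink (gaut_wf (f := id) _)) | apply: (cstep_sink (gaut_wf colN))].
    exact: id_ok.
have hAE c i : c <= V * V -> chas b A c (crun A w i) (w i) =
    if (crun A w i < N + V) && gdef (crun A w i) (w i)
    then (c == V * V) || glab id (crun A w i) (w i) c else b.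
  by move=> hc; apply: ghas => //; apply: ww.
have hBE c i : c <= V * V -> chas b B c (crun B w i) (w i) =
    if (crun B w i < N + N) && gdef (crun B w i) (w i)
    then (c == V * V) || glab col (crun B w i) (w i) c else b.
  by move=> hc; apply: ghas => //; apply: ww.
have AB c i : c <= V * V -> chas b A c (crun A w i) (w i) -> chas b B c (crun B w i) (w i).
  move=> hc; rewrite hAE // hBE //; case: (HR i) => [[h1 ->]|[[i' [_ h1 h2 -> ->]]|[-> ->]]].
  - by rewrite (ltn_addr V h1) (ltn_addr N h1) /glab h1.
  - rewrite ltn_add2l h1 ltn_add2l colN // /gdef /glab.
    have -> : N + w i' < N = false by lia.
    have -> : N + col (w i') < N = false by lia.
    case: (V <= w i) => //=; case: (c == _) => //=; case: (E _ _) => //=.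
    by rewrite !eqn_add2l => /andP[-> /eqP ->] /=.
  - by rewrite !ltnn.
have BA c i : c <= V * V -> chas b B c (crun B w i) (w i) ->
    chas b A c (crun A w i) (w i) \/ (0 < i) && chas b A c (crun A w i.-1) (w i.-1).
  move=> hc; rewrite hAE // hBE //; case: (HR i) => [[h1 ->]|[[i' [-> h1 h2 -> ->]]|[-> ->]]].
  - by rewrite (ltn_addr V h1) (ltn_addr N h1) /glab h1; left.
  - rewrite !ltn_add2l h1 colN // /= hAE // (ltn_addr _ h2) /gdef /glab h2 h1 /=.
    have -> : N + w i' < N = false by lia.
    have -> : N + col (w i') < N = false by lia.
    case: (V <= w _); last by left.
    rewrite /=; case: (c == _) => /=; first by left.
    case: (boolP (E _ _)) => /=; last by left.
    move=> e; rewrite !eqn_add2l => /andP[-> /eqP ec] /=.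
    case: (w i' =P c %/ V) => [_|n1]; first by left.
    case: (w i' =P c %% V) => [n2|n2]; last by right.
    by have := colE e; rewrite -n2 ec eqxx.
  - by rewrite !ltnn; left.
split=> H c hc K; rewrite ltnS in hc.
  by have [i [hi h]] := H c hc K; exists i; split=> //; apply: AB.
(* Starting from [K.+1] leaves room for the step back. *)
have [i [hi h]] := H c hc K.+1; case: (BA c i hc h) => [h'|/andP[i0 h']].
  by exists i; split=> //; apply: ltnW.
by exists i.-1; split=> //; lia.
Qed.

End Forward.

(** * A small equivalent automaton yields a colouring *)

Section Backward.
Variables (b : bool) (u0 v0 : nat) (B : aut).
Hypothesis E0 : E u0 v0.
Hypothesis wfB : wf_det B.
Hypothesis sB : a_nS B = gS.
Hypothesis nB : a_nQ B <= N + N.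

Let A := gaut V id.
Hypothesis equiv : forall w, is_word gS w -> (allinf b A w <-> allinf b B w).

Let wfA : wf_det A. Proof. by apply: gaut_wf. Qed.

Let A_root j x : j < N -> x < V -> cstep A j x = N + x.
Proof. exact: (gstep_root id_ok). Qed.

Let A_self j : j < N -> cstep A j (V + j) = j.
Proof. exact: (gstep_self id_ok). Qed.

Let A_root_dead j a : j < N -> V <= a -> a != V + j -> cstep A j a = N + V.
Proof. exact: (gstep_root_dead id_ok). Qed.

Let A_ret p a : p < V -> V <= a < gS -> cstep A (N + p) a = (a - V) %% N.
Proof. exact: (gstep_ret id_ok). Qed.

Let A_has c p a : c <= V * V -> a < gS -> chas b A c p a =
  if (p < N + V) && gdef p a then (c == V * V) || glab id p a c else b.
Proof. exact: (ghas id_ok). Qed.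

Definition afrom X p w :=
  forall c, c < (a_nC X).+1 -> io (fun i => chas b X c (srun (cstep X) p w i) (w i)).

Lemma lasso_shift (u1 u z : seq nat) i : lasso (u1 ++ u) z (size u1 + i) = lasso u z i.
Proof.
by rewrite /lasso size_cat ltn_add2l nth_cat [size u1 + i < size u1]ltnNge leq_addr /= addKn subnDl.
Qed.

Lemma afrom_lasso X p u1 u z :
  afrom X p (lasso (u1 ++ u) z) <-> afrom X (foldl (cstep X) p u1) (lasso u z).
Proof.
have R i : srun (cstep X) p (lasso (u1 ++ u) z) (size u1 + i) =
    srun (cstep X) (foldl (cstep X) p u1) (lasso u z) i.
  rewrite srunD; have -> : srun (cstep X) p (lasso (u1 ++ u) z) (size u1) = foldl (cstep X) p u1.
    rewrite (@srun_take _ _ _ u1) ?take_size // => j hj.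
    by rewrite /lasso size_cat (ltn_addr _ hj) nth_cat hj.
  by apply: srun_ext => j _; rewrite lasso_shift.
split=> H c hc K.
  have [i [hi h]] := H c hc (size u1 + K); exists (i - size u1); split; first by lia.
  by rewrite -R -(lasso_shift u1) subnKC //; lia.
have [i [hi h]] := H c hc K; exists (size u1 + i); split; first by lia.
by rewrite R lasso_shift.
Qed.

Definition word (v : seq nat) := all (gtn gS) v.
Notation rA v := (foldl (cstep A) 0 v).
Notation rB v := (foldl (cstep B) (a_init B) v).

Lemma afrom_equiv u1 u z : word u1 -> word u -> word z -> z != [::] ->
  (afrom A (rA u1) (lasso u z) <-> afrom B (rB u1) (lasso u z)).
Proof.
move=> h1 h2 h3 nz; rewrite -!afrom_lasso; apply: equiv; apply: lasso_word => //.
by rewrite all_cat; apply/andP.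
Qed.

Lemma afrom_sink X w : wf_det X -> (afrom X (a_nQ X) w <-> b).
Proof.
move=> wX; have S i : srun (cstep X) (a_nQ X) w i = a_nQ X.
  by elim: i => //= i ->; rewrite cstep_sink.
split=> [H|hb c hc K].
  by have [i [_]] := H 0 isT 0; rewrite S /chas sink_dead.
by exists K; rewrite S /chas sink_dead.
Qed.

(** A loop at root [j] with the status opposite to that of the sink: for [b] true it never shows the
    edge [u0 v0], for [b] false it marks every vertex and shows everything. It tells live states
    from dead ones under both conditions. *)
Definition good_loop j :=
  if b then [:: u0; V + j] else flatten [seq [:: x; V + N + j] | x <- iota 0 V].

Lemma ret_mod j : j < N -> (V + j - V) %% N = j /\ (V + N + j - V) %% N = j.
Proof.
move=> hj; rewrite addKn -addnA addKn modnDl modn_small //.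
Qed.

Lemma rA_mark j x : j < N -> x < V -> foldl (cstep A) j [:: x; V + N + j] = j.
Proof.
move=> hj hx; rewrite /= (A_root hj hx) A_ret //; first by case: (ret_mod hj).
by rewrite /gS; lia.
Qed.

Lemma rA_return i j x : i < N -> j < N -> x < V -> foldl (cstep A) i [:: x; V + j] = j.
Proof.
move=> hi hj hx; rewrite /= (A_root hi hx) A_ret //; first by case: (ret_mod hj).
by rewrite /gS; lia.
Qed.

Lemma good_loopP j : j < N -> [/\ word (good_loop j), good_loop j != [::] &
  (afrom A j (lasso [::] (good_loop j)) <-> ~~ b)].
Proof.
move=> hj; have uv := EV E0.
have h1 : u0 < gS by rewrite /gS; lia.
have h2 : V + j < gS by rewrite /gS; lia.
have h3 : V + N + j < gS by rewrite /gS; lia.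
rewrite /good_loop /word; case: (boolP b) => eb.
  split=> //; first by rewrite /= h1 h2.
  split=> // H.
  have ez : foldl (cstep A) (foldl (cstep A) j [::]) [:: u0; V + j] = foldl (cstep A) j [::].
    by apply: rA_return => //; lia.
  have hu0 : u0 < V by lia.
  have hv0 : v0 < V by lia.
  have [c1 c2 c3] : [/\ u0 * V + v0 < V * V, (u0 * V + v0) %/ V = u0 & (u0 * V + v0) %% V = v0].
    by have [[h4 h5] h6] := col_inv hu0 hv0.
  have /(io_lasso _ ez isT) [r] := H (u0 * V + v0) (ltnW c1).
  case: r => [|[|r]] //= _.
    rewrite A_has //; last exact: ltnW.
    by rewrite /gdef hj (ltn_addr _ hj) (ltn_eqF c1) /glab hj c2 c3 E0 eqxx hu0.
  rewrite A_root //.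
  rewrite A_has //; last exact: ltnW.
  have n1 : N + u0 < N = false by lia.
  have n2 : N + u0 < N + V by lia.
  have n3 : V + N <= V + j = false by lia.
  by rewrite /gdef /glab n1 n2 n3 leq_addr (ltn_eqF c1) c2 c3 E0.
split.
- apply/allP => x /flattenP [l /mapP [y]]; rewrite mem_iota => /= hy -> .
  by rewrite !inE => /orP [] /eqP ->; rewrite /= /gS; lia.
- by rewrite -(prednK V0).
split=> // _ c hc.
have ez : foldl (cstep A) (foldl (cstep A) j [::]) (flatten [seq [:: x; V + N + j] | x <- iota 0 V]) =
    foldl (cstep A) j [::].
  rewrite [foldl _ j [::]]/=; have : all (gtn V) (iota 0 V) by apply/allP => x; rewrite mem_iota.
  elim: (iota 0 V) => //= x l IH /andP[hx hl].
  by have /= -> := rA_mark hj hx; apply: IH.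
apply/(io_lasso (chas b A c) ez); first by rewrite -(prednK V0).
rewrite ltnS in hc.
(* Colour [c] is shown when its first endpoint [u] is marked, at position [2 u + 1] of the loop. The
   extra colour appears anywhere, so 0 will do. *)
pose u := if c == V * V then 0 else c %/ V.
have hu : u < V.
  rewrite /u; case: eqP => // n; rewrite ltn_divLR //; move: hc; rewrite leq_eqVlt => /orP [/eqP//|//].
have Sz k : k <= V -> size (flatten [seq [:: x; V + N + j] | x <- iota 0 k]) = k.*2.
  by elim: k => // k IH hk; rewrite -addn1 iotaD map_cat flatten_cat size_cat IH ?(ltnW hk) //=; lia.
have Ek : flatten [seq [:: x; V + N + j] | x <- iota 0 V] =
    flatten [seq [:: x; V + N + j] | x <- iota 0 u] ++ [:: u, V + N + j &
    flatten [seq [:: x; V + N + j] | x <- iota u.+1 (V - u.+1)]].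
  have -> : iota 0 V = iota 0 u ++ u :: iota u.+1 (V - u.+1).
    rewrite -[in LHS](subnKC (ltnW hu)) iotaD add0n.
    by have -> : V - u = (V - u.+1).+1 by lia.
  by rewrite map_cat flatten_cat.
have lt : u.*2.+1 < size (flatten [seq [:: x; V + N + j] | x <- iota 0 V]).
  by rewrite Sz //; lia.
exists u.*2.+1 => //; rewrite Ek.
have -> : take u.*2.+1 (flatten [seq [:: x; V + N + j] | x <- iota 0 u] ++ [:: u, V + N + j &
    flatten [seq [:: x; V + N + j] | x <- iota u.+1 (V - u.+1)]]) =
    rcons (flatten [seq [:: x; V + N + j] | x <- iota 0 u]) u.
  rewrite take_cat (Sz u (ltnW hu)).
  have -> : u.*2.+1 < u.*2 = false by lia.
  have -> : u.*2.+1 - u.*2 = 1 by lia.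
  by rewrite /= cats1.
have -> : nth 0 (flatten [seq [:: x; V + N + j] | x <- iota 0 u] ++ [:: u, V + N + j &
    flatten [seq [:: x; V + N + j] | x <- iota u.+1 (V - u.+1)]]) u.*2.+1 = V + N + j.
  rewrite nth_cat (Sz u (ltnW hu)).
  have -> : u.*2.+1 < u.*2 = false by lia.
  by have -> : u.*2.+1 - u.*2 = 1 by lia.
have lp k : k <= V -> foldl (cstep A) j (flatten [seq [:: x; V + N + j] | x <- iota 0 k]) = j.
  elim: k => // k IH hk; rewrite -addn1 iotaD map_cat flatten_cat foldl_cat IH 1?ltnW //.
  exact: rA_mark.
rewrite foldl_rcons lp 1?ltnW // A_root // A_has //.
have n1 : N + u < N = false by lia.
have n2 : N + u < N + V by lia.
rewrite /gdef /glab n1 n2 -addnA leq_addr addnA leq_addr eqn_add2l /u.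
by case: (c == _) => //=; rewrite eqxx orbT.
Qed.

Lemma same_B_state v1 v2 u z : word v1 -> word v2 -> word u -> word z -> z != [::] ->
  rB v1 = rB v2 -> afrom A (rA v1) (lasso u z) -> afrom A (rA v2) (lasso u z).
Proof. by move=> h1 h2 h3 h4 nz e /(afrom_equiv h1 h3 h4 nz); rewrite e => /(afrom_equiv h2 h3 h4 nz). Qed.

Lemma afrom_step p a j : a < gS -> j < N -> cstep A p a = j ->
  (afrom A p (lasso [:: a] (good_loop j)) <-> ~~ b).
Proof.
move=> ha hj e; have [_ _ <-] := good_loopP hj.
by rewrite -[[:: a]]cats0 afrom_lasso /= e.
Qed.

Lemma afrom_dead p a z : cstep A p a = N + V -> (afrom A p (lasso [:: a] z) <-> b).
Proof.
by move=> e; rewrite -[[:: a]]cats0 afrom_lasso /= e; apply: (afrom_sink _ wfA).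
Qed.

Definition root_of v := if rA v < N then rA v else N.

Lemma separated v1 v2 j a : word v1 -> word v2 -> a < gS -> j < N ->
  cstep A (rA v1) a = j -> cstep A (rA v2) a = N + V -> rB v1 <> rB v2.
Proof.
move=> h1 h2 ha hj e1 e2 e; have [hw nz _] := good_loopP hj.
have wa : word [:: a] by rewrite /word /= ha.
have s1 := afrom_step ha hj e1; have s2 := afrom_dead (good_loop j) e2.
have i1 := same_B_state h1 h2 wa hw nz e; have i2 := same_B_state h2 h1 wa hw nz (esym e).
by case: b s1 s2 => -[a1 a2] [a3 a4]; [have := a1 (i2 (a4 isT)) | have := a3 (i1 (a2 isT))].
Qed.

Lemma root_separated v1 v2 : word v1 -> word v2 -> rA v1 < N + V -> rA v2 < N + V ->
  root_of v1 != root_of v2 -> rB v1 <> rB v2.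
Proof.
have W v1' v2' : word v1' -> word v2' -> rA v1' < N -> N <= rA v2' < N + V -> rB v1' <> rB v2'.
  move=> h1 h2 l1 l2 /esym; apply: (@separated v2' v1' (rA v1') (V + N + rA v1')) => //.
  - by rewrite /gS; lia.
  - have -> : rA v2' = N + (rA v2' - N) by lia.
    rewrite A_ret //; [by case: (ret_mod l1) | lia | rewrite /gS; lia].
  - by rewrite A_root_dead //; lia.
move=> h1 h2 l1 l2; rewrite /root_of.
case: (ltnP (rA v1) N) => g1; case: (ltnP (rA v2) N) => g2 ne.
- apply: (@separated v1 v2 (rA v1) (V + rA v1)) => //.
  + by rewrite /gS; lia.
  + by rewrite A_self.
  + by rewrite A_root_dead //; [lia | rewrite eqn_add2l].
- by apply: W => //; rewrite g2.
- by move=> e; apply: (W v2 v1) => //; rewrite g1.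
- by rewrite eqxx in ne.
Qed.

Lemma alive_B v : word v -> rA v < N + V -> rB v < a_nQ B.
Proof.
move=> hv l.
have le : rB v <= a_nQ B.
  elim/last_ind: v {hv l} => [|v x _]; last by rewrite foldl_rcons; exact: (cstep_le wfB).
  by case/and3P: wfB => /ltnW.
rewrite ltn_neqAle le andbT; apply/eqP => e.
have [a [j [ha hj es]]] : exists a j, [/\ a < gS, j < N & cstep A (rA v) a = j].
  case: (ltnP (rA v) N) => g.
    by exists (V + rA v), (rA v); rewrite A_self //; split=> //; rewrite /gS; lia.
  exists (V + 0), 0; split=> //; first by rewrite /gS; lia.
  have -> : rA v = N + (rA v - N) by lia.
  by rewrite A_ret //; [case: (ret_mod N0) | lia | rewrite /gS; lia].
have [hw nz _] := good_loopP hj.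
have wa : word [:: a] by rewrite /word /= ha.
have s1 := afrom_step ha hj es.
have s2 := afrom_equiv hv wa hw nz.
rewrite e in s2.
have s3 := afrom_sink (lasso [:: a] (good_loop j)) wfB.
have : b <-> ~~ b by tauto.
by case: (b) => -[h1 h2]; [have := h1 isT | have := h2 isT].
Qed.

Lemma word_home j : j < N -> word [:: 0; V + j] /\ rA [:: 0; V + j] = j.
Proof.
move=> hj; split; last exact: (rA_return N0 hj V0).
by rewrite /word /= andbT; apply/andP; split; rewrite /gS; lia.
Qed.

Lemma word_vertex j x : j < N -> x < V ->
  word ([:: 0; V + j] ++ [:: x]) /\ rA ([:: 0; V + j] ++ [:: x]) = N + x.
Proof.
move=> hj hx; have [h1 h2] := word_home hj; split.
  by rewrite /word all_cat; apply/andP; split=> //=; rewrite andbT /gS; lia.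
by rewrite foldl_cat h2 /= A_root.
Qed.

(* [B] has a state for the vertices, hence at most [2 N - 1] states for the [N] roots. *)
Lemma unique_root : exists2 j, j < N & forall v, word v -> rA v = j -> rB v = rB [:: 0; V + j].
Proof.
apply: NNPP => nex.
have /fin_all_exists [f fP] (j : 'I_N) : exists v, [/\ word v, rA v = j & rB v <> rB [:: 0; V + j]].
  apply: NNPP => nv; apply: nex; exists (j : nat) => // v wv e.
  by apply: NNPP => ne; apply: nv; exists v.
pose g (x : option (bool * 'I_N)) : seq nat :=
  match x with None => [:: 0] | Some (true, j) => [:: 0; V + j] | Some (false, j) => f j end.
have w0 : word [:: 0] by rewrite /word /= andbT /gS; lia.
have gP x : [/\ word (g x), rA (g x) < N + V &
    root_of (g x) = if x is Some (_, j) then (j : nat) else N].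
  case: x => [[[] j]|] /=; rewrite /root_of.
  - have [h1 /= ->] := word_home (ltn_ord j); rewrite ltn_ord; split=> //.
    by have := ltn_ord j; lia.
  - have [h1 -> _] := fP j; rewrite ltn_ord; split=> //.
    by have := ltn_ord j; lia.
  - by rewrite /= A_root // addn0; split=> //; [lia | rewrite ltnn].
have inj : injective (fun x => rB (g x)).
  move=> x y e; have [w1 l1 r1] := gP x; have [w2 l2 r2] := gP y.
  have : root_of (g x) = root_of (g y).
    by apply/eqP/negPn/negP => ne; case: (root_separated w1 w2 l1 l2 ne).
  rewrite r1 r2; case: x y e {w1 l1 r1 w2 l2 r2} => [[b1 j1]|] [[b2 j2]|] //= e.
  - move/val_inj => ej; subst j2; congr (Some (_, _)).
    have [_ _ ne] := fP j1; case: b1 b2 e => [] [] // e; case: ne => //; by rewrite e.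
  - by move=> ej; have := ltn_ord j1; rewrite ej ltnn.
  - by move=> ej; have := ltn_ord j2; rewrite -ej ltnn.
have lt x : rB (g x) < a_nQ B by have [w1 l1 _] := gP x; apply: alive_B.
have inj' : injective (fun x => Ordinal (lt x)) by move=> x y /(congr1 val) /inj.
by have := leq_card _ inj'; rewrite card_option card_prod card_bool !card_ord; lia.
Qed.

(* The colour of [x] is the state of [B] reached by [x] from the unique state of root [j]. *)
Lemma equiv_colouring : exists col, (forall x, x < V -> col x < N) /\
  forall u v, E u v -> col u <> col v.
Proof.
have [j hj uj] := unique_root.
have [wj ej] := word_home hj.
pose s := rB [:: 0; V + j].
pose p x := rB ([:: 0; V + j] ++ [:: x]).
have pE x : p x = cstep B s x by rewrite /p foldl_cat.
pose I := undup [seq p x | x <- iota 0 V].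
have sI : size I <= N.
  have : size (I ++ [seq rB [:: 0; V + i] | i <- iota 0 N]) <= size (iota 0 (a_nQ B)).
    apply: uniq_leq_size.
      rewrite cat_uniq undup_uniq /=; apply/andP; split.
        apply/hasPn => q /mapP [i]; rewrite mem_iota => /= hi ->.
        rewrite mem_undup; apply/negP => /mapP [x]; rewrite mem_iota => /= hx.
        have [w1 e1] := word_home hi; have [w2 e2] := word_vertex hj hx.
        apply: (root_separated w1 w2); rewrite ?/root_of ?e1 ?e2 ?hi; try lia.
        by have -> : N + x < N = false; lia.
      rewrite map_inj_in_uniq ?iota_uniq // => i i'; rewrite !mem_iota => /= hi hi' e.
      have [w1 e1] := word_home hi; have [w2 e2] := word_home hi'.
      apply/eqP/negPn/negP => ne; apply: (root_separated w1 w2) => //; rewrite ?e1 ?e2; try lia.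
      by rewrite /root_of e1 e2 hi hi'.
    move=> q hq; suff : q < a_nQ B by rewrite mem_iota.
    move: hq; rewrite mem_cat mem_undup => /orP [] /mapP [x]; rewrite mem_iota => /andP[_ hx] ->.
      by have [w2 e2] := word_vertex hj hx; apply: (alive_B w2); rewrite e2; lia.
    by have [w2 e2] := word_home hx; apply: (alive_B w2); rewrite e2; lia.
  by rewrite size_cat size_map !size_iota; lia.
exists (fun x => index (p x) I); split.
  move=> x hx; apply: leq_trans sI; rewrite index_mem mem_undup; apply/mapP; exists x => //.
  by rewrite mem_iota.
move=> u v e ic; have /andP[huv hv] := EV e; have hu := ltn_trans huv hv.
have pI x : x < V -> p x \in I.
  by move=> hx; rewrite mem_undup; apply/mapP; exists x; rewrite ?mem_iota.
have pp : p u = p v by rewrite -(nth_index 0 (pI _ hu)) ic nth_index ?pI.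
have back x a : x < V -> (a == V + j) || (a == V + N + j) -> cstep B (p x) a = s.
  move=> hx ha; have [w2 e2] := word_vertex hj hx.
  have [m1 m2] := ret_mod hj.
  have ag : V <= a < gS by case/orP: ha => /eqP ->; rewrite /gS; lia.
  rewrite /s -(uj (([:: 0; V + j] ++ [:: x]) ++ [:: a])).
  - by rewrite foldl_cat.
  - by rewrite /word all_cat; apply/andP; split=> //=; rewrite andbT; case/andP: ag.
  - by rewrite foldl_cat e2 /= A_ret //; case/orP: ha => /eqP ->.
pose z x y := [:: x; V + N + j; y; V + j].
have zA x y : x < V -> y < V ->
    foldl (cstep A) (foldl (cstep A) 0 [:: 0; V + j]) (z x y) = foldl (cstep A) 0 [:: 0; V + j].
  move=> hx hy; rewrite ej -[z x y]/([:: x; V + N + j] ++ [:: y; V + j]) foldl_cat.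
  by rewrite rA_mark // rA_return.
have zB x y : x < V -> y < V -> foldl (cstep B) s (z x y) = s.
  by move=> hx hy; rewrite /= -!pE !back ?eqxx ?orbT //= -pE back ?eqxx.
have wz x y : x < V -> y < V -> is_word gS (lasso [:: 0; V + j] (z x y)).
  move=> hx hy; apply: lasso_word => //; rewrite /= /gS andbT.
  by apply/and4P; split; lia.
have BB : allinf b B (lasso [:: 0; V + j] (z u v)) -> allinf b B (lasso [:: 0; V + j] (z v u)).
  move=> H c hc; have zz := zB v u hv hu; apply/(io_lasso (chas b B c) zz) => //.
  have /(io_lasso (chas b B c) (zB u v hu hv) isT) [r hr h] := H c hc.
  move: h; case: r hr => [|[|[|[|r]]]] //= _.
  - by move=> h; exists 2 => //=; rewrite -!pE back ?eqxx ?orbT.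
  - by move=> h; exists 1 => //=; move: h; rewrite -!pE pp.
  - move=> h; exists 0 => //=; move: h; by rewrite -!pE back ?eqxx ?orbT.
  - move=> h; exists 3 => //=; move: h.
    by rewrite -!pE pp back ?eqxx ?orbT // -!pE pp.
have hgu : u < gS by rewrite /gS; lia.
have hgv : v < gS by rewrite /gS; lia.
have hg1 : V + j < gS by rewrite /gS; lia.
have hg2 : V + N + j < gS by rewrite /gS; lia.
have A1 : allinf b A (lasso [:: 0; V + j] (z u v)).
  move=> c; rewrite ltnS => hc; apply/(io_lasso (chas b A c) (zA u v hu hv)) => //.
  rewrite ej.
  have n1 : N + u < N = false by lia.
  have n2 : N + u < N + V by lia.
  have H0 : chas b A c j u = (c == V * V) || glab id j u c.
    by rewrite A_has // (ltn_addr _ hj) /gdef hj hu.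
  have H1 : chas b A c (N + u) (V + N + j) = (c == V * V) || glab id (N + u) (V + N + j) c.
    by rewrite A_has // n2 /gdef n1 -addnA leq_addr.
  have H2 : chas b A c j v = (c == V * V) || glab id j v c.
    by rewrite A_has // (ltn_addr _ hj) /gdef hj hv.
  case: (boolP (c == V * V)) => cV; first by exists 0 => //=; rewrite H0 cV.
  case: (boolP (E (c %/ V) (c %% V))) => ce; last by exists 0 => //=; rewrite H0 /glab ce orbT.
  case: (boolP ((u != c %/ V) && (u != c %% V))) => cu.
    by exists 0 => //=; rewrite H0 /glab hj hu cu !orbT.
  case: (boolP ((v != c %/ V) && (v != c %% V))) => cv.
    exists 2 => //=; have := rA_mark hj hu => /= ->; by rewrite H2 /glab hj hv cv !orbT.
  exists 1 => //=; rewrite A_root // H1 /glab n1 leq_addr eqn_add2l.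
  have cE := EV ce; have -> : u = c %/ V by lia.
  by rewrite eqxx !orbT.
have A2 : ~ allinf b A (lasso [:: 0; V + j] (z v u)).
  move=> H; have [[c1 c2] c3] := col_inv hu hv; have c0 := ltnW c1.
  have /(io_lasso (chas b A _) (zA v u hv hu) isT) [r] := H (u * V + v) (ltnW c1).
  have n1 : N + u < N = false by lia.
  have n2 : N + u < N + V by lia.
  have n3 : N + v < N = false by lia.
  have n4 : N + v < N + V by lia.
  have n5 : V + N <= V + j = false by lia.
  have n6 : v == u = false by lia.
  rewrite ej; case: r => [|[|[|[|r]]]] //= _.
  - rewrite A_has // (ltn_addr _ hj) /gdef hj hv (ltn_eqF c1) /glab hj c2 c3 e eqxx.
    by rewrite !andbF.
  - rewrite (A_root hj hv) A_has // n4 /gdef n3 -addnA leq_addr (ltn_eqF c1) /glab n3 c2 c3 e.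
    by rewrite eqn_add2l n6 andbF.
  - have := rA_mark hj hv => /= ->.
    rewrite A_has // (ltn_addr _ hj) /gdef hj hu (ltn_eqF c1) /glab hj c2 c3 e eqxx.
    by rewrite !andbF.
  - have := rA_mark hj hv => /= ->.
    by rewrite (A_root hj hu) A_has // n2 /gdef n1 leq_addr (ltn_eqF c1) /glab n1 c2 c3 e n5.
by apply: A2; apply/equiv; [apply: wz | apply: BB; apply/equiv; [apply: wz |]].
Qed.

End Backward.
End Graph.

(** * Computation tableaux as binary constraints *)

Section Tableau.
Variable M : TM.
Notation Sym := (tsym (tm_k M)).
Notation choice := (tm_st M * Sym * move)%type.

(* A tableau cell: its symbol and, if the head is there, the state, the transition about to be
   taken and the move by which the head arrived. Recording the arrival makes the uniqueness of
   the head a constraint between neighbouring cells of consecutive rows. *)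
Definition tcell : finType := (Sym * option (tm_st M * choice * move))%type.

Implicit Types d : tcell.

Definition headless d := d.2 == None.
Definition tvalid d := if d.2 is Some (q, x, _)
  then (x \in tm_delta q d.1) || (tm_acc q && (x == (q, d.1, None))) else true.
Definition after d : Sym := if d.2 is Some (_, x, _) then x.1.2 else d.1.
Definition goes d (m : move) : option (tm_st M) :=
  if d.2 is Some (_, x, _) then (if x.2 == m then Some x.1.1 else None) else None.
Definition comes d (m : move) : option (tm_st M) :=
  if d.2 is Some (q, _, o) then (if o == m then Some q else None) else None.
Definition tlink m d d' := (goes d m == comes d' m) && ((m == None) ==> (d'.1 == after d)).
Definition tstart d := if d.2 is Some (q, _, _) then q == tm_start M else false.
Definition taccept d := if d.2 is Some (q, _, _) then tm_acc q else true.

Variables (w : seq bool) (T : nat).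
Let W := T + T + 3.

Definition tunary t i d :=
  [&& tvalid d, ((i == 0) || (i == W.-1)) ==> headless d,
      (t == 0) ==> ((if i == T.+1 then tstart d else headless d) &&
                    (d.1 == symat (init_cfg M w) T.+1 i)) &
      (t == T) ==> taccept d].

Definition tableau (val : nat -> nat -> tcell) :=
  (forall t i, t <= T -> i < W -> tunary t i (val t i)) /\
  (forall t i m, t < T -> i < W -> (m = Some false -> 0 < i) -> shift_pos i m < W ->
     tlink m (val t i) (val t.+1 (shift_pos i m))).

Definition accepting := exists t (cf : config M),
  [/\ t <= T, reach t (init_cfg M w) cf & tm_acc (c_st cf)].

Lemma reach_rcons t (c c1 c2 : config M) : reach t c c1 -> tm_step c1 c2 -> reach t.+1 c c2.
Proof. by move=> r s; rewrite -addn1; apply: reach_cat r _; exists c2. Qed.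

Lemma apply_idle (c : config M) : apply_tr c (c_st c, c_head c, None) = c.
Proof. by case: c. Qed.

Lemma tableau_sound val : tableau val -> accepting.
Proof.
move=> [HU HL].
pose inv t := exists t' (cf : config M) pos, [/\ t' <= t, reach t' (init_cfg M w) cf,
  (T.+1 - t <= pos) && (pos <= T.+1 + t),
  (exists x o, (val t pos).2 = Some (c_st cf, x, o)) &
  forall i, i < W -> (val t i).1 = symat cf pos i /\ (i != pos -> (val t i).2 = None)].
have base : inv 0.
  have U0 i (hi : i < W) := HU 0 i (leq0n _) hi.
  exists 0, (init_cfg M w), T.+1; split=> //; first by rewrite subn0 addn0 leqnn.
    have h1 : T.+1 < W by rewrite /W; lia.
    have /and4P[_ _ /andP[h _] _] := U0 _ h1; move: h; rewrite eqxx /tstart.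
    case: (val 0 T.+1).2 => // -[[q x] o] /eqP ->; exists x, o.
    by case: (w).
  move=> i hi; have /and4P[_ _ /andP[h1 h2] _] := U0 _ hi; split; first exact/eqP.
  by move=> ni; move: h1; rewrite (negbTE ni) => /eqP.
have step t : t < T -> inv t -> inv t.+1.
  move=> tT [t' [cf [pos [ht' hr hp [x [o hx]] hc]]]].
  have posW : 0 < pos /\ pos.+1 < W by rewrite /W; lia.
  have pW : pos < W by lia.
  have [hs _] := hc _ pW; rewrite symat_head in hs.
  have /and4P[hv _ _ _] := HU t pos (ltnW tT) pW.
  have hv' : x \in tm_delta (c_st cf) (c_head cf) \/
      (tm_acc (c_st cf) /\ x = (c_st cf, c_head cf, None)).
    move: hv; rewrite /tvalid hx hs => /orP [->|/andP[h1 /eqP h2]]; [by left | by right].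
  have posx : shift_pos pos x.2 < W /\ (x.2 = Some false -> 0 < pos).
    by case: (x.2) => [[]|] /=; lia.
  pose cf' := apply_tr cf x; pose pos' := shift_pos pos x.2.
  have [t1 ht1 hr1] : exists2 t1, t1 <= t.+1 & reach t1 (init_cfg M w) cf'.
    case: hv' => [xin|[_ ex]].
      by exists t'.+1 => //; apply: reach_rcons hr _; exists x.
    exists t'; first exact: leqW.
    by rewrite /cf' ex apply_idle.
  have goesP m : goes (val t pos) m = if x.2 == m then Some x.1.1 else None by rewrite /goes hx.
  have goesN i m : i < W -> i != pos -> goes (val t i) m = None.
    by move=> hi ni; rewrite /goes (proj2 (hc i hi) ni).
  exists t1, cf', pos'; split=> //.
  - by rewrite /pos'; case: (x.2) => [[]|] /=; lia.
  - have /andP[/eqP h _] := HL t pos x.2 tT pW (proj2 posx) (proj1 posx).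
    move: h; rewrite goesP eqxx /comes -/pos'.
    case: (val t.+1 pos').2 => // -[[q y] o']; case: eqP => // _ [<-].
    by exists y, o'; rewrite c_st_apply.
  move=> i hi; split.
    have /andP[_ /eqP ->] := HL t i None tT hi (fun e => ltac:(discriminate e)) hi.
    rewrite symat_apply; last by case: posx.
    rewrite /after; case: (i =P pos) => [->|/eqP ni]; first by rewrite hx.
    by have [-> h] := hc i hi; rewrite h.
  move=> ni; case e : (val t.+1 i).2 => [[[q y] o']|] //.
  have /and4P[_ hb _ _] := HU t.+1 i tT hi.
  have ib : 0 < i /\ i.+1 < W.
    move: hb; rewrite /headless e implybF negb_or /W /= => /andP[]; lia.
  pose i0 := match o' with None => i | Some true => i.-1 | Some false => i.+1 end.
  have i0W : i0 < W by rewrite /i0; case: (o') => [[]|]; lia.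
  have si0 : shift_pos i0 o' = i by rewrite /i0; case: (o') => [[]|] /=; lia.
  have pf : o' = Some false -> 0 < i0 by rewrite /i0 => ->; lia.
  have := HL t i0 o' tT i0W pf; rewrite si0 => /(_ hi) /andP[/eqP h _].
  rewrite /comes e eqxx in h.
  case: (i0 =P pos) => [ei|/eqP ne]; last by rewrite goesN in h.
  move: h; rewrite ei goesP; case: eqP => // ex _.
  by move: ni; rewrite /pos' ex -ei si0 eqxx.
have fin t : t <= T -> inv t by elim: t => // t IH ht; apply: step => //; apply: IH; apply: ltnW.
have [t' [cf [pos [ht' hr hp [x [o hx]] hc]]]] := fin T (leqnn _).
have pW : pos < W by rewrite /W; lia.
have /and4P[_ _ _ ha] := HU T pos (leqnn _) pW.
exists t', cf; split=> //.
by move: ha; rewrite eqxx /taccept hx.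
Qed.

Lemma reach_choices t (c cf : config M) : reach t c cf -> tm_acc (c_st cf) ->
  exists (cfs : nat -> config M) (xs : nat -> choice), [/\ cfs 0 = c,
    forall i, cfs i.+1 = apply_tr (cfs i) (xs i),
    forall i, (xs i \in tm_delta (c_st (cfs i)) (c_head (cfs i))) ||
              (tm_acc (c_st (cfs i)) && (xs i == (c_st (cfs i), c_head (cfs i), None))) &
    forall i, t <= i -> tm_acc (c_st (cfs i))].
Proof.
elim: t c => [|t IH] c.
  move=> /= <- h; exists (fun=> cf), (fun=> (c_st cf, c_head cf, None)); split=> //.
  - by move=> _; rewrite apply_idle.
  - by move=> _; rewrite h eqxx orbT.
case=> c1 [[x xin ->] r] h; have [cfs [xs [h1 h2 h3 h4]]] := IH _ r h.
exists (fun i => if i is j.+1 then cfs j else c), (fun i => if i is j.+1 then xs j else x).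
split=> //; case=> //=.
by rewrite xin.
Qed.

Lemma tableau_complete : accepting -> exists val, tableau val.
Proof.
move=> [t0 [cf [ht0 hr ha]]].
have [cfs [xs [h1 h2 h3 h4]]] := reach_choices hr ha.
pose pos := fix pos t := if t is t'.+1 then shift_pos (pos t') (xs t').2 else T.+1.
have posP t : t <= T -> (T.+1 - t <= pos t) && (pos t <= T.+1 + t).
  elim: t => [|t IH] ht; first by rewrite subn0 addn0 leqnn.
  by have := IH (ltnW ht); rewrite /=; case: (xs t).2 => [[]|] /=; lia.
pose val t i : tcell := (symat (cfs t) (pos t) i,
  if i == pos t then Some (c_st (cfs t), xs t, if t is t'.+1 then (xs t').2 else None) else None).
exists val; split.
  move=> t i ht hi; have hp := posP t ht; apply/and4P; split.
  - rewrite /tvalid /val /=; case: eqP => // ->; rewrite symat_head; exact: h3.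
  - apply/implyP => hb; rewrite /headless /val /=; case: (i =P pos t) => // ei.
    by move: hb; rewrite /W /= ei; lia.
  - apply/implyP => /eqP ->; rewrite /val /= h1 eqxx andbT /tstart /headless /=.
    by case: (i == T.+1) => //=; case: (w).
  - apply/implyP => /eqP ->; rewrite /taccept /val /=; case: (i == pos T) => //.
    exact: h4.
move=> t i m tT hi hm hm'; have hp := posP t (ltnW tT); apply/andP; split.
  rewrite /goes /comes /val /=; case: (i =P pos t) => [->|ni].
    case: ((xs t).2 =P m) => [->|nm]; first by rewrite !eqxx h2 c_st_apply.
    by case: (shift_pos (pos t) m == _) => //=; case: ((xs t).2 =P m).
  case: (shift_pos i m =P shift_pos (pos t) (xs t).2) => // e.
  case: ((xs t).2 =P m) => // em; rewrite em in e.
  by case: ni; move: e hm; case: (m) => [[]|] /=; lia.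
apply/implyP => /eqP em; rewrite em /= /after /val /= h2 symat_apply.
  by case: (i =P pos t).
by move=> _; lia.
Qed.

End Tableau.

(** * Binary constraints as graph colouring *)

(* [K] variables with values below [n]; the colours are the values of even variables, the values
   of odd variables, and [2 n]. Vertices: one per colour, one per variable, and an indicator per
   variable [P] and value [a], which must get colour [2 n] when [P] has value [a] and otherwise may
   get the colour of [a]. A forbidden pair is an edge between indicators: the two sides have
   different parities, so such an edge is only violated by two indicators coloured [2 n]. *)
Section CSP.
Variables (K n : nat) (par : nat -> bool) (U : nat -> nat -> bool)
  (C : nat -> nat -> nat -> nat -> bool).

Definition csN := n + n + 1.
Definition csV := csN + K * n.+1.
Definition csP u := (u - csN) %/ n.+1.
Definition csj u := (u - csN) %% n.+1.

Definition csE u v :=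
  [&& u < v, v < csV &
    if v < csN then true
    else if u < csN then
      (if csj v < n then (u != n + n) && (u != par (csP v) * n + csj v)
       else ~~ [&& par (csP v) * n <= u, u < par (csP v) * n + n
                 & U (csP v) (u - par (csP v) * n)])
    else ((csP u == csP v) && (csj v == n)) ||
         [&& csj u < n, csj v < n & C (csP u) (csj u) (csP v) (csj v)]].

Definition solution (val : nat -> nat) :=
  (forall P, P < K -> val P < n /\ U P (val P)) /\
  (forall P P', P < K -> P' < K -> ~~ C P (val P) P' (val P')).

Hypothesis CP : forall P a P' a', C P a P' a' -> P < P' /\ par P != par P'.

Definition vtx P j := csN + (P * n.+1 + j).

Lemma vtxP P j : j <= n -> (csP (vtx P j) = P) * (csj (vtx P j) = j).
Proof. by move=> h; rewrite /csP /csj /vtx addKn divnMDl // divn_small // addn0 modnMDl modn_small. Qed.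

Lemma vtx_lt P j : P < K -> j <= n -> vtx P j < csV.
Proof. by rewrite /vtx /csV => h1 h2; nia. Qed.

Lemma colour_sol col : (forall x, x < csV -> col x < csN) ->
  (forall u v, csE u v -> col u <> col v) -> exists val, solution val.
Proof.
move=> cN cE.
have cNV : csN <= csV by rewrite /csV leq_addr.
have inj u v : u < csN -> v < csN -> col u = col v -> u = v.
  wlog: u v / u <= v => [W hu hv e|].
    by case: (leqP u v) => h; [apply: W | apply/esym; apply: W => //; apply: ltnW].
  rewrite leq_eqVlt => /orP [/eqP//|lt] hu hv e; case: (cE u v) => //.
  by rewrite /csE lt hv (leq_trans hv cNV).
have surj k : k < csN -> exists2 u, u < csN & col u = k.
  move=> hk; pose g (u : 'I_csN) : 'I_csN := Ordinal (cN u (leq_trans (ltn_ord u) cNV)).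
  have gi : injective g.
    by move=> u v /(congr1 val) /= e; apply: val_inj; apply: (inj u v (ltn_ord u) (ltn_ord v)).
  have /codomP [u hu] : Ordinal hk \in codom g by apply: (inj_card_onto gi).
  by exists u => //; have /(congr1 val) := hu.
pose val P := find (fun a => col (par P * n + a) == col (vtx P n)) (iota 0 n).
have pN P a : a < n -> par P * n + a < csN by rewrite /csN; case: (par P); lia.
have valP P : P < K -> [/\ val P < n, U P (val P) & col (par P * n + val P) = col (vtx P n)].
  move=> hP; have [e1 e2] := vtxP P (leqnn n); have hV := vtx_lt hP (leqnn n).
  have [u hu eu] := surj _ (cN _ hV).
  have vN : csN <= vtx P n by rewrite /vtx leq_addr.
  have : ~~ csE u (vtx P n) by apply/negP => h; case: (cE _ _ h).
  rewrite /csE hV e1 e2 hu ltnn (leq_trans hu vN) ltnNge vN /= negbK => /and3P[h1 h2 h3].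
  pose a := u - par P * n.
  have ha : a < n by rewrite /a; lia.
  have ua : u = par P * n + a by rewrite /a; lia.
  have hasP : has (fun a => col (par P * n + a) == col (vtx P n)) (iota 0 n).
    by apply/hasP; exists a; rewrite ?mem_iota // -ua eu.
  have lt : val P < n by rewrite /val -[X in _ < X](size_iota 0) -has_find.
  have := nth_find 0 hasP; rewrite -/(val P) nth_iota // add0n => /eqP ev.
  split=> //; suff -> : val P = a by [].
  by have := inj _ _ (pN P _ lt) hu; rewrite ev eu => /(_ erefl); lia.
have indP P : P < K -> col (vtx P (val P)) = col (n + n).
  move=> hP; have [h1 h2 h3] := valP P hP.
  have hl := ltnW h1; have [e1 e2] := vtxP P hl; have hV := vtx_lt hP hl.
  have [u hu eu] := surj _ (cN _ hV).
  have vN : csN <= vtx P (val P) by rewrite /vtx leq_addr.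
  have : ~~ csE u (vtx P (val P)) by apply/negP => h; case: (cE _ _ h).
  rewrite /csE hV e1 e2 hu h1 (leq_trans hu vN) ltnNge vN /= negb_and !negbK.
  case/orP => /eqP e; first by rewrite -eu e.
  case: (cE (vtx P (val P)) (vtx P n)); last by rewrite -eu e.
  have [e3 e4] := vtxP P (leqnn n).
  have n1 : vtx P (val P) < csN = false by rewrite /vtx; lia.
  have n2 : vtx P n < csN = false by rewrite /vtx; lia.
  by rewrite /csE n1 n2 e1 e3 e4 !eqxx vtx_lt //= /vtx !ltn_add2l h1.
exists val; split=> [P hP|P P' hP hP']; first by have [] := valP P hP.
apply/negP => c; have [lt _] := CP c.
have [h1 _ _] := valP P hP; have [h2 _ _] := valP P' hP'.
have [e1 e2] := vtxP P (ltnW h1); have [e3 e4] := vtxP P' (ltnW h2).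
case: (cE (vtx P (val P)) (vtx P' (val P'))); last by rewrite !indP.
have n1 : vtx P (val P) < csN = false by rewrite /vtx; lia.
have n2 : vtx P' (val P') < csN = false by rewrite /vtx; lia.
apply/and3P; split; last by rewrite n1 n2 e1 e2 e3 e4 h1 h2 c orbT.
  rewrite /vtx ltn_add2l; have : P.+1 * n.+1 <= P' * n.+1 by rewrite leq_mul2r lt orbT.
  by rewrite mulSn; lia.
by apply: vtx_lt => //; apply: ltnW.
Qed.

Lemma sol_colour val : solution val -> exists col,
  (forall x, x < csV -> col x < csN) /\ (forall u v, csE u v -> col u != col v).
Proof.
move=> [s1 s2].
pose col u := if u < csN then u
  else if csj u == n then par (csP u) * n + val (csP u)
  else if csj u == val (csP u) then n + n else par (csP u) * n + csj u.
have jn u : csj u <= n by rewrite -ltnS ltn_mod.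
have PK u : csN <= u -> u < csV -> csP u < K.
  by move=> h1; rewrite /csV /csP => h2; rewrite ltn_divLR //; lia.
exists col; split.
  move=> x hx; rewrite /col; case: (ltnP x csN) => // h.
  have [v1 _] := s1 _ (PK x h hx); have := jn x.
  rewrite /csN; case: (csj x =P n) => ?; [|case: (csj x =P val (csP x)) => ?];
    by case: (par (csP x)); rewrite ?mul1n ?mul0n; lia.
move=> u v /and3P[lt hv]; case: (ltnP v csN) => vN.
  by move=> _; rewrite /col vN (ltn_trans lt vN); lia.
have [v1 v2] := s1 _ (PK v vN hv); have jv := jn v.
case: (ltnP u csN) => uN.
  rewrite {1}/col uN /col [v < csN]ltnNge vN /=.
  case: (csj v =P n) => [->|nj].
    rewrite ltnn => /negP h; apply/eqP => e; apply: h.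
    by rewrite e addKn v2 leq_addr ltn_add2l v1.
  have -> : csj v < n by lia.
  by case/andP => h1 h2; case: ifP.
rewrite /col [u < csN]ltnNge [v < csN]ltnNge uN vN /=.
have [u1 u2] := s1 _ (PK u uN (ltn_trans lt hv)); have ju := jn u.
case/orP => [/andP[/eqP eP /eqP ej]|/and3P[h1 h2 h3]].
  have nu : csj u != n.
    apply/eqP => eu; move: lt.
    have := divn_eq (u - csN) n.+1; have := divn_eq (v - csN) n.+1.
    rewrite -/(csP u) -/(csP v) -/(csj u) -/(csj v) eP eu ej; lia.
  rewrite ej eqxx (negbTE nu) eP; case: ifP => [_|/eqP ne]; last by rewrite eqn_add2l; apply/eqP.
  by case: (par (csP v)); rewrite ?mul1n ?mul0n; lia.
have [_ np] := CP h3.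
rewrite (ltn_eqF h1) (ltn_eqF h2).
case: (csj u =P val (csP u)) => eu; case: (csj v =P val (csP v)) => ev.
- by rewrite eu ev in h3; case/negP: (s2 _ _ (PK u uN (ltn_trans lt hv)) (PK v vN hv)).
- by case: (par (csP v)); rewrite ?mul1n ?mul0n; lia.
- by case: (par (csP u)); rewrite ?mul1n ?mul0n; lia.
- by move: np; case: (par (csP u)); case: (par (csP v)) => // _; rewrite ?mul1n ?mul0n; lia.
Qed.

End CSP.

(** * The encoding is injective *)

Lemma enc_unary_inj a a' x x' : enc_unary a ++ x = enc_unary a' ++ x' -> a = a' /\ x = x'.
Proof.
elim: a a' => [|a IH] [|a'] //=; first by case.
by case=> /IH [-> ->].
Qed.

Lemma enc_bits_inj l l' x x' : enc_bits l ++ x = enc_bits l' ++ x' -> l = l' /\ x = x'.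
Proof.
rewrite /enc_bits; elim: l l' => [|y l IH] [|y' l'] //=.
- by case.
- by case=> <-.
- by case=> ->.
- by case=> <- _ /IH [-> ->].
Qed.

Lemma bin_inj : injective bin.
Proof. by move=> n n' e; rewrite -(proj2 (bin_canonical n)) e (proj2 (bin_canonical n')). Qed.

Lemma enc_nat_inj n n' x x' : enc_nat n ++ x = enc_nat n' ++ x' -> n = n' /\ x = x'.
Proof. by rewrite !enc_nat_bits => /enc_bits_inj [/bin_inj -> ->]. Qed.

Lemma flatten_inj (T : Type) (enc : T -> seq bool) (s s' : seq T) x x' :
  (forall t t' y y', enc t ++ y = enc t' ++ y' -> t = t' /\ y = y') -> size s = size s' ->
  flatten (map enc s) ++ x = flatten (map enc s') ++ x' -> s = s' /\ x = x'.
Proof.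
move=> h; elim: s s' => [|t s IH] [|t' s'] //= [e].
by rewrite -!catA => /h [-> /(IH _ e) [-> ->]].
Qed.

Lemma enc_list_inj l l' x x' : enc_list l ++ x = enc_list l' ++ x' -> l = l' /\ x = x'.
Proof.
have E k y : enc_list k ++ y = enc_nat (size k) ++ (flatten (map enc_nat k) ++ y) by exact/esym/catA.
by rewrite !E => /enc_nat_inj [e]; apply: flatten_inj => // t t' y y' /enc_nat_inj.
Qed.

Fact catA4 (a b c d y : seq bool) :
  (a ++ (b ++ (c ++ d))) ++ y = a ++ (b ++ (c ++ (d ++ y))).
Proof. by rewrite -!catA. Qed.

Lemma enc_trans_inj t t' x x' : enc_trans t ++ x = enc_trans t' ++ x' -> t = t' /\ x = x'.
Proof.
have E r y : enc_trans r ++ y = enc_nat (t_src r) ++ (enc_nat (t_let r) ++ (enc_nat (t_dst r) ++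
    (enc_list (t_col r) ++ y))) by exact: catA4.
rewrite !E; case: t t' => a b c d [a' b' c' d'].
by move=> /enc_nat_inj [/= -> /enc_nat_inj [-> /enc_nat_inj [-> /enc_list_inj [-> ->]]]].
Qed.

Fact catA6 (a b c d e f y : seq bool) :
  (a ++ (b ++ (c ++ (d ++ (e ++ f))))) ++ y = a ++ (b ++ (c ++ (d ++ (e ++ (f ++ y))))).
Proof. by rewrite -!catA. Qed.

Lemma enc_inst_inj A n A' n' : enc_inst A n = enc_inst A' n' -> A = A' /\ n = n'.
Proof.
have E B k : enc_inst B k = enc_unary (a_nQ B) ++ (enc_unary (a_nS B) ++ (enc_unary (a_nC B) ++
    (enc_nat (a_init B) ++ (enc_nat (size (a_tr B)) ++ (flatten (map enc_trans (a_tr B)) ++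
    (enc_nat k ++ [::])))))) by rewrite cats0; exact: catA6.
rewrite !E; case: A A' => [q s c i t] [q' s' c' i' t'] /=.
move=> /enc_unary_inj [-> /enc_unary_inj [-> /enc_unary_inj [-> /enc_nat_inj [-> /enc_nat_inj [e]]]]].
by move=> /(flatten_inj enc_trans_inj e) [-> /enc_nat_inj [->]].
Qed.

(** * The reduction *)

(* Truncation below a constant makes arbitrary predicates definable, by a finite case distinction. *)
Definition tb1 n (P : nat -> bool) a := (a < n) && P a.
Definition tb2 n (Q : nat -> nat -> bool) a a' := [&& a < n, a' < n & Q a a'].

Lemma B_tb1 k n P (a : (nat -> bool) -> envT k -> nat) : definable a ->
  bdefinable (fun s t => tb1 n P (a s t)).
Proof.
move=> ha; elim: n => [|n IH]; first exact: B_cst.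
apply: (B_ext (Q := fun s t => tb1 n P (a s t) || ((a s t == n) && P n))); last first.
  by apply: B_or => //; dtac.
move=> s t; rewrite /tb1 ltnS leq_eqVlt; case: eqP => [->|]; rewrite ?ltnn ?orbF //.
Qed.

Lemma B_tb2 k n Q (a a' : (nat -> bool) -> envT k -> nat) : definable a -> definable a' ->
  bdefinable (fun s t => tb2 n Q (a s t) (a' s t)).
Proof.
move=> ha ha'.
have H m : bdefinable (fun s t => (a s t < m) && tb1 n (Q (a s t)) (a' s t)).
  elim: m => [|m IH]; first exact: B_cst.
  apply: (B_ext (Q := fun s t => ((a s t < m) && tb1 n (Q (a s t)) (a' s t)) ||
     ((a s t == m) && tb1 n (Q m) (a' s t)))); last first.
    by apply: B_or => //; apply: B_and; [dtac | apply: B_tb1].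
  move=> s t; rewrite ltnS leq_eqVlt; case: eqP => [->|]; rewrite ?ltnn ?orbF //.
by apply: B_ext (H n) => s t; rewrite /tb2 /tb1.
Qed.

Section Reduction.
Variables (M : TM) (c : nat).
Notation n := #|{: tcell M}|.
Let d0 : tcell M := (None, None).
Definition dv (a : nat) : tcell M := nth d0 (enum {: tcell M}) a.

Definition tT m := c * m ^ c + c.
Definition tW m := tT m + tT m + 3.
Definition tK m := (tT m).+1 * tW m.
Definition tpar m P := odd (P %/ tW m).

Definition tU (s : nat -> bool) m P a :=
  let t := P %/ tW m in let i := P %% tW m in
  [&& tb1 n (fun a => tvalid (dv a)) a,
      ((i == 0) || (i == tW m - 1)) ==> tb1 n (fun a => headless (dv a)) a,
      (t == 0) ==>
        ((if i == (tT m).+1 then tb1 n (fun a => tstart (dv a)) a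
          else tb1 n (fun a => headless (dv a)) a) &&
         (if ((tT m).+1 <= i) && (i - (tT m).+1 < m)
          then (if s (i - (tT m).+1) then tb1 n (fun a => (dv a).1 == Some (inl true)) a
                else tb1 n (fun a => (dv a).1 == Some (inl false)) a)
          else tb1 n (fun a => (dv a).1 == None) a)) &
      (t == tT m) ==> tb1 n (fun a => taccept (dv a)) a].

Definition tC m P a P' a' :=
  let t := P %/ tW m in let i := P %% tW m in
  let t' := P' %/ tW m in let i' := P' %% tW m in
  (t' == t.+1) &&
  [|| (i' == i) && tb2 n (fun a a' => ~~ tlink None (dv a) (dv a')) a a',
      (i' == i.+1) && tb2 n (fun a a' => ~~ tlink (Some true) (dv a) (dv a')) a a' |
      (i == i'.+1) && tb2 n (fun a a' => ~~ tlink (Some false) (dv a) (dv a')) a a'].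

Lemma dv_index (d : tcell M) : index d (enum {: tcell M}) < n /\
  dv (index d (enum {: tcell M})) = d.
Proof. by rewrite /dv nth_index ?mem_enum // cardE index_mem mem_enum. Qed.

Lemma tU_unary w P a : a < n ->
  tU (nth false w) (size w) P a =
  tunary w (tT (size w)) (P %/ tW (size w)) (P %% tW (size w)) (dv a).
Proof.
move=> ha; rewrite /tU /tunary /tb1 ha /= -subn1 -/(tW (size w)).
set i := P %% _; congr [&& _, _, _ ==> (_ && _) & _].
have -> : symat (init_cfg M w) (tT (size w)).+1 i =
    if ((tT (size w)).+1 <= i) && (i - (tT (size w)).+1 < size w)
    then Some (inl (nth false w (i - (tT (size w)).+1))) else None.
  rewrite /symat /init_cfg; move: (tT (size w)).+1 => T1.
  case: (ltngtP i T1) => h; rewrite ?h.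
  - by case: (w) => [|x l] /=; rewrite nth_nil.
  - case: (w) => [|x l] /=; first by rewrite nth_nil.
    have -> : i - T1 = (i - T1.+1).+1 by lia.
    rewrite ltnS /=; case: ltnP => h'; first by rewrite (nth_map false).
    by rewrite nth_default ?size_map.
  - by rewrite subnn; case: (w).
by case: ifP => // _; case: nth.
Qed.

Lemma tC_par m P a P' a' : tC m P a P' a' -> P < P' /\ tpar m P != tpar m P'.
Proof.
rewrite /tC /tpar => /andP[/eqP e _]; rewrite e /=; split; last by case: odd.
rewrite ltnNge; apply/negP => h; have := leq_div2r (tW m) h.
by rewrite e ltnn.
Qed.

Lemma tableau_solution w : accepting M w (tT (size w)) <->
  exists val, solution (tK (size w)) n (tU (nth false w) (size w)) (tC (size w)) val.
Proof.
set m := size w; have W0 : 0 < tW m by rewrite /tW addn3.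
split.
  move=> /tableau_complete [tv [H1 H2]].
  pose val P := index (tv (P %/ tW m) (P %% tW m)) (enum {: tcell M}).
  exists val; split.
    move=> P hP; have [h1 h2] := dv_index (tv (P %/ tW m) (P %% tW m)); split=> //.
    rewrite tU_unary // h2; apply: H1; last by rewrite ltn_mod.
    by rewrite -ltnS ltn_divLR.
  move=> P P' hP hP'; apply/negP => /andP[/eqP et].
  have [_ h2] := dv_index (tv (P %/ tW m) (P %% tW m)).
  have [_ h3] := dv_index (tv (P' %/ tW m) (P' %% tW m)).
  have tlt : P %/ tW m < tT m by rewrite -ltnS -et ltn_divLR.
  have iW : P %% tW m < tW m by rewrite ltn_mod.
  have iW' : P' %% tW m < tW m by rewrite ltn_mod.
  rewrite et in h3.
  case/or3P => /andP[/eqP ei /and3P[_ _]]; rewrite /val et h2 h3 => /negP; apply.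
  - by have := H2 _ _ None tlt iW; rewrite /= -ei => h; apply: h.
  - by have := H2 _ _ (Some true) tlt iW; rewrite /= -ei => h; apply: h.
  - have := H2 _ _ (Some false) tlt iW; rewrite /= ei /= => h; apply: h => //.
case=> val [H1 H2].
have idx t i : i < tW m -> ((t * tW m + i) %/ tW m = t) * ((t * tW m + i) %% tW m = i).
  by move=> hi; rewrite divnMDl // divn_small // addn0 modnMDl modn_small.
have lt t i : t <= tT m -> i < tW m -> t * tW m + i < tK m.
  by rewrite /tK => h1 h2; nia.
apply: (@tableau_sound M w (tT m) (fun t i => dv (val (t * tW m + i)))); split.
  move=> t i ht hi; have [h1 h2] := H1 _ (lt t i ht hi).
  by move: h2; rewrite tU_unary // !idx.
move=> t i mv ht hi hmv hi'.
have [a1 _] := H1 _ (lt t i (ltnW ht) hi); have [a2 _] := H1 _ (lt t.+1 _ ht hi').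
have := H2 _ _ (lt t i (ltnW ht) hi) (lt t.+1 _ ht hi').
rewrite /tC !idx // eqxx /= !negb_or => /and3P[n1 n2 n3].
move: hmv hi' a2 n1 n2 n3; case: mv => [[]|] /= hmv hi' a2 n1 n2 n3.
- by move: n2; rewrite eqxx /tb2 a1 a2 /= negbK.
- move: n3; have -> : i.-1.+1 = i by have := hmv erefl; lia.
  by rewrite eqxx /tb2 a1 a2 /= negbK.
- by move: n1; rewrite eqxx /tb2 a1 a2 /= negbK.
Qed.

Definition rN := csN n.
Definition rV m := csV (tK m) n.
Definition rE s m := csE (tK m) n (tpar m) (tU s m) (tC m).
Definition raut s m := gaut (rV m) rN (rE s m) (rV m) id.

Lemma n_gt0 : 0 < n.
Proof. by apply/card_gt0P; exists d0. Qed.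

Lemma rE_lt s m u v : rE s m u v -> u < v < rV m.
Proof. by case/and3P => -> ->. Qed.

Lemma rN0 : 0 < rN. Proof. by rewrite /rN /csN addn1. Qed.
Lemma rV0 m : 0 < rV m. Proof. by rewrite /rV /csV ltn_addr // rN0. Qed.

Theorem reduction_correct b w : accepting M w (tT (size w)) <->
  MIN b (enc_inst (raut (nth false w) (size w)) (rN + rN)).
Proof.
rewrite tableau_solution.
have hp := @tC_par (size w).
have idV x : x < rV (size w) -> id x < rV (size w) by [].
split.
  case=> val /(sol_colour hp) [col [h1 h2]].
  exists (raut (nth false w) (size w)), (rN + rN); split=> //.
    exact: (@gaut_wf _ _ _ rN0 (rV0 _) _ id (fun x hx => hx)).
  exists (gaut (rV (size w)) rN (rE (nth false w) (size w)) rN col); split=> //.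
    exact: (gaut_wf _ rN0 (rV0 _) h1).
  move=> v hv; exact: (colouring_equiv rN0 (rV0 _) b h1 h2).
case=> A [k [/enc_inst_inj [<- <-] _ [B [wB nB sB eqv]]]].
have E0 : rE (nth false w) (size w) 0 1.
  have n0 := n_gt0; have h : 1 < rN by rewrite /rN /csN; lia.
  by rewrite /rE /csE h andbT /=; apply: leq_trans h _; rewrite /rV /csV leq_addr.
have [col [h1 h2]] := equiv_colouring rN0 (rV0 (size w)) (@rE_lt _ (size w)) E0 wB sB nB eqv.
exact: (colour_sol hp h1 h2).
Qed.

End Reduction.

Section ReductionDefinable.
Variables (M : TM) (c k : nat).
Implicit Types a u v m P : (nat -> bool) -> envT k -> nat.

Lemma D_tT m : definable m -> definable (fun s t => tT c (m s t)).
Proof. by move=> hm; rewrite /tT; dtac. Qed.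

Lemma D_tW m : definable m -> definable (fun s t => tW c (m s t)).
Proof. by move=> /D_tT hm; rewrite /tW; dtac. Qed.

Lemma D_rV m : definable m -> definable (fun s t => rV M c (m s t)).
Proof. by move=> hm; have hT := D_tT hm; have hW := D_tW hm; rewrite /rV /csV /tK; dtac. Qed.

Lemma B_tpar m P : definable m -> definable P -> bdefinable (fun s t => tpar c (m s t) (P s t)).
Proof. by move=> /D_tW hm hP; apply: B_odd; dtac. Qed.

Lemma B_tU m P a : definable m -> definable P -> definable a ->
  bdefinable (fun s t => tU M c s (m s t) (P s t) (a s t)).
Proof.
move=> hm hP ha; have hT := D_tT hm; have hW := D_tW hm.
rewrite /tU; repeat (cbv beta; lazymatch goal with
  | |- bdefinable (fun s t => tb1 _ _ _) => apply: B_tb1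
  | |- _ => dstep end).
Qed.

Lemma B_tC m P a P' a' : definable m -> definable P -> definable a ->
  definable P' -> definable a' ->
  bdefinable (fun s t => tC M c (m s t) (P s t) (a s t) (P' s t) (a' s t)).
Proof.
move=> hm hP ha hP' ha'; have hT := D_tT hm; have hW := D_tW hm.
rewrite /tC; repeat (cbv beta; lazymatch goal with
  | |- bdefinable (fun s t => tb2 _ _ _ _) => apply: B_tb2
  | |- _ => dstep end).
Qed.

Lemma B_rE m u v : definable m -> definable u -> definable v ->
  bdefinable (fun s t => rE M c s (m s t) (u s t) (v s t)).
Proof.
move=> hm hu hv; have := D_rV hm; rewrite /rV => hV; rewrite /rE /csE /csP /csj.
repeat (cbv beta; lazymatch goal with
  | |- bdefinable (fun s t => tpar _ _ _) => apply: B_tpar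
  | |- bdefinable (fun s t => tU _ _ _ _ _ _) => apply: B_tU
  | |- bdefinable (fun s t => tC _ _ _ _ _ _ _) => apply: B_tC
  | |- _ => dstep end).
Qed.

End ReductionDefinable.

Section Hardness.
Variables (M : TM) (c : nat).

Ltac rtac := repeat (cbv beta; lazymatch goal with
  | |- definable (fun s t => rV _ _ _) => apply: D_rV
  | |- bdefinable (fun s t => rE _ _ _ _ _ _) => apply: B_rE
  | |- _ => dstep end).

Lemma raut_definable :
  odefinable (fun s (t : envT 1) => enc_inst (raut M c s t.2) (rN M + rN M)).
Proof.
rewrite /enc_inst; apply: O_cat; last by apply: O_enc_nat; dtac.
rewrite /raut /gaut /tabaut /gS.
apply: O_enc_aut; rewrite /gdef /gdst; try by rtac.
apply: (O_enc_list (b := fun s (t : envT 2) => rV M c t.1.2 * rV M c t.1.2)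
  (f := fun _ _ i => i)); rewrite /glab; rtac.
Qed.

End Hardness.

Theorem MIN_hard b : NP_hard (MIN b).
Proof.
move=> L [M [c hL]].
exists (fun w => enc_inst (raut M c (nth false w) (size w)) (rN M + rN M)); split.
  by apply: (@poly_computable_definable
    (fun s m => enc_inst (raut M c s m) (rN M + rN M)) _ (raut_definable M c)).
by move=> w; rewrite -reduction_correct hL.
Qed.

Theorem theorem29 : NP_complete DGBW_min /\ NP_complete DGCW_min.
Proof.
split.
  exact: (NP_complete_ext DGBW_MIN (conj (MIN_in_NP _) (MIN_hard _))).
exact: (NP_complete_ext DGCW_MIN (conj (MIN_in_NP _) (MIN_hard _))).
Qed.
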